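(* Let $\mu_n^{\Xi}$ and $\mu_n^{\Lambda}$ be the empirical zero measures associated with the polynomials $\widetilde{\Xi}_n(y)=\Xi_n(\sqrt y)$ and $\widetilde{\Lambda}_n(y)=\Lambda_n(\sqrt y)$, respectively (defined in the context). Then both sequences $\mu_n^{\Xi}$ and $\mu_n^{\Lambda}$ converge weakly, as $n\to\infty$, to the same probability measure $\mu$, absolutely continuous on $(0,1)$, with density $$\rho(x)=\frac{2}{\sqrt{x}\,(1-x)\left(\log^2\!\frac{1-\sqrt{x}}{1+\sqrt{x}}+\pi^2\right)},\qquad 0<x<1,$$ and $\rho(x)=0$ for $x\notin(0,1)$.
   Context: Binomial coefficients satisfy $\binom{m}{\ell}=0$ whenever $\ell<0$ or $\ell>m$. The Eulerian number of type $A$, $\left\langle{m\atop k}\right\rangle$ ($m\ge1$, $0\le k\le m-1$), is the number of permutations of $\{1,\dots,m\}$ with exactly $k$ descents; equivalently $\sum_{j\ge0}(j+1)^m x^j=(1-x)^{-m-1}\sum_{k=0}^{m-1}\left\langle{m\atop k}\right\rangle x^k$ for $|x|<1$. The Eulerian number of type $B$, $\left\langle{m\atop k}\right\rangle^{B}$ ($m\ge0$, $0\le k\le m$), is determined by $\sum_{j\ge0}(2j+1)^m x^j=(1-x)^{-m-1}\sum_{k=0}^{m}\left\langle{m\atop k}\right\rangle^{B} x^k$ for $|x|<1$. For $n\ge1$ and $0\le t\le n-1$ let $$\mathcal C^{(B)}_{n,t}:=\sum_{k=0}^{n-1}\left\langle {2n-1 \atop k}\right\rangle^{B}(-1)^{k}\sum_{i=0}^{k}(-1)^i\binom{k}{i}\binom{2n-2k-1}{2t-2i+1},\quad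 \mathcal C^{(A)}_{n,t}:=\sum_{k=0}^{n-1}\left\langle {2n \atop k}\right\rangle(-1)^{k}\sum_{i=0}^{k}(-1)^i\binom{k}{i}\binom{2n-2k-1}{2t-2i+1},$$ $$\Xi_n(x):=\frac{(-1)^{n+1}}{2^{4n-2}(2n-1)!}\sum_{t=0}^{n-1}\mathcal C^{(B)}_{n,t}\,x^{2t},\qquad \Lambda_n(x):=\frac{2(-1)^{n+1}}{(2^{2n+1}-1)(2n)!}\sum_{t=0}^{n-1}\mathcal C^{(A)}_{n,t}\,x^{2t}.$$ These are even polynomials, and $\widetilde{\Xi}_n(y):=\Xi_n(\sqrt y)$, $\widetilde{\Lambda}_n(y):=\Lambda_n(\sqrt y)$ denote the polynomials in $y$ (of degree $n-1$) obtained by replacing $x^2$ by $y$. For $n\ge2$ all their zeros are real, simple and lie in $(0,1)$. The empirical zero measure of such a polynomial with zeros $\rho_1,\dots,\rho_{n-1}$ is the probability measure $\frac1{n-1}\sum_{k=1}^{n-1}\delta_{\rho_k}$ on $\mathbb R$. *)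

(* Defs.v *)
From HB Require Import structures.
From mathcomp Require Import all_boot all_order all_algebra all_fingroup.
From mathcomp Require Import polyrcf.
From mathcomp Require Import all_classical all_reals all_analysis.
From mathcomp Require Import ring lra.

Set Implicit Arguments.
Unset Strict Implicit.
Unset Printing Implicit Defensive.

Import Order.TTheory GRing.Theory Num.Theory.
Import numFieldNormedType.Exports.

Local Open Scope classical_set_scope.
Local Open Scope ring_scope.

(* The lower index is an integer because 2 t - 2 i + 1 may be negative; the upper
   one, 2 n - 2 k - 1 with k < n, is positive, so truncated subtraction is
   harmless there. *)
Definition binz (m : nat) (l : int) : nat :=
  if l is Posz l' then 'C(m, l') else 0%N.

Definition descents (m : nat) (s : 'S_m) : {set 'I_m * 'I_m} :=
  finset (fun ij : 'I_m * 'I_m => (ij.2 == ij.1.+1 :> nat) && (s ij.2 < s ij.1)%N).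

Definition eulerianA (m k : nat) : nat :=
  #|finset (fun s : 'S_m => #|descents s| == k)|.

Definition is_eulerianB_poly (R : realType) (m : nat) (p : {poly R}) : Prop :=
  (size p <= m.+1)%N /\
  forall x : R, `|x| < 1 ->
    series (fun j : nat => (2 * j%:R + 1) ^+ m * x ^+ j) @ \oo
      --> (1 - x) ^- m.+1 * p.[x].

(* By [eulerianB_poly_ex] below the default value 0 is never used; the polynomial
   is unique because its values on ]-1, 1[ are prescribed. *)
Definition eulerianB_poly (R : realType) (m : nat) : {poly R} :=
  xget 0 (@is_eulerianB_poly R m).

Definition eulerianB (R : realType) (m k : nat) : R := (eulerianB_poly R m)`_k.

Section EulerianBExistence.
Variable R : realType.

Lemma cvg0_contraction (x : R) (e w : nat -> R) : `|x| < 1 ->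
  (forall n, e n.+1 = x * e n + w n) -> w @ \oo --> (0 : R) -> e @ \oo --> (0 : R).
Proof.
move=> x1 eE w0.
apply/cvgr0Pnorm_le => eps eps0.
have d0 : 0 < eps / 2 * (1 - `|x|) by rewrite mulr_gt0 ?divr_gt0 ?subr_gt0.
move/cvgr0Pnorm_le : w0 => /(_ _ d0)[N _ Nw].
have eb k : `|e (k + N)%N| <= `|x| ^+ k * `|e N| + eps / 2.
  elim: k => [|k ih].
    by rewrite add0n expr0 mul1r lerDl divr_ge0 // ltW.
  rewrite addSn eE (le_trans (ler_normD _ _))// normrM exprS.
  have wk := Nw (k + N)%N (leq_addl _ _).
  apply: (le_trans (lerD (ler_wpM2l (normr_ge0 x) ih) wk)).
  by rewrite mulrDr mulrA -addrA lerD2l mulrBr mulr1 mulrC addrC subrK.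
have xk : (fun k => `|x| ^+ k * `|e N|) @ \oo --> (0 : R).
  rewrite -[X in _ --> X](mul0r `|e N|); apply: cvgMr_tmp.
  by apply: cvg_expr; rewrite normr_id.
have e20 : 0 < eps / 2 by rewrite divr_gt0.
move/cvgr0Pnorm_le : xk => /(_ _ e20)[M _ MM].
exists (M + N)%N => // n /= MNn.
have Nn : (N <= n)%N by rewrite (leq_trans _ MNn)// leq_addl.
rewrite -(subnK Nn) (le_trans (eb _))// [leRHS](splitr eps) lerD2r.
by rewrite (le_trans (ler_norm _))// MM//= leq_subRL// addnC.
Qed.

Lemma eulerianB_poly_ex (m : nat) : exists p : {poly R}, is_eulerianB_poly m p.
Proof.
elim/ltn_ind: m => m ih.
have {ih}/choice[q qP] : forall i : 'I_m, exists p : {poly R}, is_eulerianB_poly i p.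
  by move=> i; exact: ih.
pose c (i : nat) : R := 2 ^+ (m - i) *+ 'C(m, i).
pose D : {poly R} := 1 - 'X.
exists (D ^+ m + 'X * \sum_(i < m) c i *: (D ^+ (m - i.+1) * q i)).
have sD n : (size (D ^+ n) <= n.+1)%N.
  apply: leq_trans (size_poly_exp_leq _ _) _.
  by rewrite /D -opprB size_polyN size_XsubC mul1n.
split.
  apply: leq_trans (size_polyD _ _) _; rewrite geq_max sD /=.
  apply: leq_trans (size_polyMleq _ _) _; rewrite size_polyX /= ltnS.
  apply: leq_trans (size_sum _ _ _) _; apply/bigmax_leqP => i _.
  apply: leq_trans (size_scale_leq _ _) _.
  apply: leq_trans (size_polyMleq _ _) _.
  have [qi _] := qP i; have im := ltn_ord i.
  have := leq_add (sD (m - i.+1)%N) qi.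
  by rewrite addnS -subSn// subSS subnK ?(ltnW im)//; case: (_ + _)%N.
move=> x x1.
have x1_neq0 : 1 - x != 0.
  by rewrite subr_eq0; apply: contraTneq x1 => <-; rewrite normr1 ltxx.
pose S i := series (fun j : nat => (2 * j%:R + 1) ^+ i * x ^+ j : R).
pose v N := 1 + x * \sum_(i < m) c i * S i N.
pose Lv := 1 + x * \sum_(i < m) c i * ((1 - x) ^- i.+1 * (q i).[x]).
have vLv : v @ \oo --> Lv.
  apply: cvgD; first exact: cvg_cst.
  apply: cvgM; first exact: cvg_cst.
  elim: (index_enum _) => [|i r ih].
    rewrite big_nil; under eq_fun do rewrite big_nil; exact: cvg_cst.
  rewrite big_cons; under eq_fun do rewrite big_cons.
  apply: cvgD ih; apply: cvgM; first exact: cvg_cst.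
  by have [_] := qP i; exact.
have SE N : S m N.+1 = x * S m N + v N.
  rewrite /S /v /series /= big_nat_recl//= mulr0 add0r expr1n expr0 mulr1.
  rewrite addrCA; congr (1 + _).
  under [X in _ + x * X]eq_bigr do rewrite mulr_sumr.
  rewrite exchange_big /= !mulr_sumr -big_split /=; apply: eq_bigr => j _.
  have -> : 2 * j.+1%:R + 1 = 2 + (2 * j%:R + 1) :> R by rewrite -natr1; ring.
  rewrite exprDn big_ord_recr /= subnn expr0 mul1r binn mulr1n exprS.
  rewrite mulrDl addrC mulrCA; congr (_ + _); last by rewrite mulrCA.
  rewrite mulr_suml; congr (_ * _); apply: eq_bigr => i _.
  by rewrite /c !mulrnAl mulrA.
set L := (X in _ --> X).
have LE : L = x * L + Lv.
  suff : (1 - x) * L = Lv by move=> <-; ring.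
  have DE n : (D ^+ n).[x] = (1 - x) ^+ n.
    by rewrite horner_exp /D hornerD hornerN hornerX hornerC.
  rewrite /L /Lv hornerD hornerM hornerX DE horner_sum.
  have E : (1 - x) * (1 - x) ^- m.+1 = (1 - x) ^- m by rewrite exprS invfM mulVKf.
  rewrite mulrA [X in X * _ = _]E mulrDr mulVf ?expf_neq0//; congr (1 + _).
  rewrite [LHS]mulrCA; congr (x * _).
  rewrite mulr_sumr; apply: eq_bigr => i _.
  rewrite hornerZ hornerM DE [LHS]mulrCA; congr (c i * _).
  rewrite mulrA; congr (_ * _).
  rewrite -{1}(subnK (ltn_ord i)) exprD invfM mulrAC mulVf ?mul1r//.
  by rewrite expf_neq0.
have : (fun N => S m N - L) @ \oo --> (0 : R).
  apply: (@cvg0_contraction x _ (fun N => v N - Lv)) => // [N|].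
    by rewrite SE {1}LE; ring.
  by rewrite -(subrr Lv); apply: cvgB => //; exact: cvg_cst.
by move/subr_cvg0.
Qed.
End EulerianBExistence.

Definition CB (R : realType) (n t : nat) : R :=
  \sum_(k < n) eulerianB R (2 * n - 1) k * (-1) ^+ k *
    \sum_(i < k.+1) (-1) ^+ i * 'C(k, i)%:R
      * (binz (2 * n - 2 * k - 1) ((2 * t + 1)%:Z - (2 * i)%:Z))%:R.

Definition CA (R : realType) (n t : nat) : R :=
  \sum_(k < n) (eulerianA (2 * n) k)%:R * (-1) ^+ k *
    \sum_(i < k.+1) (-1) ^+ i * 'C(k, i)%:R
      * (binz (2 * n - 2 * k - 1) ((2 * t + 1)%:Z - (2 * i)%:Z))%:R.

Definition Xi (R : realType) (n : nat) : {poly R} :=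
  ((-1) ^+ n.+1 / (2 ^+ (4 * n - 2) * ((2 * n - 1)`!)%:R))
    *: \sum_(t < n) CB R n t *: 'X^(2 * t).

Definition Lambda (R : realType) (n : nat) : {poly R} :=
  (2 * (-1) ^+ n.+1 / ((2 ^+ (2 * n).+1 - 1) * ((2 * n)`!)%:R))
    *: \sum_(t < n) CA R n t *: 'X^(2 * t).

(* [even_poly p] has coefficients p`_(2 i): for an even polynomial p it is the
   polynomial obtained by replacing 'X^2 with 'X. *)
Definition Xi_tilde (R : realType) (n : nat) : {poly R} := even_poly (Xi R n).
Definition Lambda_tilde (R : realType) (n : nat) : {poly R} :=
  even_poly (Lambda R n).

(* [rootsR p] lists the distinct real roots, whereas the normalisation is by the
   degree. The zeros of [Xi_tilde R n] and [Lambda_tilde R n] are all real and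
   simple for n >= 2, so this is the average of the Dirac masses at the zeros;
   for a general p the total mass is 1 only if this holds. *)
Definition empirical_zero_measure (R : realType) (p : {poly R}) :
    {measure set (measurableTypeR R) -> \bar R} :=
  mscale (((size p).-1%:R^-1)%:nng : {nonneg R})
    (msum (fun k => @dirac _ (measurableTypeR R) (rootsR p)`_k R)
       (size (rootsR p))).

Definition weakly_converges (R : realType)
    (mu_ : nat -> {measure set (measurableTypeR R) -> \bar R})
    (mu : {measure set (measurableTypeR R) -> \bar R}) : Prop :=
  forall f : R -> R, continuous f -> bounded_fun f ->
    (\int[mu_ n]_x (f x)%:E)%E @[n --> \oo] --> (\int[mu]_x (f x)%:E)%E.

Definition rho (R : realType) (x : R) : R :=
  if 0 < x < 1 then
    2 / (Num.sqrt x * (1 - x)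
         * (ln ((1 - Num.sqrt x) / (1 + Num.sqrt x)) ^+ 2 + pi ^+ 2))
  else 0.

(* Main.v *)
Require Import Defs.
From HB Require Import structures.
From mathcomp Require Import all_boot all_order all_algebra all_fingroup.
From mathcomp Require Import polyrcf complex.
From mathcomp Require Import all_classical all_reals all_analysis.
From mathcomp Require Import measurable_realfun.
From mathcomp Require Import ring lra zify.
Import Order.TTheory GRing.Theory Num.Theory.
Import numFieldNormedType.Exports.
Local Open Scope classical_set_scope.
Local Open Scope ring_scope.

Set Implicit Arguments.
Unset Strict Implicit.
Unset Printing Implicit Defensive.

(** Write x = tanh a, y = x^2. The symmetry of the Eulerian numbers folds the
    double sums defining the polynomials: for E either family,
      2 x sum_t C_(n,t) x^(2t) = sum_(k < 2n) E_k (-1)^k (1+x)^(2n-1-k) (1-x)^k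
    ([halved_sum]). For type A the right-hand side is, up to the factor
    - (1 - x^2), the derivative of order 2n of tanh at a
    ([tanh_poly_eulerianA]); for type B it is, up to the factor
    (-2)^(2n-1) cosh a, the derivative of order 2n - 1 of sech at a
    ([eulerianB_hom_conv]). Hence the zeros in y are images of the zeros in a of
    high derivatives of tanh and sech.

    The Taylor coefficients of tanh and sech at a are governed by the two poles
    a + s = i pi / 2 and a + s = - i pi / 2, the other ones being at distance at
    least sqrt (a^2 + (3 pi / 2)^2) from a. In polar form a = r cos t,
    pi / 2 = r sin t, the coefficient of s^m is, up to a positive factor and a
    sign depending on m only, cos ((m + 1) t) for tanh and sin ((m + 1) t) for
    sech, with a geometrically small relative error as long as r stays bounded
    ([tanh_asymptotics], [sech_asymptotics], [remainder_lt_main]). These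
    estimates come from the polynomials
    C_N(s) = ((1 + (a+s)/N)^N + (1 - (a+s)/N)^N) / 2, which tend to cosh (a + s)
    and have explicit simple roots: the coefficients of C_N' / C_N and 1 / C_N
    are sums over these roots by partial fractions ([partial_fraction_coef]),
    the roots other than the innermost two contribute a remainder bounded
    uniformly in N ([tail_bound]), and N tends to infinity ([triangular_cvg]).

    Put t = (pi / 2) (1 - v), so that a = (pi / 2) tan (pi v / 2). The cosine and
    the sine then alternate in sign at the equally spaced points
    v = (2i + 1) / (2n + 1), respectively v = (2i + 1) / (2n). So do the
    polynomials at the images y = [quantile v] of these points, for v <= eta < 1
    and n large ([Lambda_alternating], [Xi_alternating]), and each cell between
    two consecutive points contains a zero. As the degree is at most n - 1, the
    cells account for all but a fraction about 1 - eta of the zeros: in the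
    coordinate v the zeros are asymptotically uniform on (0, 1).

    Finally the inverse of [quantile] is
    (2 / pi) atan (ln ((1 + sqrt y) / (1 - sqrt y)) / pi), whose derivative is
    rho ([is_derive_cdf]). Thus rho is the density of the image under
    [quantile] of the uniform law, and the sums over the zeros of a bounded
    continuous function are compared with its integral by Riemann sums
    ([quadrature_error]). *)

(** * Eulerian numbers of type A: recurrence and symmetry *)

Section EulerianA.
Local Open Scope nat_scope.

(** Words are indexed by all of [nat], with a default letter past the end, so
    that positions before and after an insertion are compared without casts
    between ordinals. *)
Definition letter (m : nat) (s : 'S_m) (k : nat) : nat :=
  if insub k is Some i then s i else 0.

Lemma letterE m (s : 'S_m) (i : 'I_m) : letter s i = s i.
Proof. by rewrite /letter valK. Qed.

Lemma letter_lt m (s : 'S_m) k : k < m -> letter s k < m.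
Proof. by move=> km; rewrite (letterE s (Ordinal km)). Qed.

Lemma card_descents m (s : 'S_m) :
  #|descents s| = \sum_(0 <= k < m.-1) (letter s k.+1 < letter s k).
Proof.
rewrite /descents cardsE -sum1_card.
rewrite (eq_bigl (fun ij : 'I_m * 'I_m => true &&
  ((ij.2 == ij.1.+1 :> nat) && (s ij.2 < s ij.1)))); last by [].
rewrite -(pair_big_dep xpredT (fun i j : 'I_m => (j == i.+1 :> nat) && (s j < s i))
   (fun _ _ => 1)) /=.
case: m s => [|m] s; first by rewrite big_ord0 big_nil.
rewrite big_ord_recr /= [X in _ + X]big1 ?addn0; last first.
  by move=> j /andP[/eqP jE _]; have := ltn_ord j; rewrite jE ltnn.
rewrite big_mkord; apply: eq_bigr => i _.
set i0 := widen_ord _ _; pose i1 : 'I_m.+1 := lift ord0 i.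
rewrite big_mkcondr (big_pred1 i1) /=; last first.
  by move=> j; rewrite -[RHS]/(j == i1) -val_eqE
    /= /bump leq0n add1n.
rewrite -[letter s i.+1]/(letter s i1) -[letter s i]/(letter s i0) !letterE.
by case: ifP.
Qed.

(** A permutation of m + 1 letters arises in exactly one way from one of m
    letters by inserting the largest letter. *)
Lemma sum_lift_perm_max m (F : 'S_m.+1 -> nat) :
  \sum_s F s = \sum_(i < m.+1) \sum_(s : 'S_m) F (lift_perm i ord_max s).
Proof.
rewrite pair_big (reindex (fun p : 'I_m.+1 * 'S_m => lift_perm p.1 ord_max p.2)) //.
apply: onW_bij; apply: inj_card_bij => [[i s] [j t] /= E|].
  have ij : i = j.
    by apply: (@perm_inj _ (lift_perm i ord_max s)); rewrite {2}E !lift_perm_id.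
  rewrite -{}ij in E *; congr pair; apply/permP => k.
  apply: (@lift_inj _ ord_max).
  by rewrite -!(lift_perm_lift i) E.
by rewrite card_prod !card_Sn card_ord factS.
Qed.

Lemma letter_lift m (s : 'S_m) (i : 'I_m.+1) k : k < m.+1 ->
  letter (lift_perm i ord_max s) k =
    if k < i then letter s k else if k == i then m else letter s k.-1.
Proof.
move=> km; rewrite -[k]/(Ordinal km : nat) letterE.
case: (unliftP i (Ordinal km)) => [j jE|->].
  rewrite jE lift_perm_lift [in RHS]/= lift_max.
  rewrite /bump; case: (leqP i j) => ij.
    by rewrite add1n ltnNge leqW//= eqn_leq leqNgt ltnS ij//= letterE.
  by rewrite add0n ij letterE.
by rewrite lift_perm_id ltnn eqxx.
Qed.

(** Inserting the largest letter creates a descent just after it, unless it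
    comes last, and destroys the descent that it splits. The destroyed descent
    is added on the left to avoid a truncated subtraction. *)
Lemma card_descents_lift m (s : 'S_m.+1) (i : 'I_m.+2) :
  #|descents (lift_perm i ord_max s)| +
    ((0 < i < m.+1) && (letter s i < letter s i.-1)) =
  #|descents s| + (i < m.+1).
Proof.
rewrite !card_descents /=.
pose d k : nat := letter s k.+1 < letter s k.
have dE k : k < m.+1 ->
    (letter (lift_perm i ord_max s) k.+1 < letter (lift_perm i ord_max s) k) =
    (if k.+1 < i then d k else if k.+1 == i then 0 else if k == i then 1 else d k.-1)
    :> nat.
  move=> km; rewrite !letter_lift ?ltnS//; last exact: ltnW.
  have [k1i|ik|ki] := ltngtP k.+1 i.
  - by [].
  - rewrite /=; have [ki|ki] := eqVneq k i; first by rewrite letter_lt.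
    have k0 : 0 < k by rewrite lt0n; apply: contraTneq ik => k0; move: ki; rewrite k0; lia.
    by rewrite /d prednK.
  - by rewrite ltnNge (ltnW (letter_lt _ _)).
rewrite (eq_big_nat _ _ (F2 := fun k => if k.+1 < i then d k else
   if k.+1 == i then 0 else if k == i then 1 else d k.-1)); last first.
  by move=> k /andP[_ km]; rewrite dE.
under [in RHS]eq_bigr => k _ do rewrite -/(d k).
have dm i' : 0 < i' < m.+1 -> (letter s i' < letter s i'.-1) = d i'.-1 :> nat.
  by move=> /andP[i0 _]; rewrite /d prednK.
have lo j : j <= i -> \sum_(0 <= k < j.-1) (if k.+1 < i then d k else
   if k.+1 == i then 0 else if k == i then 1 else d k.-1) = \sum_(0 <= k < j.-1) d k.
  by move=> ji; apply: eq_big_nat => k /andP[_ kj]; rewrite ifT//; lia.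
have hi : \sum_(i.+1 <= k < m.+1) (if k.+1 < i then d k else
   if k.+1 == i then 0 else if k == i then 1 else d k.-1)
   = \sum_(i <= k < m) d k.
  rewrite big_add1 /=; apply: eq_big_nat => k /andP[ik km].
  by rewrite ifF ?ifF//; lia.
have := ltn_ord i; rewrite ltnS leq_eqVlt => /orP[/eqP im|im].
  rewrite im ltnn andbF addn0 addn0.
  rewrite big_nat_recr//= ltnn eqxx addn0.
  by have := lo m.+1; rewrite im => ->.
rewrite im andbT.
rewrite (@big_cat_nat _ _ _ i)//=; last exact: ltnW.
rewrite [X in _ + X + _]big_ltn// ltnNge leqnSn /= eqn_leq ltnn /= eqxx hi.
case: (posnP i) => [i0|i0].
  by rewrite i0 big_geq//= addn0 add0n addnC.
rewrite -(prednK i0) big_nat_recr//= prednK// ltnn eqxx addn0 (lo i)//.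
rewrite (@big_cat_nat _ _ _ i.-1 0 m)//=; last by lia.
rewrite [X in _ = _ + X + _]big_ltn; last by lia.
by rewrite prednK// dm ?i0//; lia.
Qed.

(** Of the m + 2 places for the largest letter, those inside one of the D
    descents and the last one keep D; the m + 1 - D others raise it by one. *)
Lemma eulerianA_rec_sum m k : eulerianA m.+2 k =
  \sum_(s : 'S_m.+1) ((#|descents s| == k) * #|descents s|.+1 +
     (#|descents s|.+1 == k) * (m.+1 - #|descents s|)).
Proof.
rewrite /eulerianA cardsE -sum1_card big_mkcond /= sum_lift_perm_max exchange_big /=.
apply: eq_bigr => s _.
pose D := #|descents s|.
pose b (i : 'I_m.+2) := (0 < i < m.+1) && (letter s i < letter s i.-1).
have sumb : \sum_(i < m.+2) b i = D.
  rewrite /D card_descents /= big_ord_recl big_ord_recr /= /b /= /bump /= !add1n ltnn.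
  rewrite add0n addn0 big_mkord; apply: eq_bigr => i _.
  by rewrite /bump /= !add1n ltnS ltn_ord.
have E i : #|descents (lift_perm i ord_max s)| = if b i || (i == ord_max) then D else D.+1.
  have := card_descents_lift s i; rewrite -/(b i) -/D -val_eqE /=.
  have bm : b i -> i < m.+1 by case/andP => /andP[].
  move: (ltn_ord i) bm; move: #|_| => d.
  by case: (b i); case: (ltngtP i m.+1) => //=; lia.
have bmax : b ord_max = false by rewrite /b /= ltnn.
have cnt : \sum_(i < m.+2) (b i || (i == ord_max)) = D.+1.
  rewrite big_ord_recr /= eqxx orbT addn1; congr _.+1.
  rewrite -[in RHS]sumb [in RHS]big_ord_recr /= bmax addn0.
  apply: eq_bigr => i _; rewrite -val_eqE /= (ltn_eqF (ltn_ord i)).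
  by rewrite orbF.
have cnt' : \sum_(i < m.+2) ~~ (b i || (i == ord_max)) = m.+1 - D.
  apply/eqP; rewrite -(eqn_add2l D.+1) -{1}cnt -big_split /=.
  rewrite (eq_bigr (fun=> 1)); last by move=> i _; case: (_ || _).
  rewrite sum_nat_const card_ord muln1 addSn subnKC//.
  rewrite -sumb big_ord_recr /= bmax addn0.
  apply: leq_trans (leq_sum _ (fun i _ => leq_b1 _)) _.
  by rewrite sum_nat_const card_ord muln1.
rewrite -{1}cnt -cnt' !big_distrr -big_split /=; apply: eq_bigr => i _.
rewrite -[lift_perm _ _ _ \in _]/(#|descents (lift_perm i ord_max s)| == k) E; case: (_ || _); rewrite /= ?muln0 ?muln1 ?addn0 ?add0n -/D.
all: by case: ifP.
Qed.

Lemma sum_descents_eq m k (c : nat) :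
  \sum_(s : 'S_m) (#|descents s| == k) * c = eulerianA m k * c.
Proof.
by rewrite -big_distrl /= /eulerianA cardsE -sum1_card [in RHS]big_mkcond.
Qed.

Lemma eulerianA_recS m k : eulerianA m.+2 k.+1 =
  k.+2 * eulerianA m.+1 k.+1 + (m.+1 - k) * eulerianA m.+1 k.
Proof.
rewrite eulerianA_rec_sum big_split /= ![_ * eulerianA _ _]mulnC.
rewrite -!sum_descents_eq; congr addn; apply: eq_bigr => s _.
  by case: eqP => [->|].
by rewrite eqSS; case: eqP => [->|].
Qed.

Lemma eulerianA_rec0 m : eulerianA m.+2 0 = eulerianA m.+1 0.
Proof.
rewrite eulerianA_rec_sum big_split /= [X in _ + X]big1 ?addn0//.
rewrite -[RHS]muln1 -sum_descents_eq; apply: eq_bigr => s _.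
by case: eqP => [->|].
Qed.

Lemma eulerianA1 k : eulerianA 1 k = (k == 0).
Proof.
have d0 s : #|@descents 1 s| = 0 by rewrite card_descents big_nil.
rewrite /eulerianA cardsE -sum1_card big_mkcond /=.
transitivity (\sum_(s : 'S_1) (k == 0 : nat)); last first.
  by rewrite sum_nat_const card_Sn mul1n.
apply: eq_bigr => s _.
by rewrite -[s \in _]/(#|descents s| == k) d0 eq_sym; case: ifP.
Qed.

Lemma eulerianA_eq0 m k : m < k.+1 -> eulerianA m.+1 k.+1 = 0.
Proof.
elim: m k => [|m IH] k mk; first by rewrite eulerianA1.
rewrite eulerianA_recS IH ?muln0; last exact: ltnW.
by rewrite (_ : m.+1 - k = 0)//; apply/eqP; rewrite subn_eq0.
Qed.

(** The map k -> m - k exchanges the two terms of the recurrence. *)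
Lemma eulerianA_sym m k : k <= m -> eulerianA m.+1 (m - k) = eulerianA m.+1 k.
Proof.
elim: m k => [|m IH] k km; first by case: k km.
case: k km => [_|k km].
  rewrite subn0 eulerianA_recS eulerianA_rec0 eulerianA_eq0// muln0 add0n.
  by have := IH 0 (leq0n m); rewrite subn0 => ->; rewrite subSnn mul1n.
rewrite subSS eulerianA_recS.
have [km'|] := ltnP k m; last first.
  move=> mk; have {mk km} -> : k = m by lia.
  rewrite subnn eulerianA_rec0 eulerianA_eq0// muln0 add0n subSnn mul1n.
  by have := IH 0 (leq0n m); rewrite subn0.
rewrite -(IH k); last exact: ltnW.
rewrite -(IH k.+1)//.
have -> : m - k = (m - k.+1).+1 by lia.
rewrite eulerianA_recS addnC; congr (_ * _ + _ * _); lia.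
Qed.
End EulerianA.

(** * Eulerian numbers of type B: convolution identity and symmetry *)

Section EulerianB.
Variable R : realType.
Implicit Types (m : nat) (x z : R).

Lemma eulerianB_polyP m : is_eulerianB_poly m (eulerianB_poly R m).
Proof. exact: xgetPex (eulerianB_poly_ex R m). Qed.

Lemma poly_eq_on_unit_ball (p q : {poly R}) :
  (forall z, `|z| < 1 -> p.[z] = q.[z]) -> p = q.
Proof.
move=> pq; apply/eqP; rewrite -subr_eq0.
pose zs := [seq (k.+2%:R^-1 : R) | k <- iota 0 (size (p - q))].
apply/eqP/(@roots_geq_poly_eq0 _ _ zs); last by rewrite size_map size_iota.
- apply/allP => _ /mapP[k _ ->]; rewrite rootE hornerD hornerN pq ?subrr//.
  rewrite ger0_norm ?invr_ge0// invf_lt1// ?ltr1n ?ltr0n//.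
- rewrite map_inj_uniq ?iota_uniq// => i j /invr_inj/eqP.
  by rewrite eqr_nat => /eqP [].
Qed.

(** By the binomial theorem the sums over i of C(m, i) (-1)^(m-i) (2j+1)^i and
    of C(m, i) (2j+1)^i are (2j)^m and (2j+2)^m, so the same combination of the
    defining series telescopes in j. *)
Lemma eulerianB_cvg_conv m z : `|z| < 1 ->
  \sum_(i < m.+1) ('C(m, i)%:R * ((-1) ^+ (m - i) - z)) *
     ((1 - z) ^- i.+1 * (eulerianB_poly R i).[z]) = (m == 0%N)%:R.
Proof.
move=> z1.
pose S i := series (fun j : nat => (2 * j%:R + 1) ^+ i * z ^+ j : R).
have Scvg i : S i @ \oo --> (1 - z) ^- i.+1 * (eulerianB_poly R i).[z].
  exact: (eulerianB_polyP i).2.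
pose T N := \sum_(i < m.+1) ('C(m, i)%:R * ((-1) ^+ (m - i) - z)) * S i N.
have Tcvg : T @ \oo --> \sum_(i < m.+1) ('C(m, i)%:R * ((-1) ^+ (m - i) - z)) *
     ((1 - z) ^- i.+1 * (eulerianB_poly R i).[z]).
  rewrite /T; elim: (index_enum _) => [|i r ih].
    by rewrite big_nil; under eq_fun do rewrite big_nil; exact: cvg_cst.
  rewrite big_cons; under eq_fun do rewrite big_cons.
  by apply: cvgD ih; apply: cvgM; [exact: cvg_cst|exact: Scvg].
have TE N : T N = (m == 0%N)%:R - z ^+ N * (2 * N%:R) ^+ m.
  (* The two binomial sums, with y = 2 j + 1. *)
  have step j : \sum_(i < m.+1) ('C(m, i)%:R * ((-1) ^+ (m - i) - z)) *
      ((2 * j%:R + 1) ^+ i * z ^+ j) =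
      z ^+ j * (2 * j%:R) ^+ m - z ^+ j.+1 * (2 * j.+1%:R) ^+ m.
    set y := 2 * j%:R + 1.
    have -> : 2 * j%:R = -1 + y :> R by rewrite /y; ring.
    have -> : 2 * j.+1%:R = 1 + y :> R by rewrite /y -natr1; ring.
    rewrite !exprDn !mulr_sumr -sumrB; apply: eq_bigr => i _.
    rewrite expr1n mul1r exprS -[X in z ^+ j * X]mulr_natr.
    rewrite -[X in z * z ^+ j * X]mulr_natr.
    by move: (_ ^+ i) ((-1) ^+ _) (z ^+ j) ('C(m, i)%:R) => a b c d; ring.
  have -> : T N = \sum_(0 <= j < N) (z ^+ j * (2 * j%:R) ^+ m -
      z ^+ j.+1 * (2 * j.+1%:R) ^+ m).
    rewrite /T /S /series /=; under eq_bigr do rewrite mulr_sumr.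
    by rewrite exchange_big /=; apply: eq_bigr => j _; rewrite step.
  elim: N => [|N IH]; last by rewrite big_nat_recr//= IH; ring.
  by rewrite big_nil expr0 mulr0 expr0n mul1r subrr.
have zN0 : (fun N => z ^+ N * (2 * N%:R) ^+ m) @ \oo --> (0 : R).
  have := cvg_series_cvg_0 (cvgP _ (Scvg m)).
  move=> /cvgr0Pnorm_le H; apply/cvgr0Pnorm_le => e e0.
  near=> N; apply: (@le_trans _ _ `|(2 * N%:R + 1) ^+ m * z ^+ N|); last first.
    by near: N; exact: (H e e0).
  rewrite mulrC !normrM; apply: ler_wpM2r => //; have N0 := ler0n R N.
  by rewrite !normrX; apply: lerXn2r; rewrite ?nnegrE// !ger0_norm; lra.
have : T @ \oo --> (m == 0%N)%:R - (0 : R).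
  have -> : T = (fun N => (m == 0%N)%:R - z ^+ N * (2 * N%:R) ^+ m) by apply/funext.
  by apply: cvgB zN0; exact: cvg_cst.
by rewrite subr0; apply: cvg_unique Tcvg.
Unshelve. all: by end_near. Qed.

(** Clearing denominators gives an identity between polynomials, which extends
    [eulerianB_cvg_conv] from the unit ball to all arguments. *)
Lemma eulerianB_poly_conv m z :
  \sum_(i < m.+1) ('C(m, i)%:R * (((-1) ^+ (m - i) - z) * (1 - z) ^+ (m - i))) *
     (eulerianB_poly R i).[z] = (m == 0%N)%:R * (1 - z).
Proof.
pose P : {poly R} := \sum_(i < m.+1) ('C(m, i)%:R *: 
   ((((-1) ^+ (m - i))%:P - 'X) * (1 - 'X) ^+ (m - i) * eulerianB_poly R i)).
have PE y : P.[y] = \sum_(i < m.+1) ('C(m, i)%:R * (((-1) ^+ (m - i) - y) *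
    (1 - y) ^+ (m - i))) * (eulerianB_poly R i).[y].
  rewrite horner_sum; apply: eq_bigr => i _.
  by rewrite hornerZ !hornerM horner_exp !hornerD !hornerN !hornerX !hornerC !mulrA.
rewrite -PE; suff -> : P = (m == 0%N)%:R *: (1 - 'X).
  by rewrite hornerZ hornerD hornerN hornerX hornerC.
apply: poly_eq_on_unit_ball => y y1.
have y10 : 1 - y != 0.
  by rewrite subr_eq0; apply: contraTneq y1 => <-; rewrite normr1 ltxx.
rewrite PE hornerZ hornerD hornerN hornerX hornerC.
have -> : (m == 0%N)%:R * (1 - y) = (m == 0%N)%:R * (1 - y) ^+ m.+1.
  by case: (m) => [|k]; rewrite ?expr1// !mul0r.
rewrite -(eulerianB_cvg_conv m y1) mulr_suml; apply: eq_bigr => i _.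
have im : (i <= m)%N by rewrite -ltnS.
have -> : (1 - y) ^+ m.+1 = (1 - y) ^+ (m - i) * (1 - y) ^+ i.+1.
  by rewrite -exprD addnS subnK.
have d0 : (1 - y) ^+ i.+1 != 0 by rewrite expf_neq0.
move: (eulerianB_poly R i).[y] ((-1) ^+ (m - i) - y) ((1 - y) ^+ (m - i)).
move: 'C(m, i)%:R ((1 - y) ^+ i.+1) d0 => c d d0 p a e.
by rewrite -[in LHS](mulKf d0 p); ring.
Qed.

(** Strong induction on m: replacing y by 1/y in [eulerianB_poly_conv] and
    multiplying by - y^(m+1) reproduces the recursion. The recursion determines
    the value at y only for y <> 1, a restriction that a polynomial identity
    removes. *)
Lemma eulerianB_poly_symm m z : z != 0 ->
  (eulerianB_poly R m).[z] = z ^+ m * (eulerianB_poly R m).[z^-1].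
Proof.
move=> z0; elim/ltn_ind: m z z0 => m IH z z0.
suff H (y : R) : y != 0 -> y != 1 ->
    (eulerianB_poly R m).[y] = y ^+ m * (eulerianB_poly R m).[y^-1].
  (* The factor 'X * ('X - 1) below discards the two excluded values of y. *)
  pose q : {poly R} := \sum_(k < m.+1) (eulerianB_poly R m)`_(m - k) *: 'X^k.
  have pE y : y != 0 -> y ^+ m * (eulerianB_poly R m).[y^-1] = q.[y].
    move=> y0; rewrite (horner_coef_wide _ (eulerianB_polyP m).1) mulr_sumr.
    rewrite (reindex_inj rev_ord_inj) horner_sum; apply: eq_bigr => i _ /=.
    have im : (i <= m)%N by rewrite -ltnS.
    rewrite subSS hornerZ hornerXn mulrCA; congr (_ * _).
    have -> : y ^+ m = y ^+ i * y ^+ (m - i) by rewrite -exprD subnKC.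
    by rewrite exprVn mulfK// expf_neq0.
  have qE : 'X * (eulerianB_poly R m) * ('X - 1%:P) = 'X * q * ('X - 1%:P).
    apply: poly_eq_on_unit_ball => y _.
    rewrite !hornerM hornerXsubC hornerX.
    have [->|y0] := eqVneq y 0; first by rewrite !mul0r.
    have [->|y1] := eqVneq y 1; first by rewrite subrr !mulr0.
    by rewrite H// pE.
  have /mulfI E : 'X != 0 :> {poly R} by rewrite polyX_eq0.
  have : eulerianB_poly R m = q.
    by apply: E; apply: mulIf qE; rewrite polyXsubC_eq0.
  by rewrite pE// => <-.
move=> y0 y1.
have z10 : 1 - y != 0 by rewrite subr_eq0 eq_sym.
apply: (mulfI z10).
have := eulerianB_poly_conv m y; have := eulerianB_poly_conv m y^-1.
rewrite 2!big_ord_recr /= subnn !expr0 !mulr1 binn !mul1r.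
move=> H1 H2.
have {H2} -> : (1 - y) * (eulerianB_poly R m).[y] = (m == 0%N)%:R * (1 - y) -
   \sum_(i < m) ('C(m, i)%:R * (((-1) ^+ (m - i) - y) * (1 - y) ^+ (m - i))) *
     (eulerianB_poly R i).[y] by rewrite -H2 addrAC subrr add0r.
have -> : (1 - y) * (y ^+ m * (eulerianB_poly R m).[y^-1]) =
   - y ^+ m.+1 * ((1 - y^-1) * (eulerianB_poly R m).[y^-1]).
  rewrite mulrCA mulrA [RHS]mulrA; congr (_ * _); rewrite exprSr mulNr -mulrA.
  by rewrite [y * _]mulrBr mulr1 mulfV// -mulrN opprB mulrC.
have -> : (1 - y^-1) * (eulerianB_poly R m).[y^-1] = (m == 0%N)%:R * (1 - y^-1) -
   \sum_(i < m) ('C(m, i)%:R * (((-1) ^+ (m - i) - y^-1) * (1 - y^-1) ^+ (m - i))) *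
     (eulerianB_poly R i).[y^-1] by rewrite -H1 addrAC subrr add0r.
rewrite [RHS]mulrBr mulr_sumr; congr (_ - _).
  case: (m == 0%N) / eqP => [->|]; last by rewrite !mul0r mulr0.
  by rewrite !mul1r expr1 [RHS]mulrBr mulr1 mulNr mulfV// opprK addrC.
apply: eq_bigr => i _; rewrite IH//; move: (eulerianB_poly R i).[_] => p.
have im : (i <= m)%N by rewrite ltnW.
have -> : y ^+ m.+1 = y ^+ i * y ^+ (m - i) * y by rewrite -exprD subnKC// exprSr.
have -> : (1 - y) ^+ (m - i) = (-1) ^+ (m - i) * (y ^+ (m - i) * (1 - y^-1) ^+ (m - i)).
  rewrite -exprMn mulrBr mulr1 mulfV// -exprMn; congr (_ ^+ _); ring.
move: 'C(m, i)%:R (y ^+ i) (y ^+ (m - i)) ((1 - y^-1) ^+ (m - i)) => c a b d.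
have := sqrr_sign R (m - i); move: ((-1) ^+ (m - i)) => s s2.
have E : (s - y) * s = - ((s - y^-1) * y) by rewrite !mulrBl mulVf// -expr2 s2; ring.
transitivity (c * a * b * d * p * ((s - y) * s)); first by ring.
by rewrite E; ring.
Qed.

Lemma eulerianB_sym m k : (k <= m)%N -> eulerianB R m (m - k) = eulerianB R m k.
Proof.
move=> km; rewrite /eulerianB.
pose q : {poly R} := \poly_(k < m.+1) (eulerianB_poly R m)`_(m - k).
suff E : q = eulerianB_poly R m by rewrite -[in RHS]E coef_poly ltnS km.
suff : 'X * q = 'X * eulerianB_poly R m by move/mulfI; apply; rewrite polyX_eq0.
apply: poly_eq_on_unit_ball => y _; rewrite !hornerM hornerX.
have [->|y0] := eqVneq y 0; first by rewrite !mul0r.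
congr (_ * _); rewrite eulerianB_poly_symm//.
rewrite (horner_coef_wide _ (eulerianB_polyP m).1) mulr_sumr horner_poly.
rewrite [RHS](reindex_inj rev_ord_inj); apply: eq_bigr => i _ /=.
have im : (i <= m)%N by rewrite -ltnS.
rewrite subSS mulrCA; congr (_ * _).
have -> : y ^+ m = y ^+ i * y ^+ (m - i) by rewrite -exprD subnKC.
by rewrite exprVn mulfK// expf_neq0.
Qed.

(** At x = tanh a this is (-2)^m cosh a times the m-th derivative of sech at a,
    by [eulerianB_hom_conv]. *)
Definition eulerianB_hom m x : R :=
  \sum_(k < m.+1) eulerianB R m k * (-1) ^+ k * (1 + x) ^+ (m - k) * (1 - x) ^+ k.

Lemma eulerianB_homE m x : 1 + x != 0 ->
  eulerianB_hom m x = (1 + x) ^+ m * (eulerianB_poly R m).[- (1 - x) / (1 + x)].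
Proof.
move=> x1; rewrite (horner_coef_wide _ (eulerianB_polyP m).1) mulr_sumr.
apply: eq_bigr => i _; have im : (i <= m)%N by rewrite -ltnS.
have -> : (1 + x) ^+ m = (1 + x) ^+ (m - i) * (1 + x) ^+ i by rewrite -exprD subnK.
rewrite exprMn [(- (1 - x)) ^+ i]exprNn exprVn -/(eulerianB R m i).
have : (1 + x) ^+ i != 0 by rewrite expf_neq0.
move: (eulerianB _ _ _) ((-1) ^+ i) ((1 + x) ^+ (m - i)) ((1 + x) ^+ i).
by move=> a b c d d0; rewrite -[in LHS](mulKf d0 c); ring.
Qed.

(** At x = tanh a, the j-th derivative of cosh at a divided by cosh a. *)
Definition coshsinh x (j : nat) : R := if odd j then x else 1.

(** Case z = - (1 - x) / (1 + x), that is - exp (- 2a) for x = tanh a, of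
    [eulerianB_poly_conv]. It says that the exponential generating function of
    the normalised values is cosh a / cosh (a + s). *)
Lemma eulerianB_hom_conv m x : 1 + x != 0 ->
  \sum_(i < m.+1) 'C(m, i)%:R * coshsinh x (m - i) * (eulerianB_hom i x / (-2) ^+ i) =
  (m == 0%N)%:R.
Proof.
move=> x1.
have := eulerianB_poly_conv m (- (1 - x) / (1 + x)).
have -> : 1 - (- (1 - x) / (1 + x)) = 2 / (1 + x) by field.
move/(congr1 (fun y => (1 + x) ^+ m.+1 / 2 / (-2) ^+ m * y)) => H.
apply: etrans (etrans H _); last first.
  by case: (m) => [|k]; rewrite ?mul0r ?mulr0// eqxx expr1 expr0 /=; field.
rewrite mulr_sumr; apply: eq_bigr => i _; rewrite eulerianB_homE//.
have im : (i <= m)%N by rewrite -ltnS.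
move: (eulerianB_poly R i).[_] => p.
have E : (1 + x) * ((-1) ^+ (m - i) - - (1 - x) / (1 + x)) =
   2 * (-1) ^+ (m - i) * coshsinh x (m - i).
  by rewrite /coshsinh -signr_odd; case: odd; rewrite ?expr0 ?expr1; field.
have n2 k : (-2) ^+ k != 0 :> R by rewrite expf_neq0.
have -> : (-2) ^+ m = (-2) ^+ (m - i) * (-2) ^+ i :> R by rewrite -exprD subnK.
have -> : (1 + x) ^+ m.+1 = (1 + x) ^+ (m - i) * (1 + x) ^+ i * (1 + x).
  by rewrite -exprD subnK// exprSr.
have -> : (2 / (1 + x)) ^+ (m - i) = (-1) ^+ (m - i) * (-2) ^+ (m - i) / (1 + x) ^+ (m - i).
  by rewrite -exprMn -exprVn -exprMn mulN1r opprK.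
move: E (expf_neq0 (m - i) x1) (n2 i) (n2 (m - i)%N) (sqrr_sign R (m - i)).
move: ((-1) ^+ (m - i)) ((1 + x) ^+ (m - i)) ((-1) ^+ (m - i) - _ / _) => s a z.
move: ((-2) ^+ i) ((-2) ^+ (m - i)) (coshsinh x (m - i)) ('C(m, i)%:R) ((1 + x) ^+ i).
move=> b d g c e E a0 b0 d0 s2.
transitivity (c * p * e / b / 2 * s * ((1 + x) * z)); last by field; rewrite b0 d0 a0.
rewrite E; transitivity (c * g * e * p / b * s ^+ 2); last by field.
by rewrite s2; field.
Qed.
End EulerianB.

(** * The polynomials as derivatives of tanh and sech *)

Section DerivativePolynomials.
Variable R : realType.
Implicit Types (x : R) (m n : nat).

(** As tanh' = 1 - tanh^2, the derivative in a of p (tanh a) is the value of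
    this polynomial at tanh a. *)
Definition tanh_deriv (p : {poly R}) : {poly R} := (1 - 'X ^+ 2) * p^`().

(** The m-th derivative of tanh as a polynomial in tanh. *)
Definition tanh_poly m : {poly R} := iter m tanh_deriv 'X.

(** Pascal's rule, in the form in which it differentiates a Leibniz sum. *)
Lemma pascal_sum (S : comNzRingType) (a b : nat -> S) m :
  \sum_(i < m.+2) 'C(m.+1, i)%:R * a (m.+1 - i)%N * b i =
  \sum_(i < m.+1) 'C(m, i)%:R * (a (m.+1 - i)%N * b i + a (m - i)%N * b i.+1).
Proof.
rewrite big_ord_recl /= bin0 mul1r subn0.
under eq_bigr do rewrite /bump /= add1n subSS binS natrD !mulrDl.
under [RHS]eq_bigr do rewrite mulrDr.
rewrite !big_split /= addrA; congr (_ + _); last by apply: eq_bigr => i _; rewrite mulrA.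
rewrite big_ord_recr /= bin_small// !mul0r addr0 [RHS]big_ord_recl /= bin0 mul1r subn0.
by congr (_ + _); apply: eq_bigr => i _; rewrite /bump /= add1n subSS mulrA.
Qed.

Lemma tanh_derivM p q : tanh_deriv (p * q) = tanh_deriv p * q + p * tanh_deriv q.
Proof. by rewrite /tanh_deriv derivM mulrDr !mulrA; congr (_ + _); rewrite [p * _]mulrC. Qed.

Lemma tanh_derivD p q : tanh_deriv (p + q) = tanh_deriv p + tanh_deriv q.
Proof. by rewrite /tanh_deriv derivD mulrDr. Qed.

Definition coshsinh_poly (j : nat) : {poly R} := if odd j then 'X else 1.

Lemma tanh_deriv_coshsinh j :
  tanh_deriv (coshsinh_poly j) = coshsinh_poly j.+1 - 'X * coshsinh_poly j.
Proof.
rewrite /tanh_deriv /coshsinh_poly /=; case: odd => /=.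
  by rewrite derivX mulr1 expr2.
by rewrite -(polyC1 R) derivC mulr0 mulr1 subrr.
Qed.

(** Leibniz's rule for cosh * tanh = sinh, divided by cosh. *)
Lemma tanh_poly_conv_poly m :
  \sum_(i < m.+1) 'C(m, i)%:R * coshsinh_poly (m - i) * tanh_poly i =
  coshsinh_poly m.+1.
Proof.
elim: m => [|m IH]; first by rewrite big_ord1 bin0 !mul1r.
rewrite pascal_sum.
have -> : coshsinh_poly m.+2 = tanh_deriv (coshsinh_poly m.+1) + 'X * coshsinh_poly m.+1.
  by rewrite tanh_deriv_coshsinh subrK.
rewrite -IH (big_morph _ tanh_derivD (id1 := 0)); last by rewrite /tanh_deriv -(polyC0 R) derivC mulr0.
rewrite mulr_sumr -big_split /=; apply: eq_bigr => i _.
rewrite -!mulrA tanh_derivM [tanh_deriv 'C(m,i)%:R]/tanh_deriv -polyC_natr derivC mulr0 mul0r add0r.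
rewrite tanh_derivM tanh_deriv_coshsinh -/(tanh_poly i.+1) -[tanh_deriv (tanh_poly i)]/(tanh_poly i.+1).
rewrite -subSn; last by rewrite -ltnS.
by move: (coshsinh_poly _) (coshsinh_poly (m - i)) (tanh_poly _) (tanh_poly i) (_%:P) => *; ring.
Qed.

Lemma tanh_poly_conv m x :
  \sum_(i < m.+1) 'C(m, i)%:R * coshsinh x (m - i) * (tanh_poly i).[x] =
  coshsinh x m.+1.
Proof.
have cE j : (coshsinh_poly j).[x] = coshsinh x j.
  by rewrite /coshsinh_poly /coshsinh; case: odd; rewrite ?hornerX ?hornerC.
rewrite -cE -tanh_poly_conv_poly horner_sum; apply: eq_bigr => i _.
by rewrite !hornerM -polyC_natr hornerC cE.
Qed.

Definition eulerianA_hom m x : R :=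
  \sum_(k < m) (eulerianA m k)%:R * (-1) ^+ k * (1 + x) ^+ (m.-1 - k) * (1 - x) ^+ k.

Let u : {poly R} := 1 + 'X.
Let v : {poly R} := 1 - 'X.

Let D_uv i j : tanh_deriv (u ^+ i * v ^+ j) =
  i%:R * (u ^+ i * v ^+ j.+1) - j%:R * (u ^+ i.+1 * v ^+ j).
Proof.
have uv : 1 - 'X ^+ 2 = u * v by rewrite /u /v; ring.
have du : u^`() = 1 by rewrite /u derivD -(polyC1 R) derivC derivX add0r.
have dv : v^`() = -1 by rewrite /v derivB -(polyC1 R) derivC derivX sub0r.
have dX (p : {poly R}) n : (p ^+ n)^`() = n%:R * p^`() * p ^+ n.-1.
  by rewrite deriv_exp -[LHS]mulr_natl mulrA.
rewrite /tanh_deriv uv derivM !dX du dv.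
case: i j => [|i] [|j]; rewrite /= ?mulr0n ?expr0 !exprS.
- by move: u v => *; ring.
- by move: u v (v ^+ j) => *; ring.
- by move: u v (u ^+ i) => *; ring.
by move: u v (v ^+ j) (u ^+ i) => *; ring.
Qed.

(** With u = 1 + x and v = 1 - x, the derivation maps u^i v^j to
    i u^i v^(j+1) - j u^(i+1) v^j, so on the coefficients of these monomials it
    acts by the Eulerian recurrence. *)
Lemma tanh_poly_eulerianA_poly m : tanh_poly m.+1 = (-1) ^+ m *
  \sum_(k < m.+1) ((eulerianA m.+1 k)%:R * (-1) ^+ k * (u ^+ (m.+1 - k) * v ^+ k.+1)).
Proof.
elim: m => [|m IH].
  rewrite big_ord1 eulerianA1 /= /tanh_poly /= /tanh_deriv derivX /u /v.
  by rewrite !expr0 !expr1; ring.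
rewrite -[tanh_poly m.+2]/(tanh_deriv (tanh_poly m.+1)) IH.
have DC (c : {poly R}) p : c^`() = 0 -> tanh_deriv (c * p) = c * tanh_deriv p.
  by move=> c0; rewrite tanh_derivM {1}/tanh_deriv c0 mulr0 mul0r add0r.
have cst i j : (i%:R * (-1) ^+ j : {poly R})^`() = 0.
  have -> : i%:R * (-1) ^+ j = (i%:R * (-1) ^+ j)%:P :> {poly R}.
    by rewrite polyCM polyC_natr polyC_exp polyCN.
  by rewrite derivC.
rewrite DC; last by have := cst 1%N m; rewrite mul1r.
rewrite (big_morph _ tanh_derivD (id1 := 0)); last by rewrite /tanh_deriv -(polyC0 R) derivC mulr0.
rewrite exprS -mulrA [RHS]mulrCA; congr (_ * _).
under eq_bigr => k _ do rewrite (DC _ _ (cst _ _)) D_uv mulrBr.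
rewrite sumrB.
rewrite [X in _ = _ * X]big_ord_recl /= eulerianA_rec0 mulN1r opprD.
pose f k : {poly R} := (eulerianA m.+1 k)%:R * (-1) ^+ k *
  (k.+1%:R * (u ^+ (m.+1 - k).+1 * v ^+ k.+1)).
have -> : \sum_(k < m.+1) (eulerianA m.+1 k)%:R * (-1) ^+ k *
   (k.+1%:R * (u ^+ (m.+1 - k).+1 * v ^+ k.+1)) = f 0%N + \sum_(k < m.+1) f k.+1.
  transitivity (\sum_(k < m.+2) f k); last by rewrite big_ord_recl.
  by rewrite [RHS]big_ord_recr /= [f m.+1]/f eulerianA_eq0// !mul0r addr0.
rewrite addrC opprD -addrA; congr (_ + _).
  by rewrite /f !subn0 !expr0 !expr1; ring.
rewrite addrC -!sumrN -big_split /=; apply: eq_bigr => k _.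
have km : (k <= m)%N by rewrite -ltnS.
rewrite /f /bump /= !add1n eulerianA_recS !subSS natrD !natrM.
rewrite -subSn// [(-1) ^+ k.+1]exprS.
move: (_ ^+ (m.+1 - k)) (v ^+ k.+2) ((-1) ^+ k) (eulerianA _ k.+1)%:R (eulerianA _ k)%:R.
by move: (m.+1 - k)%:R k.+2%:R => *; ring.
Qed.

Lemma tanh_poly_eulerianA m x :
  (tanh_poly m.+1).[x] = (-1) ^+ m * (1 - x ^+ 2) * eulerianA_hom m.+1 x.
Proof.
have cst (a b : nat) y (p : {poly R}) : (a%:R * (-1) ^+ b * p).[y] = a%:R * (-1) ^+ b * p.[y].
  have -> : a%:R * (-1) ^+ b = (a%:R * (-1) ^+ b)%:P :> {poly R}.
    by rewrite polyCM polyC_natr polyC_exp polyCN.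
  by rewrite hornerM hornerC.
rewrite tanh_poly_eulerianA_poly hornerM -mulrA; congr (_ * _).
  by rewrite horner_exp hornerN -(polyC1 R) hornerC.
rewrite horner_sum /eulerianA_hom mulr_sumr; apply: eq_bigr => k _.
rewrite cst hornerM !horner_exp /u /v hornerD hornerD hornerN -(polyC1 R) !hornerC hornerX /=.
have km : (k <= m)%N by rewrite -ltnS.
rewrite subSn// !exprS; move: (_ ^+ (m - k)) ((1 - x) ^+ k) ((-1) ^+ k) (_%:R) => *; ring.
Qed.

Lemma big_ord_double (V : nmodType) (f : nat -> V) r :
  \sum_(i < r.*2) f i = \sum_(s < r) (f s.*2 + f s.*2.+1).
Proof.
elim: r => [|r IH]; first by rewrite !big_ord0.
by rewrite doubleS !big_ord_recr /= IH addrA.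
Qed.

Lemma odd_part_binomial r x : (1 + x) ^+ (r.*2.+1) - (1 - x) ^+ (r.*2.+1) =
  2 * x * \sum_(s < r.+1) 'C(r.*2.+1, s.*2.+1)%:R * x ^+ s.*2.
Proof.
rewrite !exprDn -sumrB.
rewrite (eq_bigr (fun i : 'I_(r.*2.+2) => (1 - (-1) ^+ i) * x ^+ i * 'C(r.*2.+1, i)%:R));
  last first.
  move=> i _; rewrite !expr1n !mul1r [(- x) ^+ i]exprNn.
  have MN (y : R) : y *+ 'C(r.*2.+1, i) = y * 'C(r.*2.+1, i)%:R by rewrite -[LHS]mulr_natr.
  by rewrite (MN (x ^+ i)) (MN (_ * x ^+ i)); move: (_%:R) (x ^+ i) ((-1) ^+ i) => *; ring.
rewrite -doubleS (big_ord_double (fun i => (1 - (-1) ^+ i) * x ^+ i * 'C(r.*2.+1, i)%:R)).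
rewrite mulr_sumr; apply: eq_bigr => s _.
rewrite [(-1) ^+ s.*2.+1]exprS -[(-1) ^+ s.*2]signr_odd odd_double expr0 subrr !mul0r add0r.
by rewrite exprS; ring.
Qed.

(** The coefficients of both families of polynomials have this form; only the
    symmetry of E matters for their generating function. *)
Definition halved_coef (E : nat -> R) (n t : nat) : R :=
  \sum_(k < n) E k * (-1) ^+ k *
    \sum_(i < k.+1) (-1) ^+ i * 'C(k, i)%:R
      * (binz (2 * n - 2 * k - 1) ((2 * t + 1)%:Z - (2 * i)%:Z))%:R.

Lemma sum_binz_shift i q r x :
  \sum_(t < i + (q + r.+1)) (binz r.*2.+1 ((2 * t + 1)%:Z - (2 * i)%:Z))%:R * x ^+ (2 * t) =
  x ^+ (2 * i) * \sum_(s < r.+1) 'C(r.*2.+1, s.*2.+1)%:R * x ^+ s.*2.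
Proof.
rewrite big_split_ord /= big1 ?add0r => [|t _]; last first.
  have ti := ltn_ord t.
  have : (2 * t + 1)%:Z - (2 * i)%:Z < 0 by lia.
  by case: (_ - _) => // l _; rewrite mul0r.
have E s : (2 * (i + s) + 1)%:Z - (2 * i)%:Z = s.*2.+1 :> int by lia.
under eq_bigr => t _ do rewrite E /= mulnDr exprD mulrCA.
rewrite -mulr_sumr; congr (_ * _).
rewrite addnC big_split_ord /= [X in _ + X]big1 ?addr0; last first.
  by move=> j _; rewrite bin_small ?mul0r//; lia.
by apply: eq_bigr => j _; rewrite mul2n.
Qed.

(** The inner sum is the coefficient of a product: (1 - x^2)^k times the odd
    part of (1 + x)^(2n-2k-1). *)
Lemma halved_term n k x : (k < n)%N ->
  2 * x * \sum_(t < n) (\sum_(i < k.+1) (-1) ^+ i * 'C(k, i)%:R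
      * (binz (2 * n - 2 * k - 1) ((2 * t + 1)%:Z - (2 * i)%:Z))%:R) * x ^+ (2 * t) =
  (1 - x ^+ 2) ^+ k * ((1 + x) ^+ (2 * n - 2 * k - 1) - (1 - x) ^+ (2 * n - 2 * k - 1)).
Proof.
move=> kn.
have [r rE] : exists r, n = (k + r.+1)%N by exists (n - k.+1)%N; rewrite addnS -addSn subnKC.
have dE : (2 * n - 2 * k - 1 = r.*2.+1)%N by rewrite rE; lia.
rewrite !dE odd_part_binomial mulrCA; congr (_ * _).
rewrite exprDn; under eq_bigr do rewrite mulr_suml.
rewrite exchange_big /= mulr_suml; apply: eq_bigr => i _.
have ik : (i <= k)%N by rewrite -ltnS.
have nE : n = (i + ((k - i) + r.+1))%N by rewrite addnA subnKC.
under eq_bigr do rewrite -mulrA.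
have S := sum_binz_shift i (k - i) r x; rewrite -nE in S.
rewrite -mulr_sumr S expr1n mul1r [(- x ^+ 2) ^+ i]exprNn -exprM.
rewrite -[X in _ = X * _]mulr_natr.
by move: (\sum_(_ < _) _) ('C(k, i)%:R) (x ^+ _) => *; ring.
Qed.

(** Pairing k with 2n - 1 - k, of opposite parity, leaves (1 - x^2)^k times an
    odd part, as in [halved_term]. *)
Lemma halved_sum (E : nat -> R) n x :
  (forall k, (k < 2 * n)%N -> E ((2 * n).-1 - k)%N = E k) ->
  2 * x * \sum_(t < n) halved_coef E n t * x ^+ (2 * t) =
  \sum_(k < 2 * n) E k * (-1) ^+ k * (1 + x) ^+ ((2 * n).-1 - k) * (1 - x) ^+ k.
Proof.
move=> Esym.
pose f k := E k * (-1) ^+ k * (1 + x) ^+ ((2 * n).-1 - k) * (1 - x) ^+ k.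
rewrite -[RHS](big_mkord xpredT f) (@big_cat_nat _ _ _ n)//=; last by lia.
rewrite [X in _ + X](_ : _ = \sum_(0 <= k < n) f ((2 * n).-1 - k)%N); last first.
  rewrite big_nat_rev /= -{1}[n]add0n big_addn.
  have -> : (2 * n - n = n)%N by lia.
  by apply: eq_big_nat => k kn; congr f; lia.
rewrite !big_mkord -big_split /=.
rewrite /halved_coef mulr_sumr; under [LHS]eq_bigr do rewrite big_distrl big_distrr /=.
rewrite exchange_big /=; apply: eq_bigr => k _; have kn := ltn_ord k.
transitivity (E k * (-1) ^+ k * (2 * x * \sum_(t < n) (\sum_(i < k.+1) (-1) ^+ i * 'C(k, i)%:R
      * (binz (2 * n - 2 * k - 1) ((2 * t + 1)%:Z - (2 * i)%:Z))%:R) * x ^+ (2 * t))).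
  rewrite !mulr_sumr; apply: eq_bigr => t _.
  by rewrite -!mulrA; move: (E k) ((-1) ^+ k) (x ^+ _) (\sum_(_ < _) _) => *; ring.
rewrite halved_term// /f Esym; last by lia.
have -> : ((2 * n).-1 - ((2 * n).-1 - k) = k)%N by lia.
have -> : ((2 * n).-1 - k = (2 * n - 2 * k - 1) + k)%N by lia.
have -> : 1 - x ^+ 2 = (1 + x) * (1 - x) by ring.
rewrite !exprD exprMn.
have -> : (-1) ^+ (2 * n - 2 * k - 1) = -1 :> R.
  by rewrite -signr_odd (_ : odd _ = true) ?expr1//; lia.
by move: (E k) ((-1) ^+ k) ((1 + x) ^+ k) ((1 - x) ^+ k) => a b c d; ring.
Qed.

Lemma CA_half_sum n x :
  2 * x * \sum_(t < n) CA R n t * x ^+ (2 * t) = eulerianA_hom (2 * n) x.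
Proof.
apply: (@halved_sum (fun k => (eulerianA (2 * n) k)%:R)) => k kn.
by move: kn; case: (2 * n)%N => // m km; rewrite eulerianA_sym.
Qed.

Lemma CB_half_sum n x : (0 < n)%N ->
  2 * x * \sum_(t < n) CB R n t * x ^+ (2 * t) = eulerianB_hom (2 * n).-1 x.
Proof.
move=> n0; have mE : (2 * n - 1 = (2 * n).-1)%N by rewrite subn1.
have -> : eulerianB_hom (2 * n).-1 x = \sum_(k < 2 * n) eulerianB R (2 * n - 1) k * (-1) ^+ k *
     (1 + x) ^+ ((2 * n).-1 - k) * (1 - x) ^+ k.
  by rewrite /eulerianB_hom prednK ?mE//; lia.
apply: (@halved_sum (fun k => eulerianB R (2 * n - 1) k)) => k kn.
by rewrite -mE eulerianB_sym//; lia.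
Qed.

Lemma even_poly_sum (c : nat -> R) a n x :
  (even_poly (a *: \sum_(t < n) c t *: 'X^(2 * t))).[x ^+ 2] =
  a * \sum_(t < n) c t * x ^+ (2 * t).
Proof.
have -> : even_poly (a *: \sum_(t < n) c t *: 'X^(2 * t)) = a *: \poly_(t < n) c t.
  apply/polyP => i; rewrite coef_even_poly !coefZ coef_poly coef_sum; congr (_ * _).
  under eq_bigr do rewrite coefZ coefXn -muln2 mulnC eqn_mul2l /=.
  case: ltnP => ni.
    rewrite (bigD1 (Ordinal ni)) //= eqxx mulr1 big1 ?addr0// => j.
    by rewrite -val_eqE /= eq_sym => /negbTE ->; rewrite mulr0.
  rewrite big1// => j _; rewrite [_ == _](_ : _ = false) ?mulr0//.
  by apply/eqP => E; have := ltn_ord j; rewrite -E ltnNge ni.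
rewrite hornerZ horner_poly; congr (_ * _); apply: eq_bigr => t _.
by rewrite exprM.
Qed.

Lemma size_even_poly_sum (c : nat -> R) a n :
  (size (even_poly (a *: \sum_(t < n) c t *: 'X^(2 * t))) <= n)%N.
Proof.
apply/leq_sizeP => i ni; rewrite coef_even_poly coefZ coef_sum big1 ?mulr0// => t _.
rewrite coefZ coefXn [_ == _](_ : _ = false) ?mulr0//.
by have := ltn_ord t; lia.
Qed.
End DerivativePolynomials.

(** * Taylor coefficients of a quotient *)

Section PowerSeriesQuotient.

(** Each h m is a rational expression in h 0, .., h (m-1) and in finitely many
    values of g and p, with denominator g 0. *)
Lemma triangular_cvg (R : realType) (g h p : nat -> nat -> R) (g' h' p' : nat -> R) :
  (forall N m, \sum_(i < m.+1) g N (m - i)%N * h N i = p N m) ->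
  (forall m, \sum_(i < m.+1) g' (m - i)%N * h' i = p' m) ->
  (forall N, g N 0%N != 0) -> g' 0%N != 0 ->
  (forall j, g N j @[N --> \oo] --> g' j) ->
  (forall j, p N j @[N --> \oo] --> p' j) ->
  forall m, h N m @[N --> \oo] --> h' m.
Proof.
move=> conv conv' g0 g0' cg cp; elim/ltn_ind => m IH.
have hE N : h N m = (p N m - \sum_(i < m) g N (m - i)%N * h N i) / g N 0%N.
  by rewrite -conv big_ord_recr /= subnn addrAC subrr add0r mulrC mulKf.
have -> : h' m = (p' m - \sum_(i < m) g' (m - i)%N * h' i) / g' 0%N.
  by rewrite -conv' big_ord_recr /= subnn addrAC subrr add0r mulrC mulKf.
under eq_fun do rewrite hE.
apply: cvgM; last by apply: cvgV => //; exact: cg.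
apply: cvgB; first exact: cp.
apply: cvg_big => [|i _]; first exact: add_continuous.
by apply: cvgM; [exact: cg|exact: IH].
Qed.

(** The sum in parentheses is the coefficient of X^i in P / C: Lagrange
    interpolation at the roots of C expands P / C into the fractions
    (P (r) / C' (r)) / (X - r), and 1 / (X - r) = - sum_i X^i / r^(i+1). *)
Lemma partial_fraction_coef (F : fieldType) N (C P : {poly F}) (r : 'I_N -> F) :
  injective r -> (size P <= N)%N -> (size C <= N.+1)%N ->
  (forall k, root C (r k)) -> (forall k, r k != 0) -> (forall k, C^`().[r k] != 0) ->
  forall m, \sum_(i < m.+1) C`_(m - i) *
    (- \sum_k P.[r k] / C^`().[r k] * (r k)^-1 ^+ i.+1) = P`_m.
Proof.
move=> rI sP sC Cr r0 C'r m.
(* P is interpolated at the roots of C by the cofactors D k. *)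
pose D k := C %/ ('X - (r k)%:P).
have DE k : C = D k * ('X - (r k)%:P) by rewrite divpK// dvdp_XsubCl.
have Dcoef k j : \sum_(i < j.+1) C`_(j - i) * (r k)^-1 ^+ i.+1 = - (D k)`_j.
  elim: j => [|j IH].
    rewrite big_ord1 subn0 expr1 {1}(DE k) mulrBr coefB coefMX coefMC /= sub0r.
    by rewrite mulNr mulfK.
  rewrite big_ord_recl /= subn0 expr1.
  have -> : C`_j.+1 = (D k)`_j - (D k)`_j.+1 * r k.
    by rewrite {1}(DE k) mulrBr coefB coefMX coefMC.
  under eq_bigr do rewrite /bump /= add1n subSS exprSr mulrA.
  by rewrite -mulr_suml IH mulrBl mulfK// mulNr addrAC subrr add0r.
have D'r k : C^`().[r k] = (D k).[r k].
  by rewrite {1}(DE k) derivM derivXsubC hornerD !hornerM hornerXsubC subrr mulr0 add0r hornerC mulr1.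
have Dr k l : l != k -> (D k).[r l] = 0.
  move=> lk; have := Cr l; rewrite rootE {1}(DE k) hornerM hornerXsubC mulf_eq0.
  by rewrite subr_eq0 (inj_eq rI) (negbTE lk) orbF => /eqP.
have PE : P = \sum_k (P.[r k] / C^`().[r k]) *: D k.
  apply/eqP; rewrite -subr_eq0; apply/eqP.
  apply: (@roots_geq_poly_eq0 _ _ [seq r k | k <- enum 'I_N]).
  - apply/allP => _ /mapP[l _ ->]; rewrite rootE hornerD hornerN horner_sum.
    rewrite (bigD1 l) //= big1 ?addr0 => [|k kl]; last by rewrite hornerZ Dr ?mulr0// eq_sym.
    by rewrite hornerZ -D'r divfK// subrr.
  - by rewrite map_inj_uniq// enum_uniq.
  rewrite size_map size_enum_ord; apply: leq_trans (size_polyD _ _) _.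
  rewrite geq_max sP size_polyN; apply: leq_trans (size_sum _ _ _) _.
  apply/bigmax_leqP => k _; apply: leq_trans (size_scale_leq _ _) _.
  rewrite /D size_divp ?polyXsubC_eq0// size_XsubC leq_subLR add1n.
  by apply: leq_trans sC _.
rewrite [in RHS]PE coef_sum.
under eq_bigr do rewrite mulrN mulr_sumr.
rewrite sumrN exchange_big -sumrN /=; apply: eq_bigr => k _.
rewrite coefZ -[(D k)`_m]opprK -Dcoef mulrN mulr_sumr; congr (- _).
by apply: eq_bigr => i _; rewrite mulrCA.
Qed.

End PowerSeriesQuotient.

(** * Euler's approximation of the exponential *)

Section Limits.
Variable R : realType.
Implicit Types (a c x : R).

Lemma bernoulli_ineq x n : 0 <= x <= 1 -> 1 - n%:R * x <= (1 - x) ^+ n.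
Proof.
move=> /andP[x0 x1]; elim: n => [|n IH]; first by rewrite mul0r subr0 expr0.
rewrite exprS; apply: le_trans (ler_wpM2l _ IH); last lra.
have n0 := ler0n R n; rewrite -natr1; nra.
Qed.

Lemma cvg_divn (c : R) : c / N%:R @[N --> \oo] --> (0 : R).
Proof.
rewrite -[X in _ --> X](mulr0 c); apply: cvgM; first exact: cvg_cst.
by rewrite -(@cvg_shiftS R^o (fun N => N%:R^-1)); exact: cvg_harmonic.
Qed.

(** The upper bound follows from 1 + y <= exp y for y = a / N. The same
    inequality for - y yields the lower bound, because
    (1 + y)^N (1 - y)^N = (1 - y^2)^N tends to 1 by Bernoulli's inequality. *)
Lemma cvg_compound a : (1 + a / N%:R) ^+ N @[N --> \oo] --> expR a.
Proof.
have H : expR a * (1 - a ^+ 2 / N%:R) @[N --> \oo] --> expR a.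
  rewrite -[X in _ --> X]mulr1; apply: cvgM; first exact: cvg_cst.
  rewrite -[X in _ --> X]subr0; apply: cvgB; first exact: cvg_cst.
  exact: cvg_divn.
apply: (squeeze_cvgr _ H (cvg_cst (expR a))).
have cA : `|a / N%:R| @[N --> \oo] --> (0 : R).
  by rewrite -[X in _ --> X](normr0 R); apply: cvg_norm; exact: cvg_divn.
near=> N.
have N0 : (0 < N)%N by near: N; exact: nbhs_infty_gt.
have N0' : 0 < N%:R :> R by rewrite ltr0n.
have aN : `|a / N%:R| < 1 by near: N; exact: (cvgr_lt _ cA).
move: aN; rewrite ltr_norml => /andP[aN1 aN2].
set y := a / N%:R in aN1 aN2 *.
have aE : a = N%:R * y by rewrite /y mulrCA mulfV ?mulr1// gt_eqF.
clearbody y.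
have up z : 0 <= 1 + z -> (1 + z) ^+ N <= expR (N%:R * z).
  by move=> z0; rewrite expRM_natl lerXn2r ?nnegrE ?expR_ge0 ?expR_ge1Dx.
apply/andP; split; last by rewrite aE up//; lra.
have y1 : 0 < 1 - y by lra.
have -> : 1 + y = (1 - y ^+ 2) / (1 - y) by field; lra.
have yN : 0 < (1 - y) ^+ N by rewrite exprn_gt0.
rewrite expr_div_n ler_pdivlMr//.
have h1 : (1 - y) ^+ N <= expR (- a) by rewrite aE -mulrN up//; lra.
have h2 : 1 - a ^+ 2 / N%:R <= (1 - y ^+ 2) ^+ N.
  have -> : a ^+ 2 / N%:R = N%:R * y ^+ 2 by rewrite aE exprMn; field; lra.
  by apply: bernoulli_ineq; apply/andP; split; nra.
have h3 : expR a * expR (- a) = 1 by rewrite -expRD subrr expR0.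
have e0 := expR_gt0 a; have e1 := expR_gt0 (- a).
have h4 : 0 <= (1 - y ^+ 2) ^+ N by rewrite exprn_ge0//; nra.
have [s0|s0] := leP 0 (1 - a ^+ 2 / N%:R); last first.
  by apply: le_trans h4; rewrite mulrAC mulr_ge0_le0 ?mulr_ge0 ?ltW.
apply: le_trans h2; apply: (@le_trans _ _ (expR a * expR (- a) * (1 - a ^+ 2 / N%:R))).
  by rewrite mulrAC; apply: ler_wpM2r => //; apply: ler_wpM2l => //; exact: ltW.
by rewrite h3 mul1r.
Unshelve. all: by end_near. Qed.

Lemma cvg_binomial_expn j : 'C(N, j)%:R / N%:R ^+ j @[N --> \oo] --> (j`!%:R^-1 : R).
Proof.
elim: j => [|j IH].
  by under eq_fun do rewrite bin0 expr0 invr1 mulr1; rewrite fact0 invr1; exact: cvg_cst.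
have -> : j.+1`!%:R^-1 = j`!%:R^-1 * ((1 - 0) * j.+1%:R^-1) :> R.
  by rewrite factS natrM invfM subr0 mul1r mulrC.
have H : 'C(N, j)%:R / N%:R ^+ j * ((1 - j%:R / N%:R) * j.+1%:R^-1) @[N --> \oo] -->
    (j`!%:R^-1 * ((1 - 0) * j.+1%:R^-1) : R).
  apply: cvgM => //; apply: cvgM; last exact: cvg_cst.
  by apply: cvgB; [exact: cvg_cst|exact: cvg_divn].
apply: cvg_trans H; apply: near_eq_cvg; near=> N.
have N0 : (0 < N)%N by near: N; exact: nbhs_infty_gt.
have jN : (j <= N)%N by near: N; exact: nbhs_infty_ge.
have N0' : N%:R != 0 :> R by rewrite pnatr_eq0 -lt0n.
have j0 : j.+1%:R != 0 :> R by rewrite pnatr_eq0.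
have E : j.+1%:R * 'C(N, j.+1)%:R = (N%:R - j%:R) * 'C(N, j)%:R :> R.
  by rewrite -natrB// -!natrM -mul_bin_left.
have -> : 'C(N, j.+1)%:R = (N%:R - j%:R) * 'C(N, j)%:R / j.+1%:R :> R.
  by rewrite -E mulrAC mulfV// mul1r.
rewrite exprS; move: (N%:R ^+ j) (expf_neq0 j N0') ('C(N, j)%:R) => p p0 b.
by move: j.+1%:R j0 => q q0; field; rewrite N0' p0 q0.
Unshelve. all: by end_near. Qed.

Lemma cvg_compound_sub a j : (1 + a / N%:R) ^+ (N - j) @[N --> \oo] --> expR a.
Proof.
have D : (1 + a / N%:R) ^+ j @[N --> \oo] --> ((1 + 0) ^+ j : R).
  apply: (cvg_comp (fun N => 1 + a / N%:R) (fun x : R => x ^+ j)); last exact: exprn_continuous.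
  by apply: cvgD; [exact: cvg_cst|exact: cvg_divn].
rewrite addr0 expr1n in D.
have H : (1 + a / N%:R) ^+ N / (1 + a / N%:R) ^+ j @[N --> \oo] --> expR a / 1.
  by apply: cvgM; [exact: cvg_compound|apply: cvgV => //; exact: oner_neq0].
rewrite invr1 mulr1 in H; apply: cvg_trans H; apply: near_eq_cvg.
have cA : `|a / N%:R| @[N --> \oo] --> (0 : R).
  by rewrite -[X in _ --> X](normr0 R); apply: cvg_norm; exact: cvg_divn.
near=> N.
have jN : (j <= N)%N by near: N; exact: nbhs_infty_ge.
have aN : `|a / N%:R| < 1 by near: N; exact: (cvgr_lt _ cA).
move: aN; rewrite ltr_norml => /andP[aN1 aN2].
have -> : (1 + a / N%:R) ^+ N = (1 + a / N%:R) ^+ (N - j) * (1 + a / N%:R) ^+ j.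
  by rewrite -exprD subnK.
by rewrite mulfK// expf_neq0// gt_eqF//; lra.
Unshelve. all: by end_near. Qed.

Lemma cvg_mul_tan c : N%:R * tan (c / N%:R) @[N --> \oo] --> c.
Proof.
have [->|c0] := eqVneq c 0.
  by under eq_fun do rewrite mul0r tan0 mulr0; exact: cvg_cst.
have D : is_derive (0 : R) 1 tan ((cos (0:R))^-2) by apply: is_derive_tan; rewrite cos0 oner_neq0.
have [dT dE] := D.
have T : (fun h : R => h^-1 *: ((tan \o shift 0) (h *: 1) - tan 0)) @ 0^' --> (1 : R).
  by have := dT : _ --> 'D_1 tan 0; rewrite dE cos0 expr1n invr1.
have cN : c / N%:R @[N --> \oo] --> (0 : R)^'.
  move=> A HA; have := cvg_divn c HA; apply: filterS2 (nbhs_infty_gt 0) => N /= N0.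
  by apply; rewrite mulf_neq0// invr_eq0 pnatr_eq0 -lt0n.
have H := cvg_comp _ _ cN T.
have H2 : c * (((c / N%:R)^-1 *: ((tan \o shift 0) ((c / N%:R) *: 1) - tan 0))) @[N --> \oo] --> c * 1.
  by apply: cvgM => //; exact: cvg_cst.
rewrite mulr1 in H2; apply: cvg_trans H2; apply: near_eq_cvg; near=> N.
rewrite /= tan0 subr0 addr0 [X in tan X]mulr1 invf_div -[_ *: _]/(_ * _).
by rewrite mulrA [c * _]mulrC divfK.
Unshelve. all: by end_near. Qed.
End Limits.

(** * Complex numbers of modulus one and complex limits *)

Section ComplexPreliminaries.
Variable R : realType.
Implicit Types (s t : R) (z w : R[i]).

Local Notation rc := (@real_complex_def R (Phant R)).
Local Notation normc := (@ComplexField.Normc.normc R).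
Local Notation Re := (@complex.Re R).
Local Notation Im := (@complex.Im R).

Definition cexp t : R[i] := Complex (cos t) (sin t).

Lemma cexpD s t : cexp (s + t) = cexp s * cexp t.
Proof. by rewrite /cexp cosD sinD; simpc; congr Complex; ring. Qed.

Lemma cexp0 : cexp 0 = 1. Proof. by rewrite /cexp cos0 sin0. Qed.

Lemma cexpX n t : cexp t ^+ n = cexp (n%:R * t).
Proof.
elim: n => [|n IH]; first by rewrite mul0r cexp0.
by rewrite exprS IH -cexpD -[in RHS]natr1 mulrDl mul1r addrC.
Qed.

Lemma cexpNK t : cexp t * cexp (- t) = 1.
Proof. by rewrite -cexpD subrr cexp0. Qed.

Lemma cexpN t : cexp (- t) = (cexp t)^-1.
Proof.
have n0 : cexp t != 0.
  by apply: contraNneq (oner_neq0 R[i]) => c0; rewrite -(cexpNK t) c0 mul0r.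
by apply: (mulfI n0); rewrite cexpNK mulfV.
Qed.

Lemma cexp_pi : cexp pi = -1.
Proof. by rewrite /cexp cospi sinpi; apply/eqP; rewrite eq_complex /= oppr0 !eqxx. Qed.

Lemma normcX z n : normc (z ^+ n) = normc z ^+ n.
Proof.
elim: n => [|n IH]; first by rewrite ComplexField.Normc.normc1.
by rewrite !exprS ComplexField.Normc.normcM IH.
Qed.

Lemma normc_ge0 z : 0 <= normc z.
Proof. by case: z => a b; exact: sqrtr_ge0. Qed.

Lemma Re_le_normc z : `|Re z| <= normc z.
Proof.
by case: z => a b /=; rewrite -sqrtr_sqr ler_wsqrtr// lerDl sqr_ge0.
Qed.

Lemma Re_sum (I : Type) (r : seq I) (P : pred I) (F : I -> R[i]) :
  Re (\sum_(i <- r | P i) F i) = \sum_(i <- r | P i) Re (F i).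
Proof. by apply: (big_morph Re) => // -[a b] [c d]. Qed.

Lemma Re_rcM t z : Re (rc t * z) = t * Re z.
Proof. by case: z => a b; simpc. Qed.

Lemma ReN z : Re (- z) = - Re z. Proof. by case: z. Qed.

Definition ccvg (u : nat -> R[i]) (l : R[i]) :=
  (Re (u n) @[n --> \oo] --> Re l) /\ (Im (u n) @[n --> \oo] --> Im l).

Lemma ccvgM u v l k : ccvg u l -> ccvg v k -> ccvg (fun n => u n * v n) (l * k).
Proof.
move=> [u1 u2] [v1 v2].
have E z w : Re (z * w) = Re z * Re w - Im z * Im w /\ Im (z * w) = Re z * Im w + Im z * Re w.
  by case: z w => [a b] [c d].
split; rewrite (E l k).1 || rewrite (E l k).2.
  under eq_fun do rewrite (E _ _).1.
  by apply: cvgB; apply: cvgM.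
under eq_fun do rewrite (E _ _).2.
by apply: cvgD; apply: cvgM.
Qed.

Lemma ccvgV u l : l != 0 -> ccvg u l -> ccvg (fun n => (u n)^-1) l^-1.
Proof.
move=> l0 [u1 u2].
have E z : Re z^-1 = Re z / (Re z ^+ 2 + Im z ^+ 2) /\
           Im z^-1 = - (Im z / (Re z ^+ 2 + Im z ^+ 2)) by case: z.
have N : (Re (u n) ^+ 2 + Im (u n) ^+ 2)^-1 @[n --> \oo] --> (Re l ^+ 2 + Im l ^+ 2)^-1.
  apply: cvgV; last by apply: cvgD; apply: cvgM.
  case: l l0 {u1 u2} => a b /=; apply: contraNneq => /eqP.
  by rewrite paddr_eq0 ?sqr_ge0// !sqrf_eq0 => /andP[/eqP-> /eqP->].
split; rewrite (E l).1 || rewrite (E l).2.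
  by under eq_fun do rewrite (E _).1; apply: cvgM.
by under eq_fun do rewrite (E _).2; apply: cvgN; apply: cvgM.
Qed.

Lemma ccvgX u l n : ccvg u l -> ccvg (fun k => u k ^+ n) (l ^+ n).
Proof.
move=> ul; elim: n => [|n IH]; first by split; exact: cvg_cst.
rewrite exprS; under eq_fun do rewrite exprS; exact: ccvgM.
Qed.

End ComplexPreliminaries.

(** * Polynomial approximation of cosh and its roots *)

Section CoshApprox.
Variable R : realType.
Implicit Types (a s t : R) (z w : R[i]).

Local Notation rc := (@real_complex_def R (Phant R)).
Local Notation normc := (@ComplexField.Normc.normc R).
Local Notation Re := (@complex.Re R).
Local Notation Im := (@complex.Im R).

Lemma coef_linear_exp (S : comNzRingType) (al be : S) N j :
  ((al%:P + be *: 'X) ^+ N)`_j = 'C(N, j)%:R * al ^+ (N - j) * be ^+ j.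
Proof.
rewrite exprDn coef_sum.
have E i : ((al%:P ^+ (N - i) * (be *: 'X) ^+ i) *+ 'C(N, i))`_j =
    'C(N, i)%:R * al ^+ (N - i) * be ^+ i * (j == i)%:R.
  rewrite coefMn exprZn -polyC_exp coefCM coefZ coefXn -[LHS]mulr_natl.
  by rewrite -!mulrA.
under eq_bigr do rewrite E.
have [jN|Nj] := ltnP j N.+1.
  rewrite (bigD1 (Ordinal jN)) //= eqxx mulr1 big1 ?addr0// => i.
  by rewrite -val_eqE /= eq_sym => /negbTE ->; rewrite mulr0.
rewrite bin_small// !mul0r big1// => i _.
by rewrite [_ == _](_ : _ = false) ?mulr0//; have := ltn_ord i; lia.
Qed.

(** cosh (a + 'X) with exp (s) and exp (- s) replaced by (1 + s/N)^N and
    (1 - s/N)^N. *)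
Definition cosh_approx N a : {poly R} :=
  2^-1 *: (((1 + a / N%:R)%:P + N%:R^-1 *: 'X) ^+ N +
           ((1 - a / N%:R)%:P + - N%:R^-1 *: 'X) ^+ N).

Lemma coef_cosh_approx N a j : (cosh_approx N a)`_j =
  'C(N, j)%:R / N%:R ^+ j *
    (((1 + a / N%:R) ^+ (N - j) + (-1) ^+ j * (1 - a / N%:R) ^+ (N - j)) / 2).
Proof.
rewrite coefZ coefD !coef_linear_exp [(- N%:R^-1) ^+ j]exprNn exprVn.
move: ('C(N, j)%:R) ((-1) ^+ j) (_ ^+ (N - j)) ((1 - a / N%:R) ^+ (N - j)).
by move: ((N%:R ^+ j)^-1) => *; field.
Qed.

Definition ch a : R := (expR a + expR (- a)) / 2.
Definition sh a : R := (expR a - expR (- a)) / 2.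
Definition th a : R := sh a / ch a.

Lemma ch_gt0 a : 0 < ch a.
Proof. by rewrite divr_gt0// addr_gt0// expR_gt0. Qed.

Lemma cvg_coef_cosh_approx a j :
  (cosh_approx N a)`_j @[N --> \oo] --> ch a * (coshsinh (th a) j / j`!%:R).
Proof.
have -> : ch a * (coshsinh (th a) j / j`!%:R) =
    j`!%:R^-1 * ((expR a + (-1) ^+ j * expR (- a)) / 2).
  have c0 := lt0r_neq0 (ch_gt0 a).
  rewrite mulrA mulrC; congr (_ * _).
  rewrite /coshsinh -signr_odd; case: odd; rewrite ?expr0 ?expr1.
    by rewrite /th mulrCA mulfV// mulr1 mulN1r.
  by rewrite mulr1 mul1r.
under eq_fun do rewrite coef_cosh_approx.
apply: cvgM; first exact: cvg_binomial_expn.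
apply: cvgM; last exact: cvg_cst.
apply: cvgD; first exact: cvg_compound_sub.
apply: cvgM; first exact: cvg_cst.
by have := @cvg_compound_sub _ (- a) j; under eq_fun do rewrite mulNr.
Qed.

Lemma size_cosh_approx N a : (size (cosh_approx N a) <= N.+1)%N.
Proof.
apply/leq_sizeP => j Nj; rewrite coef_cosh_approx bin_small//.
by rewrite !mul0r.
Qed.

(** The angles in (- pi/2, pi/2) with cos (N psi) = 0, for N even. With
    s = i N tan psi, (1 + s/N)^N + (1 - s/N)^N is 2 cos (N psi) / cos^N psi. *)
Definition psi (N k : nat) : R := (k.*2.+1%:R - N%:R) / (2 * N%:R) * pi.

Variable p : nat.
Let N := p.+1.*2.

Let N0 : (N%:R : R) != 0. Proof. by rewrite pnatr_eq0. Qed.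
Let Ngt0 : 0 < (N%:R : R). Proof. by rewrite ltr0n. Qed.

Lemma psi_itv k : (k < N)%N -> - (pi / 2) < psi N k < pi / 2.
Proof.
move=> kN; rewrite /psi.
have k1 : (k.*2.+1%:R : R) <= N%:R + N%:R - 1.
  by rewrite -natrD lerBrDr natr1 ler_nat; lia.
have k2 : 1 <= (k.*2.+1%:R : R) by rewrite ler1n.
have pi0 := pi_gt0 R; move: (k.*2.+1%:R : R) k1 k2 => x k1 k2.
have -> : (x - N%:R) / (2 * N%:R) * pi = pi / 2 * ((x - N%:R) / N%:R) by field.
have n0 := Ngt0.
have h1 : (x - N%:R) / N%:R < 1 by rewrite ltr_pdivrMr//; lra.
have h2 : -1 < (x - N%:R) / N%:R by rewrite ltr_pdivlMr//; lra.
by apply/andP; split; nra.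
Qed.

Lemma psi_in k : (k < N)%N -> psi N k \in `](- (pi / 2)), (pi / 2)[%R.
Proof. by move=> kN; rewrite in_itv /= psi_itv. Qed.

Lemma cos_psi_gt0 k : (k < N)%N -> 0 < cos (psi N k).
Proof. by move=> kN; apply/cos_gt0_pihalf/psi_itv. Qed.

Lemma psi_lt i j : (psi N i < psi N j) = (i < j)%N.
Proof.
by rewrite /psi !ltr_pM2r ?pi_gt0 ?invr_gt0 ?mulr_gt0// ltrD2r ltr_nat ltnS ltn_double.
Qed.

Lemma tan_psi_lt i j : (i < N)%N -> (j < N)%N ->
  (tan (psi N i) < tan (psi N j)) = (i < j)%N.
Proof. by move=> iN jN; rewrite ltr_tan ?psi_in// psi_lt. Qed.

Lemma psi_opp k : (k < N)%N -> psi N (N - k.+1) = - psi N k.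
Proof.
move=> kN; rewrite /psi.
have -> : (N - k.+1).*2.+1%:R = N%:R + N%:R - k.*2.+1%:R :> R.
  by rewrite -natrD -natrB; [congr _%:R|]; lia.
by rewrite -mulNr -mulNr; congr (_ / _ * _); ring.
Qed.

Definition tau k : R := N%:R * tan (psi N k).

Lemma tau_lt i j : (i < N)%N -> (j < N)%N -> (tau i < tau j) = (i < j)%N.
Proof. by move=> iN jN; rewrite ltr_pM2l// tan_psi_lt. Qed.

Lemma tau_opp k : (k < N)%N -> tau (N - k.+1) = - tau k.
Proof. by move=> kN; rewrite /tau psi_opp// tanN mulrN. Qed.

Lemma tau_neq0 k : (k < N)%N -> tau k != 0.
Proof.
move=> kN; apply/eqP => t0; have := tau_opp kN; rewrite t0 oppr0 => t0'.
have kN' : (N - k.+1 < N)%N by lia.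
have := tau_lt kN kN'; have := tau_lt kN' kN; rewrite t0 t0' ltxx.
by rewrite /N; lia.
Qed.

(** The root of [cosh_approx] attached to [psi]; it approximates a pole of
    tanh (a + s) and of sech (a + s). *)
Definition pole a (k : nat) : R[i] := Complex (- a) (tau k).

Lemma pole_inj a : injective (fun k : 'I_N => pole a k).
Proof.
move=> i j /(congr1 Im) tij; have {}tij : tau i = tau j := tij.
have := tau_lt (ltn_ord i) (ltn_ord j); have := tau_lt (ltn_ord j) (ltn_ord i).
by rewrite tij ltxx => /esym ji /esym ij; apply: ord_inj; case: (ltngtP i j) ij ji.
Qed.

Lemma pole_neq0 a k : (k < N)%N -> pole a k != 0.
Proof. by move=> kN; rewrite eq_complex /= (negbTE (tau_neq0 kN)) andbF. Qed.

Definition pole_sign (k : nat) : R[i] := (-1) ^+ (k + p.+1) * 'i%C.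

(** N psi_k is an odd multiple of pi/2, because N = 2 (p + 1) is even. *)
Lemma cexp_psiX k : cexp (psi N k) ^+ N = pole_sign k.
Proof.
rewrite cexpX.
have -> : N%:R * psi N k = k%:R * pi + (pi / 2 + p.+1%:R * (- pi)).
  rewrite /psi mulrA; have -> : N%:R * ((k.*2.+1%:R - N%:R) / (2 * N%:R)) = (k.*2.+1%:R - N%:R) / 2 :> R.
    by field.
  by rewrite /N -[k.*2.+1]addn1 -!muln2 natrD !natrM; field.
rewrite !cexpD -!cexpX cexpN cexp_pi invrN1 /pole_sign exprD -mulrA; congr (_ * _).
by rewrite mulrC /cexp cos_pihalf sin_pihalf.
Qed.

Lemma cexp_psiNX k : cexp (- psi N k) ^+ N = - pole_sign k.
Proof.
rewrite cexpN exprVn cexp_psiX /pole_sign invfM -exprVn invrN1 -mulrN; congr (_ * _).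
by apply/eqP; rewrite eq_complex /= !expr0n /= !add0r !expr1n !mul0r oppr0 divr1 !eqxx.
Qed.

(** Up to the factor 1 / cos psi, the two linear forms whose powers make up
    [cosh_approx] are phases at a root. *)
Lemma pole_linear a k : (k < N)%N ->
  rc (1 + a / N%:R) + rc N%:R^-1 * pole a k = rc (cos (psi N k))^-1 * cexp (psi N k) /\
  rc (1 - a / N%:R) + rc (- N%:R^-1) * pole a k = rc (cos (psi N k))^-1 * cexp (- psi N k).
Proof.
move=> kN; have c0 := lt0r_neq0 (cos_psi_gt0 kN).
rewrite /cexp cosN sinN; split; apply/eqP; rewrite eq_complex /= /tau /tan.
  by apply/andP; split; apply/eqP; field; rewrite ?N0 ?c0.
by apply/andP; split; apply/eqP; field; rewrite ?N0 ?c0.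
Qed.

Let cc a := map_poly rc (cosh_approx N a).

Lemma cosh_approx_rc a : cc a =
  rc 2^-1 *: (((rc (1 + a / N%:R))%:P + rc N%:R^-1 *: 'X) ^+ N +
           ((rc (1 - a / N%:R))%:P + rc (- N%:R^-1) *: 'X) ^+ N).
Proof.
rewrite /cc /cosh_approx map_polyZ rmorphD !rmorphXn !rmorphD /=.
by rewrite !map_polyC !map_polyZ map_polyX.
Qed.

Lemma root_cosh_approx a k : (k < N)%N -> root (cc a) (pole a k).
Proof.
move=> kN; rewrite rootE cosh_approx_rc hornerZ hornerD !horner_exp !hornerD.
rewrite !hornerC !hornerZ hornerX (pole_linear a kN).1 (pole_linear a kN).2.
by rewrite !exprMn cexp_psiX cexp_psiNX mulrN subrr mulr0.
Qed.

Lemma deriv_cosh_approx_pole a k : (k < N)%N ->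
  (cc a)^`().[pole a k] = rc ((cos (psi N k)) ^- N.-2) * pole_sign k.
Proof.
move=> kN; rewrite cosh_approx_rc derivZ derivD !deriv_exp !derivD !derivC !derivZ derivX !add0r.
rewrite hornerZ hornerD !hornerMn !hornerM !horner_exp !hornerD !hornerC !hornerZ hornerX hornerC.
rewrite (pole_linear a kN).1 (pole_linear a kN).2 !mulr1.
have c0 := lt0r_neq0 (cos_psi_gt0 kN); set c := cos (psi N k) in c0 *.
have mulN s z : rc s * z *+ N = rc (N%:R * s) * z.
  by rewrite -[LHS]mulr_natl mulrA rmorphM rmorph_nat.
rewrite !mulN mulrN mulfV// rmorphN1 rmorph1 mul1r mulN1r.
have eN t : cexp t ^+ N.-1 = cexp t ^+ N * cexp (- t).
  have -> : cexp t ^+ N = cexp t ^+ N.-1 * cexp t by rewrite -exprSr prednK.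
  by rewrite -mulrA cexpNK mulr1.
rewrite !exprMn !eN cexp_psiX cexp_psiNX opprK -[N.-1]/(N.-2.+1) exprS.
have E : cexp (- psi N k) + cexp (psi N k) = rc (2 * c).
  rewrite /cexp cosN sinN -/c; apply/eqP.
  by rewrite eq_complex /= addNr eqxx andbT; apply/eqP; ring.
transitivity (rc 2^-1 * rc c^-1 * (rc c^-1 ^+ N.-2) * pole_sign k *
   (cexp (- psi N k) + cexp (psi N k))); first by move: (_ ^+ N.-2) => *; ring.
rewrite E -rmorphXn -!rmorphM exprVn mulrAC -rmorphM; congr (rc _ * _).
by move: (_ ^+ N.-2)^-1 => *; field.
Qed.

Lemma deriv_cosh_approx_neq0 a k : (k < N)%N -> (cc a)^`().[pole a k] != 0.
Proof.
move=> kN; rewrite deriv_cosh_approx_pole// mulf_neq0//.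
  rewrite fmorph_eq0 invr_eq0 expf_neq0//; exact: lt0r_neq0 (cos_psi_gt0 kN).
rewrite /pole_sign mulf_neq0 ?expf_neq0 ?oppr_eq0 ?oner_neq0//.
by rewrite eq_complex /= oner_eq0 andbF.
Qed.

(** Taking real parts loses nothing, as the coefficients of both polynomials
    are real. *)
Lemma pole_conv a (P : {poly R}) m : (size P <= N)%N ->
  \sum_(i < m.+1) (cosh_approx N a)`_(m - i) *
     (- \sum_(k < N) Re ((map_poly rc P).[pole a k] / (cc a)^`().[pole a k] *
         (pole a k)^-1 ^+ i.+1)) = P`_m.
Proof.
move=> sP.
have := @partial_fraction_coef _ N (cc a) (map_poly rc P) (fun k : 'I_N => pole a k)
  (@pole_inj a).
rewrite !size_map_poly => /(_ sP (size_cosh_approx N a)).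
move=> /(_ (fun k => root_cosh_approx a (ltn_ord k)) (fun k => pole_neq0 a (ltn_ord k))
  (fun k => deriv_cosh_approx_neq0 a (ltn_ord k)) m)/(congr1 Re).
rewrite coef_map Re_sum [Re (_ P`_m)]/= => <-; apply: eq_bigr => i _.
by rewrite coef_map Re_rcM ReN Re_sum.
Qed.

Lemma size_cosh_approx_deriv a : (size (cosh_approx N a)^`() <= N)%N.
Proof.
apply/leq_sizeP => j Nj; rewrite coef_deriv nth_default ?mul0rn//.
exact: leq_trans (size_cosh_approx N a) _.
Qed.

(** For a = 0, the coefficient of s in C_N' / C_N is the sum of 1 / tau^2 by
    partial fractions, and 1 - 1/N by direct computation. *)
Lemma sum_tau_inv2 : \sum_(k < N) (tau k)^-1 ^+ 2 <= 1.
Proof.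
have := pole_conv 0 1 (size_cosh_approx_deriv 0).
rewrite big_ord_recr big_ord1 /= coef_deriv subnn subn0.
rewrite !coef_cosh_approx !mul0r !addr0 !subr0 !expr1n !expr0 !expr1 bin0 bin1.
rewrite !mul1r mulN1r subrr !mul0r mulr0 mul0r add0r invr1 mul1r sqrrN expr1n mul1r.
have -> : 'C(N, 2)%:R / N%:R ^+ 2 * ((1 + 1) / 2) *+ 2 = 1 - N%:R^-1 :> R.
  have E : 2 * 'C(N, 2)%:R = (N%:R - 1) * N%:R :> R.
    have -> : N%:R - 1 = (N - 1)%:R :> R by rewrite natrB.
    by rewrite -!natrM mul_bin_left bin1.
  have -> : 'C(N, 2)%:R = (N%:R - 1) * N%:R / 2 :> R by rewrite -E; field.
  by rewrite -[LHS]mulr_natl; field.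
have -> : (1 + 1) / 2 = 1 :> R by field.
rewrite mul1r -sumrN => S.
suff E (k : 'I_N) : (tau k)^-1 ^+ 2 = - Re ((map_poly rc (cosh_approx N 0)^`()).[pole 0 k] /
    (cc 0)^`().[pole 0 k] * (pole 0 k)^-1 ^+ 2).
  by under eq_bigr do rewrite E; rewrite S lerBlDr lerDl invr_ge0.
rewrite -deriv_map mulfV ?deriv_cosh_approx_neq0// mul1r [(pole 0 k)^-1 ^+ 2]exprVn.
have -> : pole 0 k ^- 2 = rc (- (tau k)^-1 ^+ 2).
  have -> : pole 0 k ^+ 2 = rc (- tau k ^+ 2).
    by rewrite expr2; apply/eqP; rewrite eq_complex /=; apply/andP; split; apply/eqP; ring.
  by rewrite -fmorphV invrN exprVn.
by rewrite /= opprK.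
Qed.

(** The numbers tau k increase with k and are symmetric about 0: the indices p
    and p + 1 are the innermost ones, and p + 2 is next. *)
Lemma tau_ge k : (0 < p)%N -> (k < N)%N -> k != p -> k != p.+1 ->
  0 < tau p.+2 <= `|tau k|.
Proof.
move=> p0 kN kp kp1.
have pN : (p.+2 < N)%N by rewrite /N; lia.
have pos j : (p < j)%N -> (j < N)%N -> 0 < tau j.
  move=> pj jN; have := @tau_opp j jN.
  have jN' : (N - j.+1 < N)%N by lia.
  have : tau (N - j.+1) < tau j by rewrite tau_lt//; rewrite /N; lia.
  lra.
have big j : (p.+1 < j)%N -> (j < N)%N -> tau p.+2 <= tau j.
  move=> pj jN; rewrite leNgt tau_lt//; lia.
rewrite pos//=.
have [pk|pk] := ltnP p.+1 k; first by rewrite ger0_norm ?big// ltW// pos// ltnW.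
rewrite -normrN -tau_opp// ger0_norm; first by apply: big; rewrite /N; lia.
by apply/ltW/pos; rewrite /N; lia.
Qed.

Definition pole_term a m (W : nat -> R[i]) k : R := Re (W k * (pole a k)^-1 ^+ m.+1).

(** A remaining pole has modulus at least that of the pole p + 2, which is used
    for m of the m + 2 factors, and at least |tau k|, which is used for the last
    two and makes the sum converge by [sum_tau_inv2]. *)
Lemma tail_bound a m (W : nat -> R[i]) : (0 < p)%N ->
  (forall k, (k < N)%N -> normc (W k) <= 1) ->
  `| \sum_(k < N) pole_term a m.+1 W k -
     (pole_term a m.+1 W p.+1 + pole_term a m.+1 W p)| <= (Num.sqrt (a ^+ 2 + tau p.+2 ^+ 2))^-1 ^+ m.
Proof.
move=> p0 W1; have p1N : (p.+1 < N)%N by rewrite /N; lia.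
have pN : (p < N)%N by rewrite ltnW.
rewrite (bigD1 (Ordinal p1N)) //= (bigD1 (Ordinal pN)) /=; last first.
  by rewrite -val_eqE /= ltn_eqF.
have cancel (x y z : R) : x + (y + z) - (x + y) = z by ring.
rewrite cancel {cancel}.
set B := (Num.sqrt _)^-1 ^+ m.
have B0 : 0 <= B by rewrite exprn_ge0// invr_ge0 sqrtr_ge0.
apply: le_trans (ler_norm_sum _ _ _) _.
apply: (@le_trans _ _ (\sum_(k < N) B * (tau k)^-1 ^+ 2)); last first.
  by rewrite -mulr_sumr -[leRHS]mulr1 ler_wpM2l// sum_tau_inv2.
rewrite [leRHS](bigD1 (Ordinal p1N)) //= [in leRHS](bigD1 (Ordinal pN)) /=; last first.
  by rewrite -val_eqE /= ltn_eqF.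
rewrite addrA -[leLHS]add0r; apply: lerD.
  by rewrite addr_ge0// mulr_ge0// exprn_even_ge0.
apply: ler_sum => k /andP[kp1 kp]; rewrite -!val_eqE /= in kp1 kp.
have /andP[t0 tk] := tau_ge p0 (ltn_ord k) kp kp1.
have tk0 := lt_le_trans t0 tk.
have tk2 : 0 < tau k ^+ 2 by rewrite -real_normK ?num_real// exprn_gt0.
apply: le_trans (Re_le_normc _) _.
rewrite ComplexField.Normc.normcM normcX ComplexField.Normc.normcV.
rewrite -[leRHS]mul1r; apply: ler_pM; rewrite ?normc_ge0 ?exprn_ge0 ?invr_ge0 ?normc_ge0 ?W1//.
have -> : normc (pole a k) = Num.sqrt (a ^+ 2 + tau k ^+ 2) by rewrite /= sqrrN.
set r := Num.sqrt (a ^+ 2 + tau k ^+ 2).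
have -> : r^-1 ^+ m.+2 = r^-1 ^+ m * r^-1 ^+ 2 by rewrite -exprD addn2.
rewrite {}/r; apply: ler_pM; rewrite ?exprn_ge0 ?invr_ge0 ?sqrtr_ge0//.
  apply: lerXn2r; rewrite ?nnegrE ?invr_ge0 ?sqrtr_ge0//.
  rewrite lef_pV2 ?posrE ?sqrtr_gt0; last 2 first.
  - by rewrite ltr_wpDl ?sqr_ge0.
  - by rewrite ltr_wpDl ?sqr_ge0// exprn_gt0.
  rewrite ler_wsqrtr// lerD2l -[leRHS]real_normK ?num_real//.
  by apply: lerXn2r; rewrite ?nnegrE// ltW.
rewrite !exprVn sqr_sqrtr ?addr_ge0 ?sqr_ge0//.
by rewrite lef_pV2 ?posrE ?ltr_wpDl ?sqr_ge0// lerDr sqr_ge0.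
Qed.
End CoshApprox.

(** * Asymptotics of the Taylor coefficients of tanh and sech *)

Section PoleAsymptotics.
Variable R : realType.
Implicit Types (a t : R) (z w : R[i]).

Local Notation rc := (@real_complex_def R (Phant R)).
Local Notation normc := (@ComplexField.Normc.normc R).
Local Notation Re := (@complex.Re R).
Local Notation Im := (@complex.Im R).
Local Notation NN q := (q.+1.*2)%N.

Lemma cvg_even_subseq (u : nat -> R) (l : R) :
  u n @[n --> \oo] --> l -> u (NN q) @[q --> \oo] --> l.
Proof.
apply: cvg_comp => A [M _ MA]; exists M => // q /= Mq; apply: MA => /=; lia.
Qed.

Lemma psi_offset q (j : nat) : psi R (NN q) (q.+1 + j) = j.*2.+1%:R * (pi / 2) / (NN q)%:R.
Proof.
have N0 : (NN q)%:R != 0 :> R by rewrite pnatr_eq0.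
rewrite /psi; have -> : (q.+1 + j).*2.+1%:R - (NN q)%:R = j.*2.+1%:R :> R.
  by rewrite -natrB; [congr _%:R|]; lia.
by field.
Qed.

Lemma cvg_tau q0 : tau R q (q.+1 + q0) @[q --> \oo] --> ((q0.*2.+1%:R : R) * (pi / 2)).
Proof.
under eq_fun do rewrite /tau psi_offset.
exact: cvg_even_subseq (@cvg_mul_tan _ ((q0.*2.+1%:R : R) * (pi / 2))).
Qed.

Lemma cvg_tau0 : tau R q q.+1 @[q --> \oo] --> (pi / 2 : R).
Proof.
by have := @cvg_tau 0%N; rewrite mul1r; under eq_fun do rewrite addn0.
Qed.

Lemma tau_pred q : tau R q q = - tau R q q.+1.
Proof.
rewrite -tau_opp; last by lia.
by congr (tau _ _ _); lia.
Qed.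

Lemma cosh_approx_coef0 q a : (cosh_approx (NN q) a)`_0 != 0.
Proof.
rewrite coef_cosh_approx bin0 !expr0 subn0 invr1 !mul1r.
have sq0 (x : R) : 0 <= x ^+ (NN q) by rewrite exprn_even_ge0// odd_double.
rewrite mulf_neq0 ?invr_neq0//; apply/eqP => /eqP.
rewrite paddr_eq0// !expf_eq0 /= => /andP[/eqP h1 /eqP h2]; lra.
Qed.

(** For h the coefficients of a quotient by cosh (a + s), approximated by those
    of P / C_N, with weights W = P / C_N' at the poles. The innermost poles tend
    to - a + i pi/2 and - a - i pi/2 and give the main term; the next ones tend
    to - a + 3 i pi/2 and its conjugate and control the error. *)
Lemma pole_asymptotics a (h c : nat -> R) (P : nat -> {poly R}) (W : nat -> nat -> R[i]) w w' m :
  (forall m, \sum_(i < m.+1) ch a * (coshsinh (th a) (m - i) / (m - i)`!%:R) * h i = c m) ->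
  (forall q, (size (P q) <= NN q)%N) ->
  (forall j, (P q)`_j @[q --> \oo] --> c j) ->
  (forall q k, (k < NN q)%N -> (map_poly rc (P q)).[pole q a k] /
     (map_poly rc (cosh_approx (NN q) a))^`().[pole q a k] = W q k) ->
  (forall q k, (k < NN q)%N -> normc (W q k) <= 1) ->
  ccvg (fun q => W q q.+1) w -> ccvg (fun q => W q q) w' ->
  `| h m.+1 + (Re (w * (Complex (- a) (pi / 2))^-1 ^+ m.+2) +
     Re (w' * (Complex (- a) (- (pi / 2)))^-1 ^+ m.+2)) | <=
  (Num.sqrt (a ^+ 2 + (3 * (pi / 2)) ^+ 2))^-1 ^+ m.
Proof.
move=> hc sP cP PW W1 Ww Ww'.
pose H q i : R := - \sum_(k < NN q) pole_term q a i (W q) k.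
have Hh i : H q i @[q --> \oo] --> h i.
  apply: (triangular_cvg (g := fun q j => (cosh_approx (NN q) a)`_j) (p := fun q j => (P q)`_j)
    (g' := fun j => ch a * (coshsinh (th a) j / j`!%:R))
    _ hc _ _ _ cP) => [q j|q||j].
  - rewrite -(pole_conv a j (sP q)); apply: eq_bigr => l _; congr (_ * _).
    rewrite /H; congr (- _); apply: eq_bigr => k _.
    by rewrite /pole_term -PW.
  - exact: cosh_approx_coef0.
  - by rewrite /coshsinh /= fact0 divr1 mulr1 lt0r_neq0// ch_gt0.
  - exact: (cvg_even_subseq (u := fun n => (cosh_approx n a)`_j)) (@cvg_coef_cosh_approx _ a j).
have pi0 := pi_gt0 R.
have cpole1 : ccvg (fun q => pole q a q.+1) (Complex (- a) (pi / 2)).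
  by split; [exact: cvg_cst|exact: cvg_tau0].
have cpole2 : ccvg (fun q => pole q a q) (Complex (- a) (- (pi / 2))).
  split; first exact: cvg_cst.
  by under eq_fun do rewrite /pole /= tau_pred; apply: cvgN; exact: cvg_tau0.
have pole0 (b : R) : b != 0 -> Complex (- a) b != 0.
  by move=> b0; rewrite eq_complex /= (negbTE b0) andbF.
have F1 : pole_term q a m.+1 (W q) q.+1 @[q --> \oo] -->
    Re (w * (Complex (- a) (pi / 2))^-1 ^+ m.+2).
  apply: (proj1 (ccvgM Ww (ccvgX _ (ccvgV _ cpole1)))).
  by apply: pole0; rewrite gt_eqF// divr_gt0.
have F2 : pole_term q a m.+1 (W q) q @[q --> \oo] -->
    Re (w' * (Complex (- a) (- (pi / 2)))^-1 ^+ m.+2).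
  apply: (proj1 (ccvgM Ww' (ccvgX _ (ccvgV _ cpole2)))).
  by apply: pole0; rewrite oppr_eq0 gt_eqF// divr_gt0.
have B : (Num.sqrt (a ^+ 2 + tau R q q.+2 ^+ 2))^-1 ^+ m @[q --> \oo] -->
    (Num.sqrt (a ^+ 2 + (3 * (pi / 2)) ^+ 2))^-1 ^+ m.
  apply: (cvg_comp (fun q => (Num.sqrt (a ^+ 2 + tau R q q.+2 ^+ 2))^-1) (fun x : R => x ^+ m));
    last exact: exprn_continuous.
  apply: cvgV.
    by rewrite gt_eqF// sqrtr_gt0 ltr_wpDl ?sqr_ge0// exprn_gt0// mulr_gt0// divr_gt0.
  apply: (cvg_comp (fun q => a ^+ 2 + tau R q q.+2 ^+ 2) (@Num.sqrt R));
    last exact: sqrt_continuous.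
  apply: cvgD; first exact: cvg_cst.
  have T : tau R q q.+2 @[q --> \oo] --> (3 : R) * (pi / 2).
    by have := @cvg_tau 1%N; under eq_fun do rewrite addn1.
  by apply: cvgM; exact: T.
have L := cvg_norm (cvgD (Hh m.+1) (cvgD F1 F2)).
apply: (ler_cvg_to (L _ _ _) B); near=> q.
have q0 : (0 < q)%N by near: q; exact: nbhs_infty_gt.
apply: le_trans (tail_bound a m q0 (W1 q)).
rewrite -[leLHS]normrN; set S := \sum_(_ < _) _.
have -> : (H^~ m.+1 + ((fun q => pole_term q a m.+1 (W q) q.+1) +
   (fun q => pole_term q a m.+1 (W q) q))) q = - S + (pole_term q a m.+1 (W q) q.+1 +
     pole_term q a m.+1 (W q) q) by [].
by rewrite opprD opprK.
Unshelve. all: by end_near. Qed.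

Lemma conv_divfact (g F : nat -> R) m (c : R) :
  \sum_(i < m.+1) 'C(m, i)%:R * g (m - i)%N * F i = c ->
  \sum_(i < m.+1) (g (m - i)%N / (m - i)`!%:R) * (F i / i`!%:R) = c / m`!%:R.
Proof.
have f0 n : n`!%:R != 0 :> R by rewrite pnatr_eq0 -lt0n fact_gt0.
move=> <-; rewrite mulr_suml; apply: eq_bigr => i _.
have im : (i <= m)%N by rewrite -ltnS.
have -> : m`!%:R = 'C(m, i)%:R * (i`!%:R * (m - i)`!%:R) :> R.
  by rewrite -!natrM bin_fact.
have b0 : 'C(m, i)%:R != 0 :> R by rewrite pnatr_eq0 -lt0n bin_gt0.
by move: ('C(m, i)%:R) b0 (i`!%:R) (f0 i) ((m - i)`!%:R) (f0 (m - i)%N) => x x0 y y0 z z0;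
   field; rewrite x0 y0 z0.
Qed.

Lemma th_lt1 a : -1 < th a < 1.
Proof.
rewrite /th ltr_pdivlMr ?ch_gt0// ltr_pdivrMr ?ch_gt0// /sh /ch.
have e0 := expR_gt0 a; have e1 := expR_gt0 (- a); apply/andP; split; lra.
Qed.

(** The two innermost poles are - r exp (- i t) and - r exp (i t). *)
Let pole_polar (r t : R) b : r != 0 ->
  (Complex (- (r * cos t)) (r * sin t))^-1 ^+ b = rc ((- r^-1) ^+ b) * cexp (b%:R * t) /\
  (Complex (- (r * cos t)) (- (r * sin t)))^-1 ^+ b = rc ((- r^-1) ^+ b) * cexp (- (b%:R * t)).
Proof.
move=> r0.
have E s : Complex (- (r * cos s)) (r * sin s) = rc (- r) * cexp (- s).
  by rewrite /cexp cosN sinN; simpc; congr Complex; ring.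
have V s : (Complex (- (r * cos s)) (r * sin s))^-1 ^+ b = rc ((- r^-1) ^+ b) * cexp (b%:R * s).
  rewrite E invfM -fmorphV -cexpN opprK invrN exprMn -cexpX; congr (_ * _).
  by rewrite rmorphXn.
by split; [exact: V | have := V (- t); rewrite cosN sinN !mulrN].
Qed.

(** tanh (a + s) is the logarithmic derivative of cosh (a + s), approximated by
    C_N' / C_N, all of whose weights are 1. *)
Lemma tanh_asymptotics (r t : R) m : r != 0 -> r * sin t = pi / 2 ->
  `| (tanh_poly R m.+1).[th (r * cos t)] / m.+1`!%:R +
     2 * (- r^-1) ^+ m.+2 * cos (m.+2%:R * t) | <=
  (Num.sqrt ((r * cos t) ^+ 2 + (3 * (pi / 2)) ^+ 2))^-1 ^+ m.
Proof.
move=> r0 rs; set a := r * cos t.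
have := @pole_asymptotics a (fun i => (tanh_poly R i).[th a] / i`!%:R)
  (fun m => ch a * coshsinh (th a) m.+1 / m`!%:R)
  (fun q => (cosh_approx (NN q) a)^`()) (fun _ _ => 1) 1 1 m.
have -> : Complex (- a) (pi / 2) = Complex (- (r * cos t)) (r * sin t) by rewrite rs.
have -> : Complex (- a) (- (pi / 2)) = Complex (- (r * cos t)) (- (r * sin t)) by rewrite rs.
rewrite (pole_polar t m.+2 r0).1 (pole_polar t m.+2 r0).2 !mul1r !Re_rcM /= cosN.
set X := _ ^+ m.+2 => H.
have -> : 2 * X * cos (m.+2%:R * t) = X * cos (m.+2%:R * t) + X * cos (m.+2%:R * t) by ring.
apply: H => [k|q|j|q k kN|q k kN||].
- transitivity (ch a * (coshsinh (th a) k.+1 / k`!%:R)); last by rewrite mulrA.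
  transitivity (ch a * (\sum_(i < k.+1) coshsinh (th a) (k - i) / (k - i)`!%:R *
      ((tanh_poly R i).[th a] / i`!%:R))).
    by rewrite mulr_sumr; apply: eq_bigr => i _; rewrite [RHS]mulrA.
  by congr (_ * _); exact: (@conv_divfact (coshsinh (th a)) (fun i => (tanh_poly R i).[th a]) _ _ (tanh_poly_conv k (th a))).
- exact: size_cosh_approx_deriv.
- under eq_fun do rewrite coef_deriv.
  have -> : ch a * coshsinh (th a) j.+1 / j`!%:R =
      ch a * (coshsinh (th a) j.+1 / j.+1`!%:R) *+ j.+1.
    rewrite factS natrM invfM -[RHS]mulr_natl.
    have f0 : j`!%:R != 0 :> R by rewrite pnatr_eq0 -lt0n fact_gt0.
    have j0 : j.+1%:R != 0 :> R by rewrite pnatr_eq0.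
    by move: (j`!%:R) f0 (j.+1%:R) j0 => x x0 y y0; field; rewrite x0 y0.
  apply: (cvg_comp (fun q => (cosh_approx (NN q) a)`_j.+1) (fun x : R => x *+ j.+1));
    last exact: natmul_continuous.
  exact: (cvg_even_subseq (u := fun n => (cosh_approx n a)`_j.+1)) (@cvg_coef_cosh_approx _ a j.+1).
- by rewrite -deriv_map mulfV// deriv_cosh_approx_neq0.
- by rewrite le_eqVlt; apply/orP; left; apply/eqP; exact: ComplexField.Normc.normc1.
- by split; exact: cvg_cst.
- by split; exact: cvg_cst.
Qed.

(** The innermost angle is of order 1/N, hence its cosine is 1 - O(1/N^2), and
    the exponent is only N - 2. *)
Lemma cvg_cos_pow : cos (psi R (NN q) q.+1) ^+ (NN q).-2 @[q --> \oo] --> (1 : R).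
Proof.
have pi0 := pi_gt0 R.
pose T q := tan (psi R (NN q) q.+1).
have lo : 1 - tau R q q.+1 ^+ 2 * (NN q)%:R^-1 @[q --> \oo] --> (1 : R).
  have T2 : tau R q q.+1 ^+ 2 @[q --> \oo] --> ((pi / 2) ^+ 2 : R).
    by apply: cvgM; exact: cvg_tau0.
  have I : (NN q)%:R^-1 @[q --> \oo] --> (0 : R).
    apply: (cvg_even_subseq (u := fun n => n%:R^-1)).
    by have := cvg_divn (1 : R); under eq_fun do rewrite mul1r.
  rewrite -[X in _ --> X]subr0 -[X in _ --> _ - X](mulr0 ((pi / 2) ^+ 2)).
  by apply: cvgB; [exact: cvg_cst|exact: cvgM].
apply: (squeeze_cvgr _ lo (cvg_cst (1 : R))); near=> q.
have q1N : (q.+1 < NN q)%N by lia.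
have c0 := cos_psi_gt0 R q1N.
have cE := cos2_tan2 (lt0r_neq0 c0); rewrite -/(T q) in cE.
set c := cos _ in c0 cE *.
have N0 : 0 < (NN q)%:R :> R by rewrite ltr0n.
have t0 := sqr_ge0 (T q).
have c2E : c ^+ 2 = (1 + T q ^+ 2)^-1 by rewrite -cE invrK.
apply/andP; split; last by rewrite exprn_ile1 ?cos_le1 ?ltW.
have c2ge : 1 - T q ^+ 2 <= c ^+ 2.
  by rewrite c2E -[leRHS]mul1r ler_pdivlMr; nra.
have -> : c ^+ (NN q).-2 = (c ^+ 2) ^+ q by rewrite -exprM mul2n.
have -> : tau R q q.+1 ^+ 2 * (NN q)%:R^-1 = (NN q)%:R * T q ^+ 2.
  by rewrite /tau exprMn -/(T q) mulrAC expr2 mulfK ?gt_eqF.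
have qN : q%:R <= (NN q)%:R :> R by rewrite ler_nat; lia.
have N1 : 1 <= (NN q)%:R :> R by rewrite ler1n.
have [T1|T1] := leP (T q ^+ 2) 1; last first.
  apply: (@le_trans _ _ 0); first nra.
  by rewrite exprn_ge0// sqr_ge0.
apply: (@le_trans _ _ (1 - q%:R * T q ^+ 2)); first by rewrite lerD2l lerN2 ler_wpM2r.
apply: le_trans (bernoulli_ineq _ _) _; first by apply/andP.
by apply: lerXn2r; rewrite ?nnegrE ?sqr_ge0// subr_ge0.
Unshelve. all: by end_near. Qed.

(** Here P = 1 and the weights 1 / C_N' have modulus a power of cos psi, hence
    at most 1; the innermost ones tend to - i and i. *)
Lemma sech_asymptotics (r t : R) m : r != 0 -> r * sin t = pi / 2 ->
  `| eulerianB_hom m.+1 (th (r * cos t)) / (-2) ^+ m.+1 / m.+1`!%:R / ch (r * cos t) +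
     2 * (- r^-1) ^+ m.+2 * sin (m.+2%:R * t) | <=
  (Num.sqrt ((r * cos t) ^+ 2 + (3 * (pi / 2)) ^+ 2))^-1 ^+ m.
Proof.
move=> r0 rs; set a := r * cos t.
have th1 := th_lt1 a; have ch0 := lt0r_neq0 (ch_gt0 a).
have im2 : 'i%C * 'i%C = -1 :> R[i] by rewrite -expr2 sqr_i.
pose W q k : R[i] := rc (cos (psi R (NN q) k) ^+ (NN q).-2) * (- pole_sign R q k).
have sgn2 q k : pole_sign R q k * pole_sign R q k = -1.
  by rewrite /pole_sign mulrACA im2 -expr2 sqrr_sign mul1r.
have := @pole_asymptotics a (fun i => eulerianB_hom i (th a) / (-2) ^+ i / i`!%:R / ch a)
  (fun m => (m == 0%N)%:R) (fun q => 1) W (- 'i%C) 'i%C m.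
have -> : Complex (- a) (pi / 2) = Complex (- (r * cos t)) (r * sin t) by rewrite rs.
have -> : Complex (- a) (- (pi / 2)) = Complex (- (r * cos t)) (- (r * sin t)) by rewrite rs.
rewrite (pole_polar t m.+2 r0).1 (pole_polar t m.+2 r0).2.
rewrite ![_ * (rc _ * _)]mulrCA !Re_rcM /cexp cosN sinN.
set X := _ ^+ m.+2; set s := sin (m.+2%:R * t) => H.
have -> : 2 * X * s = X * Re (- 'i%C * Complex (cos (m.+2%:R * t)) s) +
    X * Re ('i%C * Complex (cos (m.+2%:R * t)) (- s)) by simpc; ring.
apply: H => [k|q|j|q k kN|q k kN||].
- have x1 : 1 + th a != 0 by rewrite gt_eqF//; lra.
  have E := @conv_divfact (coshsinh (th a)) (fun i => eulerianB_hom i (th a) / (-2) ^+ i) _ _ (eulerianB_hom_conv k x1).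
  transitivity (((k == 0%N)%:R / k`!%:R) : R); last first.
    by case: k {E} => [|k]; rewrite ?fact0 ?divr1// mul0r.
  rewrite -E; apply: eq_bigr => i _.
  have cancel (c x y : R) : c != 0 -> c * x * (y / c) = x * y by move=> c0; field.
  exact: cancel.
- by rewrite size_poly1.
- by under eq_fun do rewrite coef1; exact: cvg_cst.
- rewrite rmorph1 hornerC mul1r deriv_cosh_approx_pole// /W invfM -fmorphV invrK.
  congr (_ * _); have s0 : pole_sign R q k != 0.
    by apply: contraNneq (oner_neq0 R[i]) => s0; have := sgn2 q k; rewrite s0 mul0r => /eqP; rewrite eq_sym oppr_eq0.
  by apply: (mulfI s0); rewrite mulfV// mulrN sgn2 opprK.
- rewrite ComplexField.Normc.normcM.
  have -> : normc (- pole_sign R q k) = 1.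
    have normcN z : normc (- z) = normc z by case: z => u v /=; rewrite !sqrrN.
    rewrite normcN /pole_sign ComplexField.Normc.normcM normcX normcN ComplexField.Normc.normc1.
    by rewrite expr1n mul1r /= expr0n /= add0r expr1n sqrtr1.
  rewrite mulr1 /= expr0n /= addr0 sqrtr_sqr normrX exprn_ile1//.
  by rewrite ger0_norm ?cos_le1// ltW// cos_psi_gt0.
- have -> : - 'i%C = rc 1 * - 'i%C :> R[i] by rewrite mul1r.
  apply: ccvgM; first by split; [exact: cvg_cos_pow|exact: cvg_cst].
  have -> : (fun q => - pole_sign R q q.+1) = (fun=> - 'i%C).
    apply/funext => q; rewrite /pole_sign addnn -mul2n exprM sqrrN !expr1n mul1r //.
  by split; exact: cvg_cst.
- have -> : 'i%C = rc 1 * 'i%C :> R[i] by rewrite mul1r.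
  apply: ccvgM.
    split; last exact: cvg_cst.
    have psiE q : psi R (NN q) q = - psi R (NN q) q.+1.
      by rewrite -psi_opp; [congr psi|]; lia.
    rewrite /= ; under eq_fun do rewrite psiE cosN; exact: cvg_cos_pow.
  have -> : (fun q => - pole_sign R q q) = (fun=> 'i%C).
    apply/funext => q; rewrite /pole_sign addnS addnn -mul2n exprS exprM sqrrN !expr1n mulr1.
    by rewrite mulN1r opprK.
  by split; exact: cvg_cst.
Qed.
End PoleAsymptotics.

(** * Sign alternation at the nodes *)

Section Alternation.
Variable R : realType.
Implicit Types (v eta r K : R) (n i M m : nat).

(** In the variable v the phase of the innermost pole is linear, which makes
    the sign changes equally spaced. *)
Definition quantile v : R := th (pi / 2 * tan (pi / 2 * v)) ^+ 2.

(** The ratio of the two sides is r^2 / 2 times the m-th power of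
    r / sqrt (r^2 + 2 pi^2), and this last quotient is bounded away from 1
    for bounded r. *)
Lemma remainder_lt_main K : 0 < K ->
  \forall m \near \oo, forall r : R, 0 < r -> r ^+ 2 <= K ->
    (Num.sqrt (r ^+ 2 + 2 * pi ^+ 2))^-1 ^+ m < 2 * (r^-1) ^+ m.+2.
Proof.
move=> K0; have pi0 := pi_gt0 R.
have D0 : 0 < K + 2 * pi ^+ 2 by rewrite addr_gt0// mulr_gt0// exprn_gt0.
(* The ratio r / sqrt (r^2 + 2 pi^2) increases with r. *)
pose kappa := Num.sqrt (K / (K + 2 * pi ^+ 2)).
have kappa1 : `|kappa| < 1.
  rewrite ger0_norm ?sqrtr_ge0// -[ltRHS](sqrtr1 R) ltr_sqrt// ltr_pdivrMr// mul1r ltrDl.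
  by rewrite mulr_gt0// exprn_gt0.
have C : K * kappa ^+ m @[m --> \oo] --> (0 : R).
  by rewrite -[X in _ --> X](mulr0 K); apply: cvgM; [exact: cvg_cst|exact: cvg_expr].
have Cn : \forall m \near \oo, K * kappa ^+ m < 2 by apply: (cvgr_lt _ C); rewrite ltr0n.
apply: filterS Cn => m Km r r0 rK.
have S0 : 0 < r ^+ 2 + 2 * pi ^+ 2 by rewrite addr_gt0 ?mulr_gt0 ?exprn_gt0.
set s := Num.sqrt _; have s0 : 0 < s by rewrite sqrtr_gt0.
have rs : r / s <= kappa.
  have rs0 : 0 <= r / s by rewrite divr_ge0 ?ltW.
  rewrite -(ger0_norm rs0) -sqrtr_sqr /kappa ler_wsqrtr//.
  rewrite expr_div_n /s (sqr_sqrtr (ltW S0)) ler_pdivrMr// mulrAC ler_pdivlMr//.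
  rewrite !mulrDr mulrC lerD2l ler_pM2r//.
  by rewrite mulr_gt0// exprn_gt0.
have E : r ^+ 2 * (r / s) ^+ m < 2.
  apply: le_lt_trans Km; apply: ler_pM => //; first exact: sqr_ge0.
    by rewrite exprn_ge0// divr_ge0// ltW.
  by apply: lerXn2r; rewrite ?nnegrE ?sqrtr_ge0// divr_ge0// ltW.
have rm : 0 < r ^+ m.+2 by rewrite exprn_gt0.
rewrite exprVn [X in _ < 2 * X]exprVn ltr_pdivlMr//.
by move: E; rewrite expr_div_n mulrA -exprD add2n mulrC.
Qed.

(* With a = (pi/2) tan alpha, the innermost poles have modulus r, and their
   phase t is affine in alpha, hence in v. *)
Section Angle.
Variable v : R.
Hypothesis v01 : 0 < v < 1.
Let alpha := pi / 2 * v.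
Let t := pi / 2 - alpha.
Let r := pi / 2 / cos alpha.

Let alpha_itv : 0 < alpha < pi / 2.
Proof.
have pi0 : 0 < pi / 2 :> R by rewrite divr_gt0// pi_gt0.
by rewrite /alpha mulr_gt0 ?gtr_pMr//; case/andP: v01.
Qed.

Lemma cos_alpha_gt0 : 0 < cos alpha.
Proof. by apply: cos_gt0_pihalf; move: alpha_itv => /andP[? ->]; rewrite andbT; have := pi_gt0 R; lra. Qed.

Lemma angle_radius_gt0 : 0 < r.
Proof. by rewrite divr_gt0 ?cos_alpha_gt0// divr_gt0// pi_gt0. Qed.

Lemma sin_angle : sin t = cos alpha.
Proof. by rewrite /t -opprB sinN sinBpihalf opprK. Qed.

Lemma cos_angle : cos t = sin alpha.
Proof. by rewrite /t -cosN opprB cosBpihalf. Qed.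

Lemma radius_sin : r * sin t = pi / 2.
Proof. by rewrite sin_angle /r divfK// gt_eqF// cos_alpha_gt0. Qed.

Lemma radius_cos : r * cos t = pi / 2 * tan alpha.
Proof. by rewrite cos_angle /r /tan mulrAC mulrA. Qed.

(** The squared modulus of the next poles exceeds that of the innermost ones by
    (3 pi/2)^2 - (pi/2)^2. *)
Lemma radius_sqrD : (r * cos t) ^+ 2 + (3 * (pi / 2)) ^+ 2 = r ^+ 2 + 2 * pi ^+ 2.
Proof.
have -> : (r * cos t) ^+ 2 = r ^+ 2 - (r * sin t) ^+ 2.
  by rewrite !exprMn cos2sin2; ring.
by rewrite radius_sin; field.
Qed.

Lemma quantile_arg_gt0 : 0 < pi / 2 * tan alpha.
Proof.
have /andP[a0 a1] := alpha_itv.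
apply: mulr_gt0; first by rewrite divr_gt0// pi_gt0.
by rewrite /tan divr_gt0 ?cos_alpha_gt0// sin_gt0_pihalf// a0.
Qed.

Lemma th_quantile_arg : 0 < th (pi / 2 * tan alpha) < 1.
Proof.
rewrite (andP (th_lt1 _)).2 andbT divr_gt0 ?ch_gt0// divr_gt0// subr_gt0 ltr_expR.
by have := quantile_arg_gt0; rewrite /alpha; lra.
Qed.

End Angle.

Lemma cos_natpi k : cos (k%:R * pi : R) = (-1) ^+ k.
Proof.
elim: k => [|k IH]; first by rewrite mul0r cos0.
by rewrite -natr1 mulrDl mul1r cosDpi IH exprS mulN1r.
Qed.

Lemma node_angle n i M : (i < n)%N -> (0 < M)%N ->
  M%:R * (pi / 2 - pi / 2 * ((2 * i + 1)%:R / M%:R)) =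
  (M%:R - (2 * i + 1)%:R) * (pi / 2) :> R.
Proof. by move=> iN M0; have M0' : M%:R != 0 :> R; [rewrite pnatr_eq0 -lt0n|field]. Qed.

Lemma cos_node n i : (i < n)%N -> let M := (2 * n).+1 in
  cos (M%:R * (pi / 2 - pi / 2 * ((2 * i + 1)%:R / M%:R))) = (-1) ^+ (n + i) :> R.
Proof.
move=> iN M; rewrite (@node_angle n)//.
have -> : (M%:R - (2 * i + 1)%:R) * (pi / 2) = (n - i)%:R * pi :> R.
  by rewrite natrB ?(ltnW iN)// /M -natr1 natrD !natrM; field.
rewrite cos_natpi -signr_odd -[RHS]signr_odd oddB ?(ltnW iN)// oddD //.
Qed.

Lemma sin_node n i : (i < n)%N -> let M := (2 * n)%N in
  sin (M%:R * (pi / 2 - pi / 2 * ((2 * i + 1)%:R / M%:R))) = - (-1) ^+ (n + i) :> R.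
Proof.
move=> iN M; rewrite (@node_angle n)//; last by rewrite /M; lia.
have -> : (M%:R - (2 * i + 1)%:R) * (pi / 2) = (n - i)%:R * pi - pi / 2 :> R.
  by rewrite natrB ?(ltnW iN)// /M natrD !natrM; field.
rewrite sinBpihalf cos_natpi -signr_odd -[in RHS]signr_odd oddB ?(ltnW iN)// oddD //.
Qed.

(** For M = 2n + 1, respectively M = 2n, the cosine, respectively the sine, of
    the main term is 1 or -1 at these points. *)
Definition node M i : R := (2 * i + 1)%:R / M%:R.

Lemma sign_of_approx (x y B s : R) : s = 1 \/ s = -1 -> `|x - y * s| <= B -> B < y -> 0 < s * x.
Proof. by move=> [->|->]; rewrite ler_norml => /andP[]; nra. Qed.

(** Bounded radii are what makes the estimates uniform over the nodes up to eta. *)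
Lemma radius_bound v eta : 0 < v -> v <= eta -> eta < 1 ->
  (pi / 2 / cos (pi / 2 * v)) ^+ 2 <= (pi / 2 / cos (pi / 2 * eta)) ^+ 2.
Proof.
move=> v0 ve e1; have pi0 := pi_gt0 R; have e0 := lt_le_trans v0 ve.
have ce : 0 < cos (pi / 2 * eta) by apply: cos_alpha_gt0; rewrite e0.
have cv : 0 < cos (pi / 2 * v) by apply: cos_alpha_gt0; rewrite v0 (le_lt_trans ve).
have cle : cos (pi / 2 * eta) <= cos (pi / 2 * v).
  rewrite leNgt ltr_cos ?in_itv /=; last 2 first.
  - by apply/andP; split; nra.
  - by apply/andP; split; nra.
  by rewrite -leNgt ler_pM2l// divr_gt0.
have p20 : 0 < pi / 2 :> R by rewrite divr_gt0.
apply: lerXn2r; rewrite ?nnegrE; [exact/ltW/divr_gt0|exact/ltW/divr_gt0|].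
by rewrite ler_pM2l// lef_pV2.
Qed.

Lemma sign_pm k : (-1) ^+ k = 1 :> R \/ (-1) ^+ k = -1 :> R.
Proof. by rewrite -signr_odd; case: odd; [right|left]; rewrite ?expr1 ?expr0. Qed.

(** At a node the main term has modulus 2 / r^(2n+1), and it dominates the
    remainder as soon as n is large, uniformly in i. *)
Lemma tanh_poly_sign eta : 0 < eta < 1 ->
  \forall n \near \oo, forall i, (i < n)%N -> node (2 * n).+1 i <= eta ->
    0 < (-1) ^+ (n + i) * (tanh_poly R (2 * n)).[th (pi / 2 * tan (pi / 2 * node (2 * n).+1 i))].
Proof.
move=> /andP[e0 e1]; have pi0 := pi_gt0 R.
have K0 : 0 < (pi / 2 / cos (pi / 2 * eta)) ^+ 2.
  by rewrite exprn_gt0// angle_radius_gt0// e0.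
have [m0 _ main] := remainder_lt_main K0.
exists m0.+1 => // n /= mn i iN vle.
set v := node _ _ in vle *.
have v0 : 0 < v by rewrite divr_gt0// ltr0n; lia.
have v01 : 0 < v < 1 by rewrite v0 (le_lt_trans vle).
set r := pi / 2 / cos (pi / 2 * v); have r0 : 0 < r := angle_radius_gt0 v01.
have rK : r ^+ 2 <= (pi / 2 / cos (pi / 2 * eta)) ^+ 2 := radius_bound v0 vle e1.
have [m mE] : exists m, (2 * n = m.+1)%N by exists (2 * n).-1; lia.
have mm : (m0 <= m)%N by lia.
have lt := main m mm r r0 rK.
have := tanh_asymptotics m (lt0r_neq0 r0) (radius_sin v01).
rewrite (radius_sqrD v01) radius_cos -mE -/r => approx.
have cosE := cos_node iN; rewrite /= -/(node _ i) -/v in cosE.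
rewrite cosE in approx.
have f0 : 0 < (2 * n)`!%:R :> R by rewrite ltr0n fact_gt0.
have sr : (- r^-1) ^+ (2 * n).+1 = - r^-1 ^+ (2 * n).+1.
  by rewrite exprNn exprS exprM sqrrN !expr1n mulr1 mulN1r.
rewrite sr mulrN mulNr in approx.
have := sign_of_approx (sign_pm (n + i)) approx.
rewrite -mE in lt; move/(_ lt).
by rewrite mulrA pmulr_lgt0// invr_gt0.
Qed.

Lemma eulerianB_hom_sign eta : 0 < eta < 1 ->
  \forall n \near \oo, forall i, (i < n)%N -> node (2 * n) i <= eta ->
    (-1) ^+ (n + i) * eulerianB_hom (2 * n).-1 (th (pi / 2 * tan (pi / 2 * node (2 * n) i))) < 0.
Proof.
move=> /andP[e0 e1]; have pi0 := pi_gt0 R.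
have K0 : 0 < (pi / 2 / cos (pi / 2 * eta)) ^+ 2.
  by rewrite exprn_gt0// angle_radius_gt0// e0.
have [m0 _ main] := remainder_lt_main K0.
exists m0.+1 => // n /= mn i iN vle.
set v := node _ _ in vle *.
have v0 : 0 < v by rewrite divr_gt0// ltr0n; lia.
have v01 : 0 < v < 1 by rewrite v0 (le_lt_trans vle).
set r := pi / 2 / cos (pi / 2 * v); have r0 : 0 < r := angle_radius_gt0 v01.
have rK : r ^+ 2 <= (pi / 2 / cos (pi / 2 * eta)) ^+ 2 := radius_bound v0 vle e1.
have [m mE] : exists m, (2 * n = m.+2)%N by exists (2 * n).-2; lia.
have mm : (m0 <= m)%N by lia.
have lt := main m mm r r0 rK.
have := sech_asymptotics m (lt0r_neq0 r0) (radius_sin v01).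
rewrite (radius_sqrD v01) radius_cos -/r => approx.
have sinE := sin_node iN; rewrite /= -/(node _ i) -/v in sinE.
rewrite -mE sinE in approx.
have mE1 : (2 * n).-1 = m.+1 by rewrite mE.
rewrite mE1.
set a := pi / 2 * tan _ in approx *.
have f0 : 0 < m.+1`!%:R :> R by rewrite ltr0n fact_gt0.
have sr : (- r^-1) ^+ (2 * n) = r^-1 ^+ (2 * n) by rewrite !exprM sqrrN.
have s2 : (-2) ^+ m.+1 = - 2 ^+ m.+1 :> R.
  by rewrite exprNn -signr_odd -mE1 (_ : odd _ = true) ?expr1 ?mulN1r//; lia.
rewrite sr mulrN in approx.
have := sign_of_approx (sign_pm (n + i)) approx.
rewrite -mE in lt; move/(_ lt).
rewrite s2 !mulrA pmulr_lgt0 ?invr_gt0 ?ch_gt0// pmulr_lgt0 ?invr_gt0//.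
by rewrite invrN mulrN oppr_gt0 pmulr_llt0// invr_gt0 exprn_gt0.
Qed.

(** The nodes above eta, which are left out, are a fraction about 1 - eta of
    all nodes; s absorbs a sign depending on n. *)
Definition sign_alternating (p : nat -> {poly R}) (M : nat -> nat) :=
  forall eta, 0 < eta < 1 -> \forall n \near \oo, exists s : R, forall i, (i < n)%N ->
    node (M n) i <= eta -> 0 < s * (-1) ^+ i * (p n).[quantile (node (M n) i)].

Lemma node_lt1 n i M : (i < n)%N -> (2 * n <= M)%N -> 0 < node M i < 1.
Proof.
move=> iN nM; have M0 : 0 < M%:R :> R by rewrite ltr0n; lia.
have i0 : 0 < (2 * i + 1)%:R :> R by rewrite ltr0n; lia.
rewrite /node divr_gt0//=.
by rewrite ltr_pdivrMr// mul1r ltr_nat; lia.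
Qed.

Lemma sign_transfer n i (c x y : R) : c != 0 -> 0 < x ->
  (-1) ^+ (n + i) * (2 * x * y) < 0 -> 0 < - (-1) ^+ n / c * (-1) ^+ i * (c * y).
Proof.
move=> c0 x0; have x2 : 0 < 2 * x by rewrite mulr_gt0.
rewrite exprD mulrCA (pmulr_rlt0 _ x2) => H.
have -> : - (-1) ^+ n / c * (-1) ^+ i * (c * y) = - ((-1) ^+ n * (-1) ^+ i * y).
  by move: ((-1) ^+ n) ((-1) ^+ i) => u w; field.
by rewrite oppr_gt0.
Qed.

Lemma Lambda_alternating : sign_alternating (Lambda_tilde R) (fun n => (2 * n).+1).
Proof.
move=> eta e01; have := tanh_poly_sign e01.
apply: filterS2 (nbhs_infty_gt 0) => n /= n0 H.
set c : R := 2 * (-1) ^+ n.+1 / ((2 ^+ (2 * n).+1 - 1) * ((2 * n)`!)%:R).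
have c0 : c != 0.
  have f0 : (2 * n)`!%:R != 0 :> R by rewrite pnatr_eq0 -lt0n fact_gt0.
  have p0 : 2 ^+ (2 * n).+1 - 1 != 0 :> R.
    by rewrite subr_eq0 gt_eqF// exprn_egt1// ltr1n.
  by apply: mulf_neq0; rewrite ?invr_eq0; apply: mulf_neq0; rewrite // ?signr_eq0// pnatr_eq0.
exists (- (-1) ^+ n / c) => i iN vle.
have v01 : 0 < node (2 * n).+1 i < 1 by apply: node_lt1 iN _.
have {H} := H i iN vle.
have /andP[x0 x1] := th_quantile_arg v01.
rewrite /quantile; set x := th _ in x0 x1 *.
rewrite /Lambda_tilde /Lambda even_poly_sum -/c => H.
apply: (sign_transfer c0 x0); rewrite CA_half_sum.
have [m mE] : exists m, (2 * n = m.+1)%N by exists (2 * n).-1; lia.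
move: H; rewrite mE tanh_poly_eulerianA -mE.
have -> : (-1) ^+ m = -1 :> R by rewrite -signr_odd (_ : odd m = true) ?expr1//; lia.
rewrite mulN1r !mulNr mulrN oppr_gt0 mulrCA pmulr_rlt0// subr_gt0.
by rewrite expr_lt1 ?ltW.
Qed.

Lemma Xi_alternating : sign_alternating (Xi_tilde R) (fun n => 2 * n)%N.
Proof.
move=> eta e01; have := eulerianB_hom_sign e01.
apply: filterS2 (nbhs_infty_gt 0) => n /= n0 H.
set c : R := (-1) ^+ n.+1 / (2 ^+ (4 * n - 2) * ((2 * n - 1)`!)%:R).
have c0 : c != 0.
  have f0 : (2 * n - 1)`!%:R != 0 :> R by rewrite pnatr_eq0 -lt0n fact_gt0.
  apply: mulf_neq0; first by rewrite signr_eq0.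
  by rewrite invr_eq0 mulf_neq0// expf_neq0// pnatr_eq0.
exists (- (-1) ^+ n / c) => i iN vle.
have v01 : 0 < node (2 * n) i < 1 by apply: node_lt1 iN _.
have {H} := H i iN vle.
have /andP[x0 x1] := th_quantile_arg v01.
rewrite /quantile; set x := th _ in x0 x1 *.
rewrite /Xi_tilde /Xi even_poly_sum -/c => H.
by apply: (sign_transfer c0 x0); rewrite CB_half_sum.
Qed.
End Alternation.

(** * Distribution function and quantiles of the limit law *)

Section LimitLaw.
Variable R : realType.
Implicit Types (x y v w a b s : R).
Local Notation leb := (@lebesgue_measure R).

Definition density x : R :=
  2 / (Num.sqrt x * (1 - x)
         * (ln ((1 - Num.sqrt x) / (1 + Num.sqrt x)) ^+ 2 + pi ^+ 2)).

Definition cdf_mu x : R :=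
  2 / pi * atan ((ln (1 + Num.sqrt x) - ln (1 - Num.sqrt x)) / pi).

Lemma rhoE x : rho x = if 0 < x < 1 then density x else 0.
Proof. by []. Qed.

Lemma sqrt_itv x : 0 < x < 1 -> 0 < Num.sqrt x < 1.
Proof.
by move=> /andP[x0 x1]; rewrite sqrtr_gt0 x0 -[ltRHS](sqrtr1 R) ltr_sqrt.
Qed.

Lemma ln_ratio x : 0 < x < 1 ->
  ln ((1 - Num.sqrt x) / (1 + Num.sqrt x)) = - (ln (1 + Num.sqrt x) - ln (1 - Num.sqrt x)).
Proof.
by move=> /sqrt_itv/andP[s0 s1]; rewrite ln_div ?opprB// posrE; lra.
Qed.

Lemma density_gt0 x : 0 < x < 1 -> 0 < density x.
Proof.
move=> x01; have /andP[s0 s1] := sqrt_itv x01; case/andP: x01 => x0 x1.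
rewrite /density divr_gt0// mulr_gt0//; first by rewrite mulr_gt0// subr_gt0.
by rewrite ltr_wpDl ?sqr_ge0// exprn_gt0// pi_gt0.
Qed.

Lemma rho_ge0 x : 0 <= rho x.
Proof. by rewrite rhoE; case: ifPn => // /density_gt0/ltW. Qed.

Lemma continuous_density x : 0 < x < 1 -> {for x, continuous density}.
Proof.
move=> x01; have /andP[s0 s1] := sqrt_itv x01; case/andP: (x01) => x0 x1.
have cs := @sqrt_continuous R x.
rewrite /density; apply: cvgM; first exact: cvg_cst.
apply: cvgV.
  have := density_gt0 x01; rewrite /density => H; apply/eqP => E.
  by move: H; rewrite E invr0 mulr0 ltxx.
apply: cvgM.
  by apply: cvgM => //; apply: cvgB; [exact: cvg_cst|exact: cvg_id].
apply: cvgD; last exact: cvg_cst.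
have cl : ln ((1 - Num.sqrt y) / (1 + Num.sqrt y)) @[y --> x] -->
    ln ((1 - Num.sqrt x) / (1 + Num.sqrt x)).
  apply: (cvg_comp (fun y => (1 - Num.sqrt y) / (1 + Num.sqrt y)) (@ln R)); last first.
    by apply: continuous_ln; rewrite divr_gt0//; lra.
  apply: cvgM; first by apply: cvgB => //; exact: cvg_cst.
  by apply: cvgV; [lra|apply: cvgD => //; exact: cvg_cst].
exact: (cvgM cl cl).
Qed.

(** With s = sqrt x the derivative of ln (1 + s) - ln (1 - s) in x is
    1 / (s (1 - x)). *)
Lemma is_derive_cdf x : 0 < x < 1 -> is_derive x 1 cdf_mu (density x).
Proof.
move=> x01; have /andP[s0 s1] := sqrt_itv x01; case/andP: (x01) => x0 x1.
have pi0 := pi_gt0 R.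
have ds := is_derive1_sqrt x0.
have c1 : is_derive x (1 : R) (cst (1 : R)) (0 : R) := is_derive_cst _ _ _.
have p1 : 0 < 1 + Num.sqrt x by lra.
have p2 : 0 < 1 - Num.sqrt x by lra.
have d1 := is_deriveD c1 ds.
have d2 := is_deriveB c1 ds.
have l1 : is_derive ((cst 1 + Num.sqrt) x : R) 1 (@ln R) (1 + Num.sqrt x)^-1 := is_derive1_ln p1.
have l2 : is_derive ((cst 1 - Num.sqrt) x : R) 1 (@ln R) (1 - Num.sqrt x)^-1 := is_derive1_ln p2.
have d3 := is_deriveZ pi^-1 (is_deriveB (is_derive1_comp l1 d1) (is_derive1_comp l2 d2)).
have d4 := is_deriveZ (2 / pi) (is_derive1_comp (is_derive1_atan _) d3).
have -> : cdf_mu = (2 / pi) \*: (atan \o (pi^-1 \*: ((@ln R \o (cst 1 + Num.sqrt)) - (@ln R \o (cst 1 - Num.sqrt))))).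
  by apply/funext => y; rewrite /cdf_mu [X in atan X]mulrC.
apply: (is_derive_eq d4).
rewrite /density ln_ratio// sqrrN.
set s := Num.sqrt x in s0 s1 p1 p2 *; set L := ln (1 + s) - ln (1 - s).
rewrite -[X in (1 + X ^+ 2)^-1]/(pi^-1 * L) -![_ *: _]/(_ * _).
have -> : x = s ^+ 2 by rewrite sqr_sqrtr// ltW.
have Q : 0 < L ^+ 2 + pi ^+ 2 by rewrite ltr_wpDl ?sqr_ge0// exprn_gt0.
have [q0 s0' p1' p2' pi0'] : [/\ L ^+ 2 + pi ^+ 2 != 0, s != 0, 1 + s != 0, 1 - s != 0 & pi != 0 :> R].
  by split; rewrite gt_eqF.
have q0' : 1 - s ^+ 2 != 0 by rewrite (_ : 1 - s ^+ 2 = (1 - s) * (1 + s)) ?mulf_neq0//; ring.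
clearbody L; clearbody s.
have q1 : 1 + (pi^-1 * L) ^+ 2 = (L ^+ 2 + pi ^+ 2) / pi ^+ 2.
  by move: (pi : R) pi0' => c c0; field.
rewrite q1; move: (pi : R) pi0' q0 {Q q1 pi0} => c c0 q0; field.
by apply/and5P; split => //; apply/andP.
Qed.

Lemma onepm_th a : 1 + th a = expR a / ch a /\ 1 - th a = expR (- a) / ch a.
Proof.
have c0 := lt0r_neq0 (ch_gt0 a); rewrite /th; split.
  have -> : expR a = ch a + sh a by rewrite /ch /sh; field.
  by rewrite mulrDl mulfV.
have -> : expR (- a) = ch a - sh a by rewrite /ch /sh; field.
by rewrite mulrBl mulfV.
Qed.

Lemma ln_ratio_th a : ln (1 + th a) - ln (1 - th a) = 2 * a.
Proof.
have [-> ->] := onepm_th a; have c0 := ch_gt0 a.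
have e0 := expR_gt0 (- a); have e1 := expR_gt0 a.
have lnd u : 0 < u -> ln (u / ch a) = ln u - ln (ch a) by move=> u0; rewrite ln_div ?posrE.
by rewrite !lnd// !expRK; ring.
Qed.

Lemma th_ln_ratio s : -1 < s < 1 -> th ((ln (1 + s) - ln (1 - s)) / 2) = s.
Proof.
move=> /andP[s0 s1]; have p1 : 0 < 1 + s by lra. have p2 : 0 < 1 - s by lra.
set a := _ / 2; have := ln_ratio_th a; have /andP[h1 h2] := th_lt1 a.
have -> : 2 * a = ln (1 + s) - ln (1 - s) by rewrite /a; field.
rewrite -!ln_div ?posrE; [|lra..]; move/ln_inj; rewrite !posrE.
have q1 : 0 < 1 + th a by lra. have q2 : 0 < 1 - th a by lra.
move=> /(_ (divr_gt0 q1 q2) (divr_gt0 p1 p2)) E.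
have : (1 + th a) * (1 - s) = (1 + s) * (1 - th a).
  apply: (mulIf (invr_neq0 (lt0r_neq0 q2))); rewrite mulrAC E.
  by rewrite mulfK ?gt_eqF// divfK ?gt_eqF.
lra.
Qed.

Lemma quantile_arg_itv v : 0 < v < 1 -> - (pi / 2) < pi / 2 * v < pi / 2.
Proof. by have := pi_gt0 R => pi0 /andP[v0 v1]; apply/andP; split; nra. Qed.

Lemma sqrt_quantile v : 0 < v < 1 -> Num.sqrt (quantile v) = th (pi / 2 * tan (pi / 2 * v)).
Proof.
by move=> v01; have /andP[h _] := th_quantile_arg v01; rewrite sqrtr_sqr ger0_norm// ltW.
Qed.

Lemma quantile_itv v : 0 < v < 1 -> 0 < quantile v < 1.
Proof.
move=> v01; have /andP[h0 h1] := th_quantile_arg v01.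
by rewrite /quantile exprn_gt0//= expr_lt1// ltW.
Qed.

Lemma quantileK v : 0 < v < 1 -> cdf_mu (quantile v) = v.
Proof.
move=> v01; have pi0 := pi_gt0 R.
rewrite /cdf_mu sqrt_quantile// ln_ratio_th.
have pi0' := lt0r_neq0 pi0.
have -> : 2 * (pi / 2 * tan (pi / 2 * v)) / pi = tan (pi / 2 * v).
  by move: (tan _) => t; move: (pi : R) pi0' => c c0; field.
rewrite tanK ?in_itv /= ?quantile_arg_itv//.
by move: (pi : R) pi0' => c c0; field.
Qed.

Lemma cdf_mu_itv x : 0 < x < 1 -> 0 < cdf_mu x < 1.
Proof.
move=> x01; have /andP[s0 s1] := sqrt_itv x01; have pi0 := pi_gt0 R.
have l0 : 0 < (ln (1 + Num.sqrt x) - ln (1 - Num.sqrt x)) / pi.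
  by rewrite divr_gt0// subr_gt0 ltr_ln ?posrE; lra.
have a0 := lt_atan l0; rewrite atan0 in a0; have a1 := atan_ltpi2 ((ln (1 + Num.sqrt x) - ln (1 - Num.sqrt x)) / pi).
rewrite /cdf_mu mulr_gt0 ?divr_gt0//=.
by rewrite mulrAC ltr_pdivrMr// mul1r; lra.
Qed.

Lemma cdf_muK x : 0 < x < 1 -> quantile (cdf_mu x) = x.
Proof.
move=> x01; have /andP[s0 s1] := sqrt_itv x01; have pi0 := pi_gt0 R.
rewrite /quantile /cdf_mu.
have -> : pi / 2 * (2 / pi * atan ((ln (1 + Num.sqrt x) - ln (1 - Num.sqrt x)) / pi)) =
  atan ((ln (1 + Num.sqrt x) - ln (1 - Num.sqrt x)) / pi).
  by move: (atan _) => t; have := lt0r_neq0 pi0; move: (pi : R) => c c0; field.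
rewrite atanK.
have -> : pi / 2 * ((ln (1 + Num.sqrt x) - ln (1 - Num.sqrt x)) / pi) =
  (ln (1 + Num.sqrt x) - ln (1 - Num.sqrt x)) / 2.
  by move: (_ - ln _) => t; have := lt0r_neq0 pi0; move: (pi : R) => c c0; field.
rewrite th_ln_ratio; last by apply/andP; split; lra.
by rewrite sqr_sqrtr// ltW//; case/andP: x01.
Qed.

Lemma th_lt a b : a < b -> th a < th b.
Proof.
move=> ab; have := onepm_th a; have := onepm_th b.
have /andP[a1 a2] := th_lt1 a; have /andP[b1 b2] := th_lt1 b.
move=> _ _; have la := ln_ratio_th a; have lb := ln_ratio_th b.
rewrite ltNge; apply/negP => ba.
have h1 : ln (1 + th b) <= ln (1 + th a) by rewrite ler_ln ?posrE; lra.
have h2 : ln (1 - th a) <= ln (1 - th b) by rewrite ler_ln ?posrE; lra.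
lra.
Qed.

Lemma quantile_lt v w : 0 < v -> v < w -> w < 1 -> quantile v < quantile w.
Proof.
move=> v0 vw w1; have pi0 := pi_gt0 R.
have v01 : 0 < v < 1 by rewrite v0 (lt_trans vw).
have w01 : 0 < w < 1 by rewrite w1 (lt_trans v0).
have /andP[h0 _] := th_quantile_arg v01.
rewrite /quantile ltr_pXn2r ?nnegrE ?ltW//; last first.
  by have /andP[h _] := th_quantile_arg w01.
apply: th_lt; rewrite ltr_pM2l ?divr_gt0// ltr_tan ?in_itv /= ?quantile_arg_itv//.
by rewrite ltr_pM2l ?divr_gt0.
Qed.

Lemma continuous_quantile v : -1 < v < 1 -> {for v, continuous (@quantile R)}.
Proof.
move=> /andP[v0 v1]; have pi0 := pi_gt0 R.
have ca : pi / 2 * y @[y --> v] --> pi / 2 * v.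
  by apply: cvgM; [exact: cvg_cst|exact: cvg_id].
have ct : tan (pi / 2 * y) @[y --> v] --> tan (pi / 2 * v).
  apply: (cvg_comp (fun y => pi / 2 * y) (@tan R)) ca _; apply: continuous_tan.
  by rewrite gt_eqF// cos_gt0_pihalf//; apply/andP; split; nra.
have cat : pi / 2 * tan (pi / 2 * y) @[y --> v] --> pi / 2 * tan (pi / 2 * v).
  by apply: cvgM => //; exact: cvg_cst.
have cth a : th b @[b --> a] --> th a.
  have cp : expR b @[b --> a] --> expR a by exact: continuous_expR.
  have cm : expR (- b) @[b --> a] --> expR (- a).
    apply: (cvg_comp (fun b => - b) (@expR R)); last exact: continuous_expR.
    by apply: cvgN; exact: cvg_id.
  apply: cvgM.
    by apply: cvgM; [apply: cvgB|exact: cvg_cst].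
  apply: cvgV; first by rewrite lt0r_neq0// ch_gt0.
  by apply: cvgM; [apply: cvgD|exact: cvg_cst].
have cq := cvg_comp (fun y => pi / 2 * tan (pi / 2 * y)) (@th R) cat (cth _).
exact: (cvgM cq cq).
Qed.
End LimitLaw.

(** * The limit law as a probability measure *)

Section LimitMeasure.
Variable R : realType.
Implicit Types (x y v w c d : R).
Local Notation leb := (@lebesgue_measure R).

Lemma measurable_density :
  measurable_fun (`]0%R, 1%R[%classic : set (measurableTypeR R)) (@density R).
Proof.
apply: open_continuous_measurable_fun; first exact: interval_open.
by move=> x; rewrite inE /= in_itv /= => x01; exact: continuous_density.
Qed.

Lemma rho_restrict : (@rho R) = (@density R) \_ (`]0%R, 1%R[%classic : set R).
Proof.
apply/funext => x; rewrite rhoE patchE; congr (if _ then _ else _).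
by apply/esym; rewrite mem_setE in_itv.
Qed.

Lemma measurable_rho : measurable_fun [set: measurableTypeR R] (@rho R).
Proof.
rewrite rho_restrict; apply/measurable_restrict => //.
by rewrite setTI; exact: measurable_density.
Qed.

Definition mu_law (A : set (measurableTypeR R)) : \bar R :=
  (\int[leb]_(x in A) (rho x)%:E)%E.

Let mu_law0 : mu_law set0 = 0%E. Proof. by rewrite /mu_law integral_set0. Qed.

Let mu_law_ge0 A : (0 <= mu_law A)%E.
Proof. by apply: integral_ge0 => x _; rewrite lee_fin rho_ge0. Qed.

Let mu_law_sigma_additive : semi_sigma_additive mu_law.
Proof.
move=> /= F mF tF mUF; rewrite /mu_law; apply: cvg_toP.
  apply: ereal_nondecreasing_is_cvgn => m n mn.
  apply: lee_sum_nneg_natr => // k _ _.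
  by apply: integral_ge0 => /= x Fkx; rewrite lee_fin rho_ge0.
rewrite ge0_integral_bigcup//=.
- by apply: measurable_funTS; apply: measurableT_comp => //; exact: measurable_rho.
- by move=> x _; rewrite lee_fin rho_ge0.
Qed.

HB.instance Definition _ := isMeasure.Build _ _ _ mu_law
  mu_law0 mu_law_ge0 mu_law_sigma_additive.

Lemma mu_law_itv c d : 0 < c -> c < d -> d < 1 ->
  mu_law `]c, d] = (cdf_mu d - cdf_mu c)%:E.
Proof.
move=> c0 cd d1; rewrite /mu_law.
have in01 x : c <= x <= d -> 0 < x < 1.
  by move=> /andP[cx xd]; rewrite (lt_le_trans c0 cx) (le_lt_trans xd d1).
rewrite integral_itv_obnd_cbnd; last first.
  by apply/measurable_EFinP; apply: measurable_funTS; exact: measurable_rho.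
transitivity (\int[leb]_(x in `[c, d]) (density x)%:E)%E.
  apply: eq_integral => x; rewrite inE /= in_itv /= => /in01 x01.
  by rewrite rhoE x01.
have cF x : c <= x <= d -> {for x, continuous (@cdf_mu R)}.
  move=> /in01 x01; have := is_derive_cdf x01 => -[dF _].
  by apply: differentiable_continuous; exact/derivable1_diffP.
rewrite (continuous_FTC2 cd (F := @cdf_mu R)) ?EFinB//.
- apply: continuous_in_subspaceT => x; rewrite inE /= in_itv /= => /in01.
  exact: continuous_density.
- split.
  + move=> x; rewrite in_itv /= => /andP[cx xd].
    by have [] := is_derive_cdf (in01 x _); rewrite ?ltW.
  + by apply: cvg_at_right_filter; apply: cF; rewrite lexx ltW.
  + by apply: cvg_at_left_filter; apply: cF; rewrite lexx ltW.
- move=> x; rewrite in_itv /= => /andP[cx xd].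
  have x01 : 0 < x < 1 by apply: in01; rewrite !ltW.
  by rewrite derive1E; have [_] := is_derive_cdf x01.
Qed.

Lemma mu_law_quantile v w : 0 < v -> v < w -> w < 1 ->
  mu_law `]quantile v, quantile w] = (w - v)%:E.
Proof.
move=> v0 vw w1.
have v01 : 0 < v < 1 by rewrite v0 (lt_trans vw).
have w01 : 0 < w < 1 by rewrite w1 (lt_trans v0).
rewrite mu_law_itv ?quantileK// ?quantile_lt//.
  by case/andP: (quantile_itv v01).
by case/andP: (quantile_itv w01).
Qed.

(** The intervals between the quantiles of e k and 1 - e k, of mass 1 - 2 e k,
    exhaust (0, 1) as e k tends to 0. *)
Lemma mu_law_setT : mu_law [set: R] = 1%E.
Proof.
have -> : mu_law [set: R] = mu_law `]0%R, 1%R[.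
  rewrite /mu_law [RHS]integral_mkcond; apply: eq_integral => x _.
  by rewrite patchE rho_restrict patchE; case: ifP.
have [e [e_itv e_decr e_cvg]] : exists e : nat -> R, [/\ forall k, 0 < e k < 2^-1,
    (forall k l, (k < l)%N -> e l < e k) & e k @[k --> \oo] --> (0 : R)].
  exists (fun k => k.+3%:R^-1); split.
  - by move=> k; rewrite invr_gt0 ltr0n /= ltf_pV2 ?posrE ?ltr0n// ltr_nat.
  - by move=> k l kl; rewrite ltf_pV2 ?posrE ?ltr0n// ltr_nat.
  - have := @cvg_harmonic R; rewrite -(@cvg_shiftS R^o (@harmonic R)).
    by rewrite -(@cvg_shiftS R^o (fun n => harmonic n.+1)).
pose F k : set (measurableTypeR R) := `]quantile (e k), quantile (1 - e k)]%classic.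
have muF k : mu_law (F k) = (1 - 2 * e k)%:E.
  have /andP[h0 h1] := e_itv k.
  by rewrite mu_law_quantile; [congr (_%:E); ring|lra|lra|lra].
have UF : \bigcup_k F k = `]0%R, 1%R[%classic.
  apply/seteqP; split => x /=.
    move=> [k _]; rewrite /F /= in_itv /= => /andP[qx xq]; have /andP[h0 h1] := e_itv k.
    have a01 : 0 < e k < 1 by apply/andP; split; lra.
    have b01 : 0 < 1 - e k < 1 by apply/andP; split; lra.
    rewrite in_itv /= (lt_trans _ qx)/=; last by case/andP: (quantile_itv a01).
    by rewrite (le_lt_trans xq)//; case/andP: (quantile_itv b01).
  rewrite in_itv /= => x01; have /andP[v0 v1] := cdf_mu_itv x01.
  rewrite -(cdf_muK x01); move: (cdf_mu x) v0 v1 => v v0 v1.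
  have m0 : 0 < Num.min v (1 - v) by rewrite lt_min v0 subr_gt0.
  have [N _ /(_ N (leqnn N))] := cvgr_lt _ e_cvg _ m0.
  rewrite /= lt_min => /andP[kv vk]; exists N => //.
  have /andP[h0 h1] := e_itv N; rewrite /F /= in_itv /=.
  rewrite quantile_lt//=; have [->|vne] := eqVneq v (1 - e N); first by rewrite lexx.
  by apply/ltW/quantile_lt; lra.
have ndF : nondecreasing_seq F.
  move=> k l; rewrite leq_eqVlt => /orP[/eqP->//|kl].
  apply/subsetPset => x; rewrite /F /= !in_itv /= => /andP[qx xq].
  have /andP[h0 h1] := e_itv k; have /andP[h2 h3] := e_itv l; have lt := e_decr _ _ kl.
  apply/andP; split; first by apply: lt_trans qx; apply: quantile_lt; lra.
  by apply: le_trans xq _; apply/ltW/quantile_lt; lra.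
have H1 : mu_law (F k) @[k --> \oo] --> mu_law `]0%R, 1%R[.
  rewrite -UF; apply: nondecreasing_cvg_mu => //.
  - by move=> k; exact: measurable_itv.
  - by rewrite UF; exact: measurable_itv.
have H2 : mu_law (F k) @[k --> \oo] --> 1%E.
  under eq_fun do rewrite muF.
  apply: cvg_EFin; first exact: nearW.
  rewrite /= -[X in _ --> X]subr0 -[X in _ --> _ - X](mulr0 (2 : R)).
  apply: cvgB; first exact: cvg_cst.
  by apply: cvgM; [exact: cvg_cst|exact: e_cvg].
exact: (cvg_unique _ H1 H2).
Qed.

HB.instance Definition _ := @Measure_isProbability.Build _ _ R mu_law mu_law_setT.

Lemma mu_law_dominated : mu_law `<< leb.
Proof.
apply/null_content_dominatesP => A mA A0; rewrite /mu_law null_set_integral//.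
by apply/measurable_EFinP; apply: measurable_funTS; exact: measurable_rho.
Qed.

End LimitMeasure.

(** * Locating the zeros *)

Section ZeroLocation.
Variable R : realType.
Implicit Types (x y z v w e B : R) (f g : R -> R).

Lemma heine_cantor (g : R -> R) (a b e : R) : 0 < e ->
  (forall x, a <= x <= b -> {for x, continuous g}) ->
  exists2 del : R, 0 < del & forall x y, a <= x <= b -> `|y - x| < del -> `|g y - g x| < e.
Proof.
move=> e0 cg.
have K : near_covering `[a, b]%classic by apply/compact_near_coveringP/segment_compact.
have := K _ (0^'+) (fun del x => forall y, `|y - x| < del -> `|g y - g x| < e) _.
have [|H] := pselect (forall x, `[a, b]%classic x -> \forall x' \near x & i \near 0^'+,
   forall y, `|y - x'| < i -> `|g y - g x'| < e); last first.
  exfalso; apply: H => x; rewrite /= in_itv /= => /cg cgx.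
  have e20 : 0 < e / 2 by rewrite divr_gt0.
  have /cvgrPdist_lt/(_ _ e20) [d /= d0 Hd] := cgx.
  have d20 : 0 < d / 2 by rewrite divr_gt0.
  have Hd' y : `|y - x| < d -> `|g x - g y| < e / 2 by move=> yx; apply: Hd; rewrite /ball_ /= distrC.
  near=> x' i => y yx'.
  have xx' : `|x - x'| < d / 2 by near: x'; exact: nbhsx_ballx.
  have id2 : i < d / 2 by near: i; exact: nbhs_right_lt.
  have xd : `|x' - x| < d by rewrite distrC (lt_trans xx')// ltr_pdivrMr// ltr_pMr// ltr1n.
  have yd : `|y - x| < d.
    have -> : y - x = (y - x') + (x' - x) by ring.
    apply: le_lt_trans (ler_normD _ _) _; rewrite [d]splitr.
    by apply: ltrD; [exact: lt_trans id2|rewrite distrC].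
  have -> : g y - g x' = (g x - g x') - (g x - g y) by ring.
  apply: le_lt_trans (ler_normB _ _) _; rewrite [e]splitr.
  by apply: ltrD; exact: Hd'.
move=> H /(_ _ H) N.
have [d /= d0 Hd] := N.
exists (d / 2); first by rewrite divr_gt0.
move=> x y xab; apply: Hd; rewrite /= ?in_itv//= /ball_ /= ?sub0r ?normrN.
  by rewrite ger0_norm ?divr_ge0 ?ltW// ltr_pdivrMr// ltr_pMr// ltr1n.
by rewrite divr_gt0.
Unshelve. all: by end_near. Qed.

(** The integral against a sum of Dirac masses is computed for the positive and
    the negative part of f separately. *)
Lemma integral_empirical (p : {poly R}) f : measurable_fun [set: measurableTypeR R] f ->
  (\int[empirical_zero_measure p]_x (f x)%:E)%E =
  ((size p).-1%:R^-1 * \sum_(x <- rootsR p) f x)%:E.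
Proof.
move=> mf; set s := rootsR p; set c := (size p).-1%:R^-1.
have ge0 (g : R -> \bar R) : measurable_fun [set: measurableTypeR R] g ->
    (forall x, (0 <= g x)%E) ->
    (\int[empirical_zero_measure p]_x g x = c%:E * \sum_(k < size s) g s`_k)%E.
  move=> mg g0; rewrite ge0_integral_mscale//; congr (_ * _)%E.
  rewrite ge0_integral_measure_sum//; apply: eq_bigr => k _.
  by rewrite integral_dirac// diracT mul1e.
have mE : measurable_fun [set: measurableTypeR R] (EFin \o f) by exact/measurable_EFinP.
rewrite integralE ge0 //; last exact/measurable_funepos.
rewrite ge0 //; last exact/measurable_funeneg.
have pE k : ((fun x => (f x)%:E)^\+ s`_k = (Num.max (f s`_k) 0)%:E)%E.
  by rewrite funeposE EFin_max.
have nE k : ((fun x => (f x)%:E)^\- s`_k = (Num.max (- f s`_k) 0)%:E)%E.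
  by rewrite funenegE -EFinN EFin_max.
under eq_bigr do rewrite pE.
under [X in (_ - _ * X)%E]eq_bigr do rewrite nE.
rewrite !sumEFin -!EFinM -EFinB -mulrBr -sumrB; congr (_ * _)%:E.
rewrite (big_nth 0) big_mkord; apply: eq_bigr => k _.
rewrite /Num.max; case: ltP => h1; case: ltP => h2; lra.
Qed.

(** Each real root outside zs contributes at most B to the difference. *)
Lemma sum_rootsR_sub (p : {poly R}) (zs : seq R) f B : p != 0 ->
  uniq zs -> all (root p) zs -> (forall x, `|f x| <= B) ->
  (size zs <= size (rootsR p))%N /\
  `|\sum_(x <- rootsR p) f x - \sum_(x <- zs) f x| <= B * (size (rootsR p) - size zs)%:R.
Proof.
move=> p0 uz rz fB; set s := rootsR p.
have zsub : {subset zs <= s}.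
  move=> x /(allP rz) rx; have := roots_on_rootsR p0 => /(_ x).
  by rewrite rx in_itv /= => <-.
have us : uniq s by exact: uniq_roots.
have ps : perm_eq s (zs ++ [seq x <- s | x \notin zs]).
  apply: uniq_perm => //.
    rewrite cat_uniq uz filter_uniq// andbT /=; apply/hasPn => x.
    by rewrite mem_filter => /andP[].
  move=> x; rewrite mem_cat mem_filter; have [/zsub ->//|] := boolP (x \in zs).
  by rewrite andTb.
have sz := perm_size ps; rewrite size_cat in sz.
split; first by rewrite sz leq_addr.
rewrite (perm_big _ ps) big_cat /= addrAC subrr add0r sz addKn.
apply: le_trans (ler_norm_sum _ _ _) _.
apply: le_trans (ler_sum _ (fun x _ => fB x)) _.
by rewrite big_const_seq count_predT iter_addr_0 mulr_natr.
Qed.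

(** Intermediate value theorem in each cell. *)
Lemma exists_zeros (p : {poly R}) (M J : nat) (s : R) :
  (forall i, (i <= J)%N -> 0 < s * (-1) ^+ i * p.[quantile (node R M i)]) ->
  (forall i j, (i < j <= J)%N -> quantile (node R M i) < quantile (node R M j) :> R) ->
  exists z : nat -> R, forall i, (i < J)%N ->
    root p (z i) /\ quantile (node R M i) < z i < quantile (node R M i.+1).
Proof.
move=> sgn mono.
have H i : (i < J)%N -> exists z, root p z /\ quantile (node R M i) < z < quantile (node R M i.+1).
  move=> iJ; have h0 := sgn i (ltnW iJ); have h1 := sgn i.+1 iJ.
  have lt : quantile (node R M i) < quantile (node R M i.+1) :> R by apply: mono; rewrite ltnSn.
  have neg : p.[quantile (node R M i)] * p.[quantile (node R M i.+1)] < 0.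
    have := mulr_gt0 h0 h1; rewrite exprS.
    have := sqrr_sign R i; have := sqr_ge0 s.
    move: ((-1) ^+ i) (p.[quantile (node R M i)]) (p.[quantile (node R M i.+1)]) => t a b s2 t2.
    have -> : s * t * a * (s * (-1 * t) * b) = - (s ^+ 2 * t ^+ 2 * (a * b)) by ring.
    rewrite t2 mulr1 oppr_gt0; nra.
  have [z zI rz] := poly_ivtoo (ltW lt) neg.
  by exists z; split => //; rewrite in_itv in zI.
exists (fun i => match pselect (i < J)%N with left h => projT1 (cid (H i h)) | _ => 0 end).
move=> i iJ; case: pselect => // h; exact: (projT2 (cid (H i h))).
Qed.

End ZeroLocation.

(** * Riemann sums for the limit law *)

Section CellEstimate.
Variable R : realType.
Variable P : probability (measurableTypeR R) R.
Variables (f : R -> R) (B : R).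
Hypothesis mf : measurable_fun [set: measurableTypeR R] f.
Hypothesis fB : forall x, `|f x| <= B.
Implicit Types (A C : set (measurableTypeR R)) (c e : R).

Lemma bounded_integrable A (g : R -> R) (b : R) : measurable A ->
  measurable_fun [set: measurableTypeR R] g -> (forall x, `|g x| <= b) ->
  P.-integrable A (EFin \o g).
Proof.
move=> mA mg gb; apply: measurable_bounded_integrable => //.
- by rewrite (le_lt_trans (probability_le1 P mA))// ltry.
- exact: measurable_funTS.
- exists b; split; first exact: num_real.
  by move=> x bx y _; apply: le_trans (gb y) (ltW bx).
Qed.

Lemma cell_estimate A c e : measurable A ->
  (forall x, A x -> `|f x - c| <= e) ->
  `|\int[P]_(x in A) f x - c * fine (P A)| <= e * fine (P A).
Proof.
move=> mA fc.
have ic (b : R) : P.-integrable A (EFin \o cst b).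
  by apply: (@bounded_integrable _ (cst b) `|b|).
have iff := bounded_integrable mA mf fB.
rewrite -!Rintegral_cst// -RintegralB//.
have ifc : P.-integrable A (EFin \o (fun x => f x - c)).
  apply: (@bounded_integrable _ _ (B + `|c|)) => //.
    by apply: measurable_funB.
  by move=> x; apply: le_trans (ler_normB _ _) _; rewrite lerD2r.
apply: le_trans (le_normr_Rintegral mA ifc) _.
apply: le_Rintegral => //; first last.
- exact: ic.
- apply: (@bounded_integrable _ _ (B + `|c|)) => //.
    by apply: measurableT_comp => //; apply: measurable_funB.
  by move=> x; rewrite normr_id; apply: le_trans (ler_normB _ _) _; rewrite lerD2r.
- exact: ic.
Qed.

Lemma complement_estimate C : measurable C ->
  `|\int[P]_x f x - \int[P]_(x in C) f x| <= B * (1 - fine (P C)).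
Proof.
move=> mC; have mC' := measurableC mC.
have -> : \int[P]_x f x = \int[P]_(x in C) f x + \int[P]_(x in ~` C) f x.
  rewrite -Rintegral_setU//; first by rewrite setUv.
    by rewrite setUv; exact: bounded_integrable.
  by rewrite disj_set2E setICr.
have := @cell_estimate (~` C) 0 B mC'.
rewrite mul0r subr0 addrAC subrr add0r => H.
have -> : 1 - fine (P C) = fine (P (~` C)).
  by rewrite probability_setC// fineB ?fin_num_measure.
by apply: H => x _; rewrite subr0.
Qed.

End CellEstimate.

Section RiemannSum.
Variable R : realType.
Local Notation mu := (@mu_law R).
Variables (f : R -> R) (B : R).
Hypothesis mf : measurable_fun [set: measurableTypeR R] f.
Hypothesis fB : forall x, `|f x| <= B.

(** The cell between the quantiles of v i and v (i + 1) has mass v (i + 1) - v i. *)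
Lemma mu_law_riemann_sum (v z : nat -> R) (e : R) J :
  (forall i, (i <= J)%N -> 0 < v i < 1) -> (forall i, (i < J)%N -> v i < v i.+1) ->
  (forall i x, (i < J)%N -> quantile (v i) < x <= quantile (v i.+1) -> `|f x - f (z i)| <= e) ->
  `|\int[mu]_(x in `]quantile (v 0%N), quantile (v J)]) f x -
    \sum_(i < J) f (z i) * (v i.+1 - v i)| <= e * (v J - v 0%N).
Proof.
elim: J => [|J IH] v01 vS fz.
  by rewrite set_itvoc0 Rintegral_set0 big_ord0 !subrr mulr0 normr0.
have {}IH := IH (fun i h => v01 i (leqW h)) (fun i h => vS i (ltnW h)) (fun i x h => fz i x (ltnW h)).
have v0J : v 0%N <= v J.
  have : forall j, (j <= J)%N -> v 0%N <= v j.
    elim=> [//|j IHj] jJ; apply: le_trans (IHj (ltnW jJ)) _.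
    by apply/ltW/vS; rewrite ltnS ltnW.
  exact.
have /andP[v00 v0l] := v01 0%N isT; have /andP[vJ0 vJ1] := v01 J (leqnSn J).
have /andP[vS0 vS1] := v01 J.+1 (leqnn _); have vJS := vS J (ltnSn J).
have q0J : quantile (v 0%N) <= quantile (v J).
  by move: v0J; rewrite le_eqVlt => /predU1P[->//|lt]; apply/ltW/quantile_lt.
have qJS : quantile (v J) <= quantile (v J.+1) by apply/ltW/quantile_lt.
have -> : `]quantile (v 0%N), quantile (v J.+1)]%classic =
   (`]quantile (v 0%N), quantile (v J)]%classic `|` `]quantile (v J), quantile (v J.+1)]%classic
   : set (measurableTypeR R)).
  by apply: itv_bndbnd_setU; rewrite bnd_simp.
rewrite Rintegral_setU//; last 2 first.
- by apply: (@bounded_integrable R mu _ f B) => //; apply: measurableU; exact: measurable_itv.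
- rewrite disj_set2E; apply/eqP/seteqP; split => // x /= []; rewrite !in_itv /= => /andP[_ h1] /andP[h2 _].
  by have := lt_le_trans h2 h1; rewrite ltxx.
rewrite big_ord_recr /=.
set C := `]quantile (v J), quantile (v J.+1)]%classic.
have mC : measurable (C : set (measurableTypeR R)) by exact: measurable_itv.
have muC : mu C = (v J.+1 - v J)%:E by rewrite mu_law_quantile.
have H : `|\int[mu]_(x in C) f x - f (z J) * (v J.+1 - v J)| <= e * (v J.+1 - v J).
  have -> : v J.+1 - v J = fine (mu C) by rewrite muC.
  apply: (@cell_estimate R mu f B) => // x; rewrite /C /= in_itv /=.
  exact: fz (ltnSn J).
have -> : e * (v J.+1 - v 0%N) = e * (v J - v 0%N) + e * (v J.+1 - v J) by ring.
rewrite opprD addrACA; apply: le_trans (ler_normD _ _) _.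
exact: lerD.
Qed.

End RiemannSum.

(** * Weak convergence of the zero measures *)

Section WeakConvergence.
Variable R : realType.
Local Notation mu := (@mu_law R).

Lemma bounded_fun_norm (f : R -> R) : bounded_fun f -> exists2 B : R, 0 < B & forall x, `|f x| <= B.
Proof.
move=> [M0 [_ M0P]]; exists (`|M0| + 1) => [|x]; first by rewrite ltr_wpDl.
by apply: M0P => //; rewrite (le_lt_trans (ler_norm M0))// ltrDl.
Qed.

(** Contrapositive of the monotonicity of [quantile]. *)
Lemma quantile_between (v w x : R) : 0 < v -> v < w -> w < 1 ->
  quantile v < x <= quantile w -> 0 < x < 1 /\ v < cdf_mu x <= w.
Proof.
move=> v0 vw w1 /andP[vx xw].
have v01 : 0 < v < 1 by rewrite v0 (lt_trans vw).
have w01 : 0 < w < 1 by rewrite w1 (lt_trans v0).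
have /andP[qv0 _] := quantile_itv v01; have /andP[_ qw1] := quantile_itv w01.
have x01 : 0 < x < 1 by rewrite (lt_trans qv0)//= (le_lt_trans xw).
have /andP[c0 c1] := cdf_mu_itv x01.
split => //; apply/andP; split.
  rewrite ltNge; apply/negP; rewrite le_eqVlt => /predU1P[E|lt].
    by move: vx; rewrite -E cdf_muK// ltxx.
  by have := quantile_lt c0 lt (lt_trans vw w1); rewrite cdf_muK// => /(lt_trans vx); rewrite ltxx.
rewrite leNgt; apply/negP => lt.
by have := quantile_lt (lt_trans v0 vw) lt c1; rewrite cdf_muK// => /(le_lt_trans xw); rewrite ltxx.
Qed.


(** In the application a is the weight of one zero and b the mass of one cell,
    r counts the real zeros and J the cells, S and Sz are the sums of the test
    function over all real zeros and over one zero per cell, I and Ic are its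
    integrals over the line and over the union of the cells. *)
Lemma error_chain (a b r J B e S Sz I Ic : R) : 0 <= B -> 0 <= e -> 0 <= b -> b <= a ->
  0 <= J -> a * r <= 1 -> b * J <= 1 ->
  `|S - Sz| <= B * (r - J) -> `|Sz| <= B * J -> `|Ic - b * Sz| <= e * (b * J) ->
  `|I - Ic| <= B * (1 - b * J) ->
  `|a * S - I| <= 2 * B * (1 - b * J) + e.
Proof.
move=> B0 e0 b0 ba J0 ar bJ hS hz hc hI.
have a0 : 0 <= a by exact: le_trans ba.
have -> : a * S - I = a * (S - Sz) + (a - b) * Sz - (Ic - b * Sz) - (I - Ic) by ring.
have h1 : `|a * (S - Sz)| <= B * (a * r - a * J).
  by rewrite normrM (ger0_norm a0); apply: le_trans (ler_wpM2l a0 hS) _; rewrite mulrCA mulrBr.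
have h2 : `|(a - b) * Sz| <= B * (a * J - b * J).
  have ab0 : 0 <= a - b by rewrite subr_ge0.
  by rewrite normrM (ger0_norm ab0); apply: le_trans (ler_wpM2l ab0 hz) _; rewrite mulrCA mulrBl.
have h3 : `|a * (S - Sz) + (a - b) * Sz - (Ic - b * Sz) - (I - Ic)| <=
    B * (a * r - a * J) + B * (a * J - b * J) + e * (b * J) + B * (1 - b * J).
  apply: le_trans (ler_normB _ _) _; apply: lerD => //.
  apply: le_trans (ler_normB _ _) _; apply: lerD => //.
  by apply: le_trans (ler_normD _ _) _; apply: lerD.
apply: le_trans h3 _.
have : B * (a * r) <= B * 1 by apply: ler_wpM2l.
have : e * (b * J) <= e * 1 by apply: ler_wpM2l.
move: (a * r) (a * J) (b * J) => u v w; lra.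
Qed.

Lemma nodeS M i : node R M i.+1 - node R M i = 2 / M%:R.
Proof.
rewrite /node -mulrBl; congr (_ / _).
by rewrite mulnS -addnA natrD addrK.
Qed.

Lemma node_sub0 M J : node R M J - node R M 0 = 2 / M%:R * J%:R.
Proof.
by rewrite /node -mulrBl muln0 add0n natrD addrK natrM mulrAC.
Qed.

Lemma node_lt M i j : (0 < M)%N -> (i < j)%N -> node R M i < node R M j.
Proof. by move=> M0 ij; rewrite ltr_pM2r ?invr_gt0 ?ltr0n// ltr_nat; lia. Qed.

(** Each cell has mass 2 / M and contains a zero, whose weight is at least
    2 / M. All the mass which this does not match up, on either side, is at most
    1 - 2 J / M. *)
Lemma quadrature_error (p : {poly R}) (n M J : nat) (s B e : R) (f : R -> R) :
  (size p <= n)%N -> (0 < J < n)%N -> (2 * n <= M)%N ->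
  (forall i, (i <= J)%N -> 0 < s * (-1) ^+ i * p.[quantile (node R M i)]) ->
  measurable_fun [set: measurableTypeR R] f -> (forall x, `|f x| <= B) ->
  (forall i x y, (i < J)%N -> quantile (node R M i) < x <= quantile (node R M i.+1) ->
     quantile (node R M i) < y <= quantile (node R M i.+1) -> `|f x - f y| <= e) ->
  `|(size p).-1%:R^-1 * \sum_(x <- rootsR p) f x - \int[mu]_x f x| <=
    2 * B * (1 - 2 / M%:R * J%:R) + e.
Proof.
move=> szp /andP[J0 Jn] nM sgn mf fB osc.
have M0 : (0 < M)%N by lia.
have n01 i : (i <= J)%N -> 0 < node R M i < 1 by move=> iJ; apply: (@node_lt1 R n); lia.
have qlt i j : (i < j <= J)%N -> quantile (node R M i) < quantile (node R M j) :> R.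
  move=> /andP[ij jJ]; have /andP[_ j1] := n01 j jJ.
  have /andP[i0 _] := n01 i (ltnW (leq_trans ij jJ)).
  by apply: quantile_lt => //; exact: node_lt.
have [z zP] := exists_zeros sgn qlt.
have zlt i j : (i < j)%N -> (j < J)%N -> z i < z j.
  move=> ij jJ; have [_ /andP[_ h1]] := zP i (ltn_trans ij jJ).
  have [_ /andP[h2 _]] := zP j jJ; apply: (lt_trans h1); apply: le_lt_trans h2.
  by move: ij; rewrite leq_eqVlt => /predU1P[->//|ij]; apply/ltW/qlt; rewrite ij ltnW.
pose zs := [seq z i | i <- iota 0 J].
have uz : uniq zs.
  rewrite map_inj_in_uniq ?iota_uniq// => i j; rewrite !mem_iota !add0n /= => iJ jJ zE.
  by case: (ltngtP i j) => // h; [have := zlt _ _ h jJ|have := zlt _ _ h iJ]; rewrite zE ltxx.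
have rz : all (root p) zs.
  by rewrite all_map; apply/allP => i; rewrite mem_iota add0n /= => iJ; have [] := zP i iJ.
have p0 : p != 0.
  by apply: contraTneq (sgn 0%N isT) => ->; rewrite horner0 mulr0 ltxx.
have [szr hS] := sum_rootsR_sub p0 uz rz fB.
have szz : size zs = J by rewrite size_map size_iota.
rewrite szz in szr hS.
have rd : (size (rootsR p) <= (size p).-1)%N.
  rewrite -ltnS prednK ?size_poly_gt0//; apply: max_poly_roots => //.
    apply/allP => x xr; have := roots_on_rootsR p0 x.
    by rewrite xr in_itv.
  exact: uniq_roots.
have B0 : 0 <= B by exact: le_trans (normr_ge0 _) (fB 0).
have e0 : 0 <= e.
  have h : quantile (node R M 0) < quantile (node R M 1) <= quantile (node R M 1).
    by rewrite lexx andbT qlt.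
  by have := osc 0%N _ _ J0 h h; exact: le_trans.
have d0 : (0 < (size p).-1)%N by lia.
have SzE : \sum_(x <- zs) f x = \sum_(i < J) f (z i).
  by rewrite big_map -{1}(subn0 J) big_mkord.
rewrite natrB// in hS.
have vS i : (i < J)%N -> node R M i < node R M i.+1 by move=> _; exact: node_lt.
have fz i x : (i < J)%N -> quantile (node R M i) < x <= quantile (node R M i.+1) -> `|f x - f (z i)| <= e.
  move=> iJ xi; apply: (osc i) => //.
  by have [_ /andP[h1 h2]] := zP i iJ; rewrite h1 ltW.
have hc := mu_law_riemann_sum mf fB n01 vS fz.
rewrite node_sub0 in hc.
set C := `]quantile (node R M 0), quantile (node R M J)]%classic in hc.
have mC : measurable (C : set (measurableTypeR R)) by exact: measurable_itv.
have hI := @complement_estimate R mu f B mf fB C mC.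
have muC : fine (mu C) = 2 / M%:R * J%:R.
  have /andP[a0 _] := n01 0%N isT; have /andP[_ a1] := n01 J (leqnn _).
  by rewrite mu_law_quantile ?node_lt// node_sub0.
have {}hI : `|\int[mu]_x f x - \int[mu]_(x in C) f x| <= B * (1 - 2 / M%:R * J%:R).
  by rewrite -muC.
apply: (@error_chain _ (2 / M%:R) (size (rootsR p))%:R J%:R B e _ (\sum_(x <- zs) f x) _ _
   B0 e0 _ _ _ _ _ hS _ _ hI).
- by rewrite divr_ge0.
- rewrite ler_pdivrMr ?ltr0n// mulrC ler_pdivlMr ?ltr0n// -natrM ler_nat; lia.
- by [].
- by rewrite ler_pdivrMl ?ltr0n// mulr1 ler_nat.
- rewrite mulrAC ler_pdivrMr ?ltr0n// mul1r -natrM ler_nat; lia.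
- rewrite SzE; apply: le_trans (ler_norm_sum _ _ _) _.
  have -> : B * J%:R = \sum_(i < J) B by rewrite sumr_const card_ord mulr_natr.
  exact: ler_sum.
- rewrite SzE mulr_sumr.
  by under [X in _ - X]eq_bigr => i _ do rewrite -(nodeS M i) mulrC.
Qed.


(** Nodes up to eta = 1 - delta give about (1 - delta) n cells, on which
    the test function composed with [quantile] is uniformly continuous; the
    unmatched mass is then at most 2 delta. *)
Lemma weak_of_alternating (p : nat -> {poly R}) (M : nat -> nat) :
  (forall n, (size (p n) <= n)%N) -> (forall n, (2 * n <= M n <= (2 * n).+1)%N) ->
  sign_alternating p M -> weakly_converges (fun n => empirical_zero_measure (p n)) mu.
Proof.
move=> szp hM alt f cf bf.
have [B B0 fB] := bounded_fun_norm bf.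
have mf : measurable_fun [set: measurableTypeR R] f by exact: continuous_measurable_fun.
have fI : mu.-integrable [set: measurableTypeR R] (EFin \o f).
  exact: (@bounded_integrable R mu setT f B).
have -> : (\int[mu]_x (f x)%:E)%E = (\int[mu]_x f x)%:E.
  by rewrite /Rintegral fineK// integrable_fin_num.
under eq_fun do rewrite integral_empirical//.
apply: cvg_EFin; first by near=> n.
apply/cvgrPdist_lt => eps eps0 /=.
(* The total error will be at most 4 B delta + eps / 4. *)
pose delta : R := Num.min 4^-1 (eps / (24 * B)).
have d0 : 0 < delta by rewrite lt_min invr_gt0 ltr0n divr_gt0// mulr_gt0.
have d4 : delta <= 4^-1 by rewrite ge_min lexx.
have dB : delta * (24 * B) <= eps.
  by rewrite -ler_pdivlMr ?mulr_gt0// ge_min lexx orbT.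
have eta01 : 0 < 1 - delta < 1 by apply/andP; split; lra.
have e40 : 0 < eps / 4 by rewrite divr_gt0.
have [del del0 heineP] : exists2 del : R, 0 < del & forall v w, 0 <= v <= 1 - delta ->
    `|w - v| < del -> `|f (quantile w) - f (quantile v)| < eps / 4.
  apply: (@heine_cantor R (f \o @quantile R) 0 (1 - delta) _ e40) => v /andP[v0 v1].
  apply: continuous_comp; last exact: cf.
  by apply: continuous_quantile; lra.
near=> n.
have hn : 4 <= delta * (2 * n%:R).
  rewrite mulrA -ler_pdivrMl ?mulr_gt0//.
  by near: n; exact: nbhs_infty_ger.
have hdel : 2 < del * (2 * n%:R).
  rewrite mulrA -ltr_pdivrMl ?mulr_gt0//.
  by near: n; exact: nbhs_infty_gtr.
have [s sP] : exists s : R, forall i, (i < n)%N -> node R (M n) i <= 1 - delta ->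
    0 < s * (-1) ^+ i * (p n).[quantile (node R (M n) i)].
  by near: n; exact: alt.
have /andP[M1 M2] := hM n; have szn := szp n.
move: (p n) (M n) sP M1 M2 szn => q m sP M1 M2 szn.
have n0 : 0 < n%:R :> R by nra.
have m1 : 2 * n%:R <= m%:R :> R by rewrite -natrM ler_nat.
have m2 : m%:R <= 2 * n%:R + 1 :> R by rewrite -natrM natr1 ler_nat.
have m0 : 0 < m%:R :> R by lra.
have dm : 4 <= delta * m%:R by apply: le_trans hn _; rewrite ler_pM2l.
have dm4 : delta * m%:R <= 4^-1 * m%:R by rewrite ler_pM2r.
have delm : 2 < del * m%:R by apply: lt_le_trans hdel _; rewrite ler_pM2l.
(* Node J is at most 1 - delta exactly if 2 J + 1 <= 2 x; J + 1 = truncn x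
   satisfies this and leaves 2 J / M > 1 - delta - 4 / M. *)
pose x : R := (1 - delta) * m%:R / 2.
have xE : 2 * x = m%:R - delta * m%:R by rewrite /x; lra.
have x0 : 0 <= x by lra.
have /andP[t1 t2] := truncn_itv x0.
move: (Num.truncn x) t1 t2 => t t1 t2; clearbody x.
have x1 : 2 <= x by lra.
have t0 : (1 < t)%N by rewrite -(ltr_nat R); move: t2; rewrite -natr1; lra.
have [J tJ] : exists J, t = J.+1 by exists t.-1; rewrite prednK// ltnW.
rewrite {t}tJ in t1 t2 t0.
rewrite -!natr1 in t1 t2.
have Jn : (0 < J < n)%N by rewrite -ltnS t0 -(ltr_nat R); lra.
have Jeta i : (i <= J)%N -> node R m i <= 1 - delta.
  move=> iJ; rewrite ler_pdivrMr// natrD natrM.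
  have : i%:R <= J%:R :> R by rewrite ler_nat.
  by move=> iJ'; lra.
have beta : 1 - 2 / m%:R * J%:R <= 2 * delta.
  have : 1 - 2 * delta <= 2 * J%:R / m%:R.
    by rewrite ler_pdivlMr//; lra.
  by rewrite mulrAC; lra.
have JN : (J < n)%N by case/andP: Jn.
have osc i x' y : (i < J)%N -> quantile (node R m i) < x' <= quantile (node R m i.+1) ->
    quantile (node R m i) < y <= quantile (node R m i.+1) -> `|f x' - f y| <= eps / 4.
  move=> iJ hx hy.
  have /andP[i0 _] : 0 < node R m i < 1 by apply: (@node_lt1 R n) => //; exact: ltn_trans JN.
  have /andP[_ i1] : 0 < node R m i.+1 < 1 by apply: (@node_lt1 R n) => //; exact: leq_ltn_trans JN.
  have ii : node R m i < node R m i.+1 by apply: node_lt; rewrite // -(ltr0n R).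
  have [x01 /andP[xl xr]] := quantile_between i0 ii i1 hx.
  have [y01 /andP[yl yr]] := quantile_between i0 ii i1 hy.
  have := Jeta _ iJ; have := nodeS m i => nS iE.
  have mdel : 2 / m%:R < del by rewrite ltr_pdivrMr.
  rewrite -(cdf_muK x01) -(cdf_muK y01); apply/ltW/heineP.
    by apply/andP; split; lra.
  by rewrite ltr_norml; apply/andP; split; lra.
have sgn i : (i <= J)%N -> 0 < s * (-1) ^+ i * q.[quantile (node R m i)].
  by move=> iJ; apply: sP; [exact: leq_ltn_trans JN|exact: Jeta].
have := quadrature_error szn Jn M1 sgn mf fB osc.
rewrite distrC => /le_lt_trans; apply.
have : 2 * B * (1 - 2 / m%:R * J%:R) <= 2 * B * (2 * delta) by rewrite ler_pM2l// mulr_gt0.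
lra.
Unshelve. all: by end_near.
Qed.

End WeakConvergence.

Theorem theorem16p2 (R : realType) :
  exists mu : probability (measurableTypeR R) R,
    [/\ mu `<< @lebesgue_measure R,
        (forall A : set (measurableTypeR R), measurable A ->
          mu A = (\int[@lebesgue_measure R]_(x in A) (rho x)%:E)%E),
        weakly_converges (fun n : nat => empirical_zero_measure (Xi_tilde R n)) mu
      & weakly_converges (fun n : nat => empirical_zero_measure (Lambda_tilde R n)) mu].
Proof.
exists (@mu_law R); split => //.
- exact: mu_law_dominated.
- apply: (@weak_of_alternating R _ (fun n => 2 * n)%N _ _ (@Xi_alternating R)) => n.
    exact: size_even_poly_sum.
  by rewrite leqnn leqnSn.
- apply: (@weak_of_alternating R _ (fun n => (2 * n).+1) _ _ (@Lambda_alternating R)) => n.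
    exact: size_even_poly_sum.
  by rewrite leqnn leqnSn.
Qed.
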